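(* Let $n\ge4$ and $\frac1{\sqrt2}<t\le1$. Then for all $a\in S^{n-1}$, $$P(a,t)\le P(e_1,t)=\frac{\sqrt{n-1}}{(n-2)!}\,2^{n-1}(1-t)^{n-2}.$$ For $n=3$ the same holds for $\frac45<t\le1$.
   Context: $K=B(\ell_1^n)=\{x\in\mathbb{R}^n:\|x\|_1\le1\}$ is the cross-polytope with boundary $\partial K$. For $a\in S^{n-1}$, $t\in\mathbb{R}$, $H_t(a)=\{x\in\mathbb{R}^n:\langle a,x\rangle=t\}$ and the perimeter function is $P(a,t)=\mathrm{vol}_{n-2}(H_t(a)\cap\partial K)$. $e_1=(1,0,\dots,0)$. *)

(* Defs.v *)
From mathcomp Require Import all_boot all_order all_algebra.
From mathcomp Require Import all_classical all_reals all_analysis.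
Import Order.TTheory GRing.Theory Num.Theory.
Set Implicit Arguments. Unset Strict Implicit. Unset Printing Implicit Defensive.
Local Open Scope classical_set_scope.
Local Open Scope ring_scope.

Definition edist (R : realType) (n : nat) (x y : 'I_n -> R) : R :=
  Num.sqrt (\sum_(i < n) (x i - y i) ^+ 2).

(* diameter of a set (0 for the empty set) *)
Definition diam (R : realType) (n : nat) (U : set ('I_n -> R)) : \bar R :=
  ereal_sup ([set 0%E] `|` [set e | exists x y, U x /\ U y /\ e = (edist x y)%:E]).

Fixpoint ball_vol (R : realType) (k : nat) : R :=
  match k with
  | 0 => 1
  | 1 => 2
  | k'.+2 => 2 * pi / (k'.+2)%:R * ball_vol R k'
  end.

Definition hterm (R : realType) (n k : nat) (U : set ('I_n -> R)) : \bar R :=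
  if pselect (U = set0) is left _ then 0%E
  else ((ball_vol R k / 2 ^+ k) * fine (diam U) ^+ k)%:E.

Definition hcontent (R : realType) (n k : nat) (d : R) (A : set ('I_n -> R)) : \bar R :=
  ereal_inf [set S | exists U : nat -> set ('I_n -> R),
    A `<=` \bigcup_i U i /\ (forall i, (diam (U i) <= d%:E)%E) /\
    S = (\sum_(0 <= i <oo) hterm k (U i))%E].

Definition hausdorff (R : realType) (n k : nat) (A : set ('I_n -> R)) : \bar R :=
  ereal_sup [set x | exists2 d : R, 0 < d & x = hcontent k d A].

Definition l1norm (R : realType) (n : nat) (x : 'I_n -> R) : R := \sum_(i < n) `|x i|.
Definition dotp (R : realType) (n : nat) (a x : 'I_n -> R) : R := \sum_(i < n) a i * x i.

Definition hyperplane (R : realType) (n : nat) (a : 'I_n -> R) (t : R) : set ('I_n -> R) :=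
  [set x | dotp a x = t].

Definition cross_boundary (R : realType) (n : nat) : set ('I_n -> R) :=
  [set x | l1norm x = 1].

Definition on_sphere (R : realType) (n : nat) (a : 'I_n -> R) : Prop :=
  \sum_(i < n) a i ^+ 2 = 1.

Definition e1 (R : realType) (n : nat) : 'I_n -> R :=
  fun i => if val i == 0%N then 1 else 0.

Definition perimeter (R : realType) (n : nat) (a : 'I_n -> R) (t : R) : \bar R :=
  hausdorff (n - 2) (hyperplane a t `&` @cross_boundary R n).

(* Main.v *)
Require Import Defs.
From mathcomp Require Import all_boot all_order all_algebra.
From mathcomp Require Import all_classical all_reals all_analysis.
From mathcomp Require Import perm zify ring lra.
Import Order.TTheory GRing.Theory Num.Theory numFieldNormedType.Exports.
Set Implicit Arguments. Unset Strict Implicit. Unset Printing Implicit Defensive.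

(* For t > 1/sqrt 2 a hyperplane <a, x> = t that meets the cross-polytope cuts off, up to a
   signed permutation of the coordinates, the single vertex e_0.  Put b = a_0 - t, and for a
   sign vector ep put c_j = a_0 - ep_j a_j and X = a_0 + sum_j ep_j a_j.  The section of the
   boundary is the union over ep of the simplices with vertices e_0 + (b / c_j)(ep_j e_j - e_0),
   whose (n-2)-volume is b^(n-2) sqrt (n - X^2) / ((n-2)! prod_j c_j).
   With the weights 1 / prod_j c_j the sign ep_j has mean a_j / a_0, so X has mean 1 / a_0 >= 1,
   and the tangent line of the square root at X = 1 bounds the weighted sum of sqrt (n - X^2)
   by sqrt (n - 1) times the total weight prod_j 2 a_0 / (a_0^2 - a_j^2); what remains is an
   inequality in a_0 and t.

   The normalised Hausdorff measure H^k of a k-simplex is compared with its volume by counting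
   lattice points in an orthonormal frame.  The lower bound is a discrete isodiametric
   inequality (Steiner symmetrisation of finite subsets of Z^k) combined with the number
   w_k r^k + O(r^(k-1)) of lattice points in a ball.  The upper bound covers cubes efficiently:
   the infimum v of the costs of covers of the unit cube satisfies v <= th + (1 - th) v, where
   th > 0 is the volume of the inscribed ball. *)

(** * Discrete isodiametric inequality *)

(** The two comparisons with volume are hard for different reasons. The lower bound must hold for
    every cover, and this is the isodiametric inequality. The upper bound needs covers of
    asymptotically optimal cost, and covers by cubes alone are too expensive. Lattice points at
    scale N keep every argument finite: boundary errors are O(N^(k-1)) and disappear when leading
    coefficients in N are compared. Only the section for e_1 needs a lower bound, and there the
    2^(n-1) simplices are congruent. For every other a an upper bound is enough, so overlaps of the
    simplices are harmless. The bound 1 / sqrt 2 makes a_0 dominate: a_0^2 >= t^2 > 1/2 leaves less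
    than t^2 for the other coordinates together. In the final inequality the exponent n - 2 = 1 is
    the delicate one: both sides agree at a_0 = 1, and comparing slopes there asks for t >= 3/4. *)

Section Steiner.
Variables (k M : nat).
Let X := 'I_(M.*2.+1).
Let T := {ffun 'I_k -> X}.

Definition zc (v : 'I_(M.*2.+1)) : int := (v%:Z - M%:Z)%R.

Definition upd (x : {ffun 'I_k -> 'I_(M.*2.+1)}) i v : {ffun 'I_k -> 'I_(M.*2.+1)} :=
  [ffun j => if j == i then v else x j].

Definition dist2 (x y : {ffun 'I_k -> 'I_(M.*2.+1)}) : int :=
  (\sum_i (zc (x i) - zc (y i)) ^+ 2)%R.

Definition norm2 (x : {ffun 'I_k -> 'I_(M.*2.+1)}) : int := (\sum_i zc (x i) ^+ 2)%R.

Definition line (A : pred {ffun 'I_k -> 'I_(M.*2.+1)}) i x := #|[pred v | A (upd x i v)]|.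

(** Steiner symmetrisation on the grid: a line in direction i that meets A in m points receives the
    centred interval 2|z| + 1 <= m. For even m this has only m - 1 points, because a centred
    interval of integers has odd length. *)
Definition sym i (A : pred {ffun 'I_k -> 'I_(M.*2.+1)}) : pred {ffun 'I_k -> 'I_(M.*2.+1)} :=
  fun x => (absz (zc (x i))).*2.+1 <= line A i x.

Definition refl i (x : {ffun 'I_k -> 'I_(M.*2.+1)}) := upd x i (rev_ord (x i)).

Lemma zc_rev v : zc (rev_ord v) = (- zc v)%R.
Proof. rewrite /zc /=; have := ltn_ord v; lia. Qed.

Lemma updU x i v w : upd (upd x i v) i w = upd x i w.
Proof. by apply/ffunP => j; rewrite !ffunE; case: eqP. Qed.

Lemma upd_id x i : upd x i (x i) = x.
Proof. by apply/ffunP => j; rewrite !ffunE; case: eqP => // ->. Qed.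

Lemma card_le_interval (E : pred X) (u v : nat) :
  {in E, forall w : X, u <= w <= v} -> #|E| <= (v - u).+1.
Proof.
move=> H; have [z Ez|E0] := pickP E; last by rewrite eq_card0.
rewrite -[X in _ <= X]card_ord.
apply: (@leq_card_in _ _ (fun w : X => inord (w - u) : 'I_(v - u).+1) E) => a b Ea Eb.
have := H _ Ea; have := H _ Eb => hb ha /(congr1 val) /=.
rewrite !inordK; try lia.
by move=> h; apply/val_inj => /=; lia.
Qed.

Lemma spread (E : pred X) p : p.+1 <= #|E| -> exists u v : X, [/\ E u, E v & u + p <= v].
Proof.
move=> H; have [z Ez|E0] := pickP E; last by rewrite eq_card0 in H.
case: (arg_minnP (fun i : X => i : nat) Ez) => u Eu mu.
case: (arg_maxnP (fun i : X => i : nat) Ez) => v Ev mv.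
exists u, v; split => //.
have := @card_le_interval E u v.
have h : {in E, forall w : X, u <= w <= v} by move=> w Ew; apply/andP; split; [exact: mu | exact: mv].
move=> /(_ h); have := mu _ Ev; lia.
Qed.

Lemma card_centered m : m <= M.*2.+1 ->
  m <= #|[pred v : X | (absz (zc v)).*2.+1 <= m]|.+1.
Proof.
case: m => [|m] // mM.
pose h := m./2.
have hM : h <= M by rewrite /h; lia.
have le : #|'I_(h.*2.+1)| <= #|[pred v : X | (absz (zc v)).*2.+1 <= m.+1]|.
  pose f (j : 'I_(h.*2.+1)) : X := inord (M - h + j).
  have fE j : (f j : nat) = M - h + j by rewrite inordK //; have := ltn_ord j; lia.
  have fi : injective f.
    by move=> a b /(congr1 val) /=; rewrite !fE => e; apply/val_inj => /=; lia.
  rewrite -(card_imset _ fi).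
  apply: subset_leq_card; apply/fintype.subsetP => v /imsetP [j _ ->].
  rewrite inE /zc fE; have := ltn_ord j; rewrite /h; lia.
rewrite card_ord in le; move: le; rewrite /h; lia.
Qed.

(** A line in direction i is named by its point whose i-th index is 0. *)
Lemma sum_lines (F : T -> nat) i :
  \sum_x F x = \sum_(x : T | x i == ord0) \sum_v F (upd x i v).
Proof.
rewrite (partition_big (fun x : T => upd x i ord0) (fun x => x i == ord0)) /=; last first.
  by move=> x _; rewrite ffunE eqxx.
apply: eq_bigr => x /eqP x0.
rewrite (reindex_onto (fun v => upd x i v) (fun y : T => y i)) /=.
  apply: eq_bigl => v; rewrite updU ffunE eqxx eqxx andbT.
  by apply/eqP; rewrite -x0 upd_id.
by move=> y /eqP <-; rewrite updU upd_id.
Qed.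

Lemma card_lines i : #|[pred x : T | x i == ord0]| = (M.*2.+1) ^ k.-1.
Proof.
have c1 (U : finType) : \sum_(u : U) 1 = #|U| by rewrite -sum1_card.
have := sum_lines (fun=> 1) i; rewrite c1 card_ffun !card_ord.
have -> : \sum_(v < M.*2.+1) 1 = M.*2.+1 by rewrite c1 card_ord.
rewrite sum_nat_const.
have k0 : 0 < k by case: k i => [[]|].
rewrite -{1}(prednK k0) expnSr => /eqP; rewrite eqn_pmul2r // => /eqP <-.
by [].
Qed.

(** Each line loses at most one point, by parity, and there are (2M + 1)^(k-1) lines. *)
Lemma card_sym A i : #|A| <= #|sym i A| + (M.*2.+1) ^ k.-1.
Proof.
rewrite -(card_lines i) -!sum1_card big_mkcond (sum_lines _ i) /=.
rewrite [X in _ <= X + _]big_mkcond (sum_lines _ i) /= -big_split /=.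
apply: leq_sum => x _.
rewrite -!big_mkcond !sum1_card addn1.
have lx : line A i x <= M.*2.+1 by rewrite -[X in _ <= X]card_ord max_card.
apply: leq_trans (card_centered lx) _.
rewrite ltnS; apply: subset_leq_card; apply/fintype.subsetP => v.
rewrite !inE /in_mem /= /sym ffunE eqxx /line.
by congr (_ <= _); apply: eq_card => w; rewrite !inE updU.
Qed.

(** Let z, z' be the i-th coordinates of x, y. Their lines contain points of A with extremes u, v
    and u', v' such that v - u >= 2|z| and v' - u' >= 2|z'|. Since (v - u') + (v' - u) >= 2(|z| +
    |z'|), one of the pairs (v, u'), (u, v') is at least as far apart as z, z'. *)
Lemma sym_dist2 (A : pred T) i (D : int) :
  (forall x y, A x -> A y -> (dist2 x y <= D)%R) ->
  forall x y, sym i A x -> sym i A y -> (dist2 x y <= D)%R.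
Proof.
move=> H x y /spread [u [v [Au Av uv]]] /spread [u' [v' [Au' Av' uv']]].
have key w w' : (absz (zc (x i) - zc (y i)) <= absz (zc w - zc w'))%N ->
    A (upd x i w) -> A (upd y i w') -> (dist2 x y <= D)%R.
  move=> le Aw Aw'; apply: le_trans (H _ _ Aw Aw').
  apply: ler_sum => j _; rewrite !ffunE; case: eqP => [->|//].
  nia.
have [h|h] := leqP (absz (zc (x i) - zc (y i))) (absz (zc v - zc u')).
  exact: key Av Au'.
apply: (@key u v') => //.
move: h uv uv'; rewrite /zc; lia.
Qed.

Lemma sym_refl (A : pred T) i x : sym i A (refl i x) = sym i A x.
Proof.
rewrite /sym /refl !ffunE eqxx zc_rev; congr (_ <= _); first lia.
by apply: eq_card => w; rewrite !inE updU.
Qed.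

(** For j different from i, the reflection in j carries lines in direction i to lines with equally
    many points, so symmetries gained earlier survive. *)
Lemma sym_refl_stable (A : pred T) i j : (forall x, A (refl j x) = A x) ->
  forall x, sym i A (refl j x) = sym i A x.
Proof.
move=> H x; have [->|ij] := eqVneq j i; first exact: sym_refl.
rewrite /sym /refl ffunE eq_sym (negbTE ij); congr (_ <= _).
apply: eq_card => w; rewrite !inE -H /refl.
congr A; apply/ffunP => l; rewrite !ffunE; case: (l =P i) => [->|_].
  by rewrite eq_sym (negbTE ij).
by case: (l =P j) => // ->; rewrite eqxx (negbTE ij) rev_ordK.
Qed.

Lemma symmetrize (A : pred T) (D : int) (s : seq 'I_k) :
  (forall x y, A x -> A y -> (dist2 x y <= D)%R) ->
  exists B : pred T,
    [/\ #|A| <= #|B| + size s * (M.*2.+1) ^ k.-1,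
        forall x y, B x -> B y -> (dist2 x y <= D)%R &
        {in s, forall i x, B (refl i x) = B x}].
Proof.
move=> H; elim: s => [|i s [B [le dB sB]]].
  by exists A; split => //; rewrite mul0n addn0.
exists (sym i B); split.
- apply: leq_trans le _; rewrite mulSn addnA leq_add2r; exact: card_sym.
- exact: sym_dist2.
- move=> j; rewrite inE => /orP [/eqP ->|js] x; first exact: sym_refl.
  exact: sym_refl_stable (sB _ js) _.
Qed.

(* Once the set is invariant under all reflections it is centrally symmetric,
   so every point is at distance at most half the diameter from the origin. *)
Lemma discrete_isodiametric (A : pred T) (D : int) :
  (forall x y, A x -> A y -> (dist2 x y <= D)%R) ->
  #|A| <= #|[pred x : T | (norm2 x *+ 4 <= D)%R]| + k * (M.*2.+1) ^ k.-1.
Proof.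
move=> /(symmetrize (enum 'I_k)) [B [le dB sB]].
rewrite size_enum_ord in le; apply: leq_trans le _; rewrite leq_add2r.
apply: subset_leq_card; apply/fintype.subsetP => x Bx; rewrite inE.
pose opp (y : T) : T := [ffun i => rev_ord (y i)].
have Bo : B (opp x).
  (* The coordinates in s are reflected one at a time; [uniq] ensures that none is flipped back. *)
  suff H s : uniq s -> B [ffun i => if i \in s then rev_ord (x i) else x i].
    have := H (enum 'I_k) (enum_uniq _); congr B.
    by apply/ffunP => i; rewrite !ffunE mem_enum.
  elim: s => [_|i s IH /= /andP [nis us]].
    by move: Bx; rewrite /in_mem /=; congr B; apply/ffunP => i; rewrite ffunE.
  have := IH us; rewrite -(sB i) ?mem_enum //; congr B.
  apply/ffunP => j; rewrite !ffunE inE; case: (j =P i) => [->|//].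
  by rewrite (negbTE nis).
have := dB _ _ Bx Bo; congr (_ <= _)%R.
rewrite /dist2 /norm2 -sumrMnl; apply: eq_bigr => i _.
by rewrite ffunE zc_rev; ring.
Qed.

End Steiner.

Local Open Scope ring_scope.

(** * Lattice points in balls *)

Section DiscArea.
Variable R : realType.
Implicit Types x y u v : R.

Let le_cos x y : 0 <= x -> x <= y -> y <= pi -> cos y <= cos x.
Proof.
move=> x0 xy yp; move: xy; rewrite le_eqVlt => /orP [/eqP ->//|xy].
by apply: ltW; rewrite ltr_cos // !in_itv /= ?x0 ?yp ?andbT; lra.
Qed.

Lemma le_derive_sub (f df : R -> R) x y : x <= y ->
  (forall z : R, is_derive z 1 f (df z)) -> (forall z, x <= z <= y -> 0 <= df z) ->
  f x <= f y.
Proof.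
rewrite le_eqVlt => /orP [/eqP ->//|xy] fd d0.
have [|c /[!in_itv] /= /andP [xc cy] e] := MVT xy (fun z _ => fd z).
  apply/continuous_subspaceT => z; apply/differentiable_continuous.
  by apply/derivable1_diffP; apply: ex_derive.
rewrite -subr_ge0 e; apply: mulr_ge0; last by rewrite subr_ge0 ltW.
by apply: d0; rewrite !ltW.
Qed.

(* Twice the area under the unit circle above [0, sin x] *)
Definition sector x := sin x * cos x + x.

Lemma is_derive_sector x : is_derive x 1 sector (2 * cos x ^+ 2).
Proof.
rewrite /sector; apply: is_derive_eq.
rewrite /GRing.scale /=; have := cos2Dsin2 x; rewrite -!expr2; lra.
Qed.

(** The strip of the half disc over [sin x, sin y] lies between rectangles of heights cos y and cos
    x. The proof compares the derivative 2 cos^2 with 2 cos y cos and 2 cos x cos. *)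
Lemma sector_bounds x y : 0 <= x -> x <= y -> y <= pi / 2 ->
  2 * (sin y - sin x) * cos y <= sector y - sector x <= 2 * (sin y - sin x) * cos x.
Proof.
move=> x0 xy yp; have pp := pi_gt0 R.
have cp z : x <= z <= y -> 0 <= cos z by move=> /andP [? ?]; apply: cos_ge0_pihalf; lra.
apply/andP; split.
- pose f z := sector z - 2 * cos y * sin z.
  have : f x <= f y.
    apply: (@le_derive_sub f (fun z => 2 * cos z ^+ 2 - 2 * cos y * cos z)) => //.
      move=> z; rewrite /f; have := is_derive_sector z => H; apply: is_derive_eq.
      by rewrite /GRing.scale /=; ring.
    move=> z /[dup] zi /andP [xz zy]; have c1 := cp _ zi.
    have : cos y <= cos z by apply: le_cos; lra.
    nra.
  rewrite /f; lra.
- pose f z := 2 * cos x * sin z - sector z.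
  have : f x <= f y.
    apply: (@le_derive_sub f (fun z => 2 * cos x * cos z - 2 * cos z ^+ 2)) => //.
      move=> z; rewrite /f; have := is_derive_sector z => H; apply: is_derive_eq.
      by rewrite /GRing.scale /=; ring.
    move=> z /[dup] zi /andP [xz zy]; have c1 := cp _ zi.
    have : cos z <= cos x by apply: le_cos; lra.
    nra.
  rewrite /f; lra.
Qed.

(** The integral of sqrt (1 - s^2) over [0, u], in closed form. *)
Definition disc u := sector (asin u) / 2.

Lemma asin_ge0 u : 0 <= u <= 1 -> 0 <= asin u.
Proof.
move=> /andP [u0 u1]; have B : -1 <= u <= 1 by lra.
rewrite leNgt; apply/negP => h.
have : sin (asin u) < 0.
  by have := asin_geNpi2 B; have := pi_gt0 R => p1 p2; rewrite -(opprK (asin u)) sinN oppr_lt0 sin_gt0_pi //; lra.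
by rewrite asinK ?in_itv //=; lra.
Qed.

Lemma asin_le u v : 0 <= u -> u <= v -> v <= 1 -> asin u <= asin v.
Proof.
move=> u0 uv v1; have Bu : -1 <= u <= 1 by lra.
have Bv : -1 <= v <= 1 by lra.
rewrite leNgt; apply/negP => h.
have : sin (asin v) < sin (asin u).
  rewrite ltr_sin // in_itv /=; first by rewrite asin_geNpi2 // asin_lepi2.
  by rewrite asin_geNpi2 // asin_lepi2.
by rewrite !asinK ?in_itv //=; lra.
Qed.

Lemma disc_bounds u v : 0 <= u -> u <= v -> v <= 1 ->
  (v - u) * Num.sqrt (1 - v ^+ 2) <= disc v - disc u <= (v - u) * Num.sqrt (1 - u ^+ 2).
Proof.
move=> u0 uv v1; have Bu : -1 <= u <= 1 by lra.
have Bv : -1 <= v <= 1 by lra.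
have au : 0 <= asin u by apply: asin_ge0; lra.
have := sector_bounds au (asin_le u0 uv v1) (asin_lepi2 Bv).
rewrite !cos_asin // !asinK ?in_itv //= /disc; lra.
Qed.

Lemma disc0 : disc 0 = 0.
Proof.
have pp := pi_gt0 R.
have a0 : asin 0 = 0 :> R by rewrite -{1}(sin0 R) sinK // in_itv /=; lra.
by rewrite /disc a0 /sector sin0 mul0r add0r mul0r.
Qed.

Lemma disc1 : disc 1 = pi / 4.
Proof.
have pp := pi_gt0 R.
have a0 : asin 1 = pi / 2 :> R by rewrite -{1}(sin_pihalf R) sinK // in_itv /=; lra.
rewrite /disc a0 /sector cos_pihalf; lra.
Qed.

(* Riemann sums of sqrt (1 - u^2) with mesh 1/r, compared with [disc] interval by interval. *)
Lemma sum_sqrt_bounds (S q : nat) : (0 < S)%N -> (q ^ 2 <= S < q.+1 ^ 2)%N ->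
  pi / 4 * S%:R - Num.sqrt (S%:R : R) <=
     \sum_(1 <= j < q.+1) Num.sqrt (S%:R - j%:R ^+ 2 : R) <= pi / 4 * S%:R.
Proof.
move=> S0 /andP [qS Sq].
set r := Num.sqrt (S%:R : R).
have SR : 0 < (S%:R : R) by rewrite ltr0n.
have r0 : 0 < r by rewrite sqrtr_gt0.
have r2 : r ^+ 2 = S%:R by rewrite sqr_sqrtr // ltW.
have sc (j : nat) : (j <= q)%N -> Num.sqrt (S%:R - j%:R ^+ 2) = r * Num.sqrt (1 - (j%:R / r) ^+ 2) :> R.
  move=> jq; rewrite -[r * _]/(Num.sqrt _ * _) -sqrtrM ?ltW //.
  by congr Num.sqrt; rewrite -r2; field; rewrite gt_eqF.
have jr (j : nat) : (j <= q)%N -> j%:R / r <= 1.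
  move=> jq; rewrite ler_pdivrMr // mul1r -(ler_pXn2r (n:=2)) ?nnegrE ?ler0n ?(ltW r0) //.
  by rewrite r2 -natrX ler_nat; apply: leq_trans qS; rewrite leq_exp2r.
have j0 (j : nat) : 0 <= j%:R / r by rewrite divr_ge0 // ltW.
have up j : (j <= q)%N -> (disc (j%:R / r)) * r ^+ 2 >= \sum_(1 <= i < j.+1) Num.sqrt (S%:R - i%:R ^+ 2).
  elim: j => [|j IH] jq; first by rewrite big_geq // mul0r disc0 mul0r.
  rewrite big_nat_recr //= sc //.
  have le1 : j%:R / r <= j.+1%:R / r by rewrite ler_pM2r ?invr_gt0 // ler_nat.
  have /andP [h _] := disc_bounds (j0 j) le1 (jr _ jq).
  have e : j.+1%:R / r - j%:R / r = r^-1 by rewrite -mulrBl -natrB // subSnn mul1r.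
  rewrite e in h.
  have := IH (ltnW jq).
  set s := Num.sqrt _ in h *.
  have : r^-1 * s * r ^+ 2 <= (disc (j.+1%:R / r) - disc (j%:R / r)) * r ^+ 2.
    by rewrite ler_pM2r // exprn_gt0.
  have -> : r^-1 * s * r ^+ 2 = r * s by field; rewrite gt_eqF.
  lra.
have dn j : (j <= q)%N -> (disc (j%:R / r)) * r ^+ 2 <= \sum_(0 <= i < j) Num.sqrt (S%:R - i%:R ^+ 2).
  elim: j => [|j IH] jq; first by rewrite big_geq // mul0r disc0 mul0r.
  rewrite big_nat_recr //= sc ?(ltnW jq) //.
  have le1 : j%:R / r <= j.+1%:R / r by rewrite ler_pM2r ?invr_gt0 // ler_nat.
  have /andP [_ h] := disc_bounds (j0 j) le1 (jr _ jq).
  have e : j.+1%:R / r - j%:R / r = r^-1 by rewrite -mulrBl -natrB // subSnn mul1r.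
  rewrite e in h.
  have := IH (ltnW jq).
  set s := Num.sqrt _ in h *.
  have : (disc (j.+1%:R / r) - disc (j%:R / r)) * r ^+ 2 <= r^-1 * s * r ^+ 2.
    by rewrite ler_pM2r // exprn_gt0.
  have -> : r^-1 * s * r ^+ 2 = r * s by field; rewrite gt_eqF.
  lra.
apply/andP; split.
(* The sum from 0 to q also covers the incomplete interval [q/r, 1], which is shorter than 1/r. Its
   term at 0 equals [r], the amount subtracted in the claim. *)
- have : pi / 4 * S%:R <= \sum_(0 <= i < q.+1) Num.sqrt (S%:R - i%:R ^+ 2) :> R.
    have /andP [_ h] := disc_bounds (j0 q) (jr _ (leqnn q)) (lexx 1).
    have := dn _ (leqnn q); rewrite big_nat_recr //= sc // -disc1 -r2.
    set s := Num.sqrt _ in h *.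
    have s0 : 0 <= s by rewrite sqrtr_ge0.
    have : (disc 1 - disc (q%:R / r)) * r ^+ 2 <= r^-1 * s * r ^+ 2.
      rewrite ler_pM2r ?exprn_gt0 //; apply: (le_trans h).
      rewrite ler_wpM2r //.
      rewrite -[X in X - _](divff (x:=r)) ?gt_eqF // -mulrBl -[leRHS]mul1r ler_pM2r ?invr_gt0 //.
      rewrite lerBlDr nat1r -(ler_pXn2r (n:=2)) ?nnegrE ?ler0n ?(ltW r0) //.
      by rewrite r2 -natrX ler_nat ltnW.
    have -> : r^-1 * s * r ^+ 2 = r * s by field; rewrite gt_eqF.
    lra.
  rewrite big_nat_recl //= expr0n /= subr0 -/r big_add1 /=; lra.
- apply: (le_trans (up _ (leqnn q))); rewrite r2 ler_pM2r //.
  have /andP [h _] := disc_bounds (j0 q) (jr _ (leqnn q)) (lexx 1).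
  move: h; rewrite expr1n subrr sqrtr0 mulr0 disc1; lra.
Qed.

End DiscArea.

Lemma nat_sqrt_ex (S : nat) : exists q, (q ^ 2 <= S < q.+1 ^ 2)%N.
Proof.
elim: S => [|S [q /andP [h1 h2]]]; first by exists 0%N.
have [h|h] := leqP (q.+1 ^ 2) S.+1; last by exists q; rewrite h andbT; lia.
by exists q.+1; rewrite h /=; nia.
Qed.

(** * Lattice points in balls, counted slice by slice *)

Section LatticePoints.
Variables (R : realType) (M : nat).
Implicit Types f g h : nat -> R.

(** Slicing a ball of squared radius S by its first coordinate v leaves balls of squared radius S -
    v^2, so [step] turns counts in dimension k into counts in dimension k + 1. Radii are stored as
    squares to stay in the naturals. *)
Definition step f S : R :=
  \sum_(v < M.*2.+1) if (absz (zc v) ^ 2 <= S)%N then f (S - absz (zc v) ^ 2)%N else 0.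

Definition ball_count k (S : nat) : R :=
  #|[pred x : {ffun 'I_k -> 'I_(M.*2.+1)} | norm2 x <= S%:Z]|%:R.

Lemma ball_count0 S : ball_count 0 S = 1.
Proof.
rewrite /ball_count (eq_card (B := predT)) => [|x].
  by rewrite card_ffun !card_ord expn0.
by rewrite !inE /norm2 big_ord0.
Qed.

Definition fcons k v (y : {ffun 'I_k -> 'I_(M.*2.+1)}) : {ffun 'I_k.+1 -> 'I_(M.*2.+1)} :=
  [ffun i => if unlift ord0 i is Some j then y j else v].

Lemma norm2_fcons k v (y : {ffun 'I_k -> 'I_(M.*2.+1)}) :
  norm2 (fcons v y) = zc v ^+ 2 + norm2 y.
Proof.
rewrite /norm2 big_ord_recl ffunE unlift_none; congr (_ + _).
by apply: eq_bigr => i _; rewrite ffunE liftK.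
Qed.

Lemma sum_fcons k (F : {ffun 'I_k.+1 -> 'I_(M.*2.+1)} -> R) :
  \sum_x F x = \sum_v \sum_y F (fcons v y).
Proof.
rewrite pair_big /=.
pose hd (x : {ffun 'I_k.+1 -> 'I_(M.*2.+1)}) := (x ord0, [ffun j => x (lift ord0 j)]).
rewrite (reindex_onto (fun p : 'I_(M.*2.+1) * {ffun 'I_k -> 'I_(M.*2.+1)} => fcons p.1 p.2) hd) /=.
  apply: eq_bigl => -[v y] /=; rewrite /hd ffunE unlift_none.
  have -> : [ffun j => fcons v y (lift ord0 j)] = y by apply/ffunP => j; rewrite !ffunE liftK.
  by rewrite eqxx.
move=> x _; apply/ffunP => i; rewrite ffunE /hd /=.
by case: unliftP => [j ->|->] //; rewrite ffunE.
Qed.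

Lemma ball_countS k S : ball_count k.+1 S = step (ball_count k) S.
Proof.
rewrite /ball_count -sum1_card natr_sum big_mkcond sum_fcons /step.
apply: eq_bigr => v _; rewrite -big_mkcond /=.
have [le|gt] := leqP.
  rewrite -sum1_card natr_sum; apply: eq_bigl => y.
  rewrite !inE norm2_fcons; apply/idP/idP; lia.
rewrite big_pred0 // => y; rewrite !inE norm2_fcons.
have : 0 <= norm2 y by apply: sumr_ge0 => i _; apply: sqr_ge0.
lia.
Qed.

Lemma eq_step f g S : (forall s, (s <= S)%N -> f s = g s) -> step f S = step g S.
Proof. by move=> H; apply: eq_bigr => v _; case: leqP => // _; apply: H; exact: leq_subr. Qed.

Lemma ball_count_iter k S : ball_count k S = iter k step (fun=> 1) S.
Proof.
elim: k S => [|k IH] S; first exact: ball_count0.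
by rewrite ball_countS iterS; apply: eq_step => s _.
Qed.

Lemma step_dist f g h S : (forall s, (s <= S)%N -> `|f s - g s| <= h s) ->
  `|step f S - step g S| <= step h S.
Proof.
move=> H; rewrite /step -sumrB; apply: (le_trans (ler_norm_sum _ _ _)).
apply: ler_sum => v _; case: leqP => _; last by rewrite subrr normr0.
by apply: H; exact: leq_subr.
Qed.

Lemma iter_step_dist k f g h S : (forall s, (s <= S)%N -> `|f s - g s| <= h s) ->
  `|iter k step f S - iter k step g S| <= iter k step h S.
Proof.
elim: k S => [|k IH] S H; first exact: H.
by rewrite !iterS; apply: step_dist => s sS; apply: IH => s' s's; apply: H; lia.
Qed.

Lemma stepZ c f S : step (fun s => c * f s) S = c * step f S.
Proof. by rewrite /step mulr_sumr; apply: eq_bigr => v _; case: ifP; rewrite ?mulr0. Qed.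

Lemma iter_stepZ k c f S : iter k step (fun s => c * f s) S = c * iter k step f S.
Proof.
elim: k S => [|k IH] S //; rewrite !iterS -stepZ.
by apply: eq_step => s _.
Qed.

Lemma le_step f g S : (forall s, (s <= S)%N -> f s <= g s) -> step f S <= step g S.
Proof.
move=> H; apply: ler_sum => v _; case: leqP => // _; apply: H; exact: leq_subr.
Qed.

Lemma le_iter_step k f g S : (forall s, (s <= S)%N -> f s <= g s) ->
  iter k step f S <= iter k step g S.
Proof.
elim: k S => [|k IH] S H; first exact: H.
by rewrite !iterS; apply: le_step => s sS; apply: IH => s' s's; apply: H; lia.
Qed.

Lemma step_sum f S : step (fun s => \sum_(i < s) f i) S = \sum_(i < S) step f i.
Proof.
rewrite /step exchange_big /=; apply: eq_bigr => v _.
set a := (_ ^ 2)%N.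
rewrite -!(big_mkord xpredT (fun i => if (a <= i)%N then f (i - a)%N else 0)).
have [aS|Sa] := leqP a S.
  have z : \sum_(0 <= i < a) (if (a <= i)%N then f (i - a)%N else 0) = 0.
    by rewrite big_nat_cond big1 // => i /andP [/andP [_ ia] _]; rewrite leqNgt ia.
  rewrite (big_cat_nat (n := a)) //= z add0r.
  rewrite -[X in \sum_(X <= _ < _) _]add0n big_addn -(big_mkord xpredT (fun i => f i)); apply: eq_bigr => i _.
  by rewrite leq_addl addnK.
rewrite big_nat_cond big1 // => i /andP [/andP [_ iS] _].
by rewrite leqNgt (ltn_trans iS Sa).
Qed.

(** The identity is the partial sum of the constant 1, and [step] commutes with partial sums. This
    turns the area pi s of two coordinates into a sum of counts over smaller balls. *)
Lemma iter_step_id k S : iter k step (fun s => s%:R) S = \sum_(i < S) iter k step (fun=> 1) i.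
Proof.
elim: k S => [|k IH] S; first by rewrite sumr_const card_ord.
rewrite iterS (@eq_step _ (fun s => \sum_(i < s) iter k step (fun=> 1) i)); last by move=> s _; exact: IH.
by rewrite step_sum.
Qed.

Lemma sum_zc (F : nat -> R) :
  \sum_(v < M.*2.+1) F (absz (zc v)) = F 0%N + 2 * \sum_(1 <= j < M.+1) F j.
Proof.
rewrite /zc -(big_mkord xpredT (fun v => F (absz (v%:Z - M%:Z)))).
rewrite (big_cat_nat (n := M)) //=; last by lia.
rewrite [X in _ + X]big_ltn; last by lia.
have -> : \sum_(0 <= i < M) F (absz (i%:Z - M%:Z)) = \sum_(1 <= j < M.+1) F j.
  rewrite big_nat_rev big_add1 /=; apply: eq_big_nat => i iM; congr F; lia.
have -> : \sum_(M.+1 <= i < M.*2.+1) F (absz (i%:Z - M%:Z)) = \sum_(1 <= j < M.+1) F j.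
  have -> : M.+1 = (1 + M)%N by lia.
  have -> : M.*2.+1 = (1 + M + M)%N by lia.
  rewrite big_addn; have -> : (1 + M + M - M = 1 + M)%N by lia.
  by apply: eq_big_nat => i iM; congr F; lia.
rewrite subrr; ring.
Qed.

Lemma stepE f S : step f S =
  f S + 2 * \sum_(1 <= j < M.+1) if (j ^ 2 <= S)%N then f (S - j ^ 2)%N else 0.
Proof. by rewrite /step (sum_zc (fun j => if (j ^ 2 <= S)%N then f (S - j ^ 2)%N else 0)) /= subn0. Qed.

Lemma sum_le_sqrt (F : nat -> R) S q : (q ^ 2 <= S < q.+1 ^ 2)%N -> (S <= M ^ 2)%N ->
  \sum_(1 <= j < M.+1) (if (j ^ 2 <= S)%N then F j else 0) = \sum_(1 <= j < q.+1) F j.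
Proof.
move=> /andP [h1 h2] h3.
have qM : (q <= M)%N by rewrite leqNgt; apply/negP => h; nia.
rewrite (big_cat_nat (n := q.+1)) //= [X in _ + X]big_nat_cond [X in _ + X]big1 ?addr0.
  by apply: eq_big_nat => j /andP [_ jq]; rewrite ifT //; nia.
by move=> j /andP [/andP [qj _] _]; rewrite ifF //; apply/negbTE; rewrite -ltnNge; nia.
Qed.

Lemma step1_bound S : (S <= M ^ 2)%N ->
  `|step (fun=> 1) S - 2 * Num.sqrt (S%:R : R)| <= 1.
Proof.
move=> SM; have [q hq] := nat_sqrt_ex S.
rewrite stepE (sum_le_sqrt (fun=> 1) hq SM).
rewrite big_const_nat iter_addr_0 subn1 /=.
move: hq => /andP [h1 h2].
set r := Num.sqrt _.
have r0 : 0 <= r by rewrite sqrtr_ge0.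
have r2 : r ^+ 2 = S%:R by rewrite sqr_sqrtr // ler0n.
have l1 : q%:R <= r.
  by rewrite -(ler_pXn2r (n:=2)) ?nnegrE // r2 -natrX ler_nat.
have l2 : r <= q%:R + 1.
  by rewrite natr1 -(ler_pXn2r (n:=2)) ?nnegrE // r2 -natrX ler_nat ltnW.
rewrite ler_norml; lra.
Qed.

(** Gauss's circle estimate: each slice has a count within 1 of its length 2 sqrt (S - j^2), there
    are about 2 sqrt S slices, and the lengths are summed by [sum_sqrt_bounds]. The assumption S <=
    M^2 keeps the disc inside the box. *)
Lemma step2_bound S : (S <= M ^ 2)%N ->
  `|step (step (fun=> 1)) S - pi * S%:R| <= 4 * (Num.sqrt (S%:R : R) + 1).
Proof.
move=> SM.
have [->|S0] := posnP S.
  rewrite mulr0 subr0 sqrtr0 add0r mulr1 stepE stepE.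
  have z F : \sum_(1 <= j < M.+1) (if (j ^ 2 <= 0)%N then F j else 0) = 0 :> R.
    by rewrite (@sum_le_sqrt _ _ 0) // big_geq.
  by rewrite !z mulr0 !addr0 ger0_norm; lra.
have [q hq] := nat_sqrt_ex S.
set r := Num.sqrt _.
have r0 : 0 <= r by rewrite sqrtr_ge0.
have b1 := step1_bound SM; rewrite -/r in b1.
have d := @step_dist (step (fun=> 1)) (fun s => 2 * Num.sqrt s%:R) (fun=> 1) S.
have {}d := d (fun s sS => step1_bound (leq_trans sS SM)).
have e : step (fun s => 2 * Num.sqrt s%:R) S =
    2 * r + 4 * \sum_(1 <= j < q.+1) Num.sqrt (S%:R - j%:R ^+ 2 : R).
  rewrite stepE (sum_le_sqrt (fun j => 2 * Num.sqrt (S - j ^ 2)%N%:R) hq SM).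
  rewrite -mulr_sumr mulrA; congr (_ + _ * _); first lra.
  apply: eq_big_nat => j /andP [_ jq]; rewrite natrB ?natrX //.
  by move: hq jq => /andP [? ?] ?; nia.
rewrite e in d.
have := sum_sqrt_bounds R S0 hq; rewrite -/r => /andP [c1 c2].
move: b1 d; rewrite !ler_norml => /andP [? ?] /andP [? ?]; lra.
Qed.

(** The innermost two of the k + 2 steps are replaced by the area pi s, and [iter_step_id] evaluates
    the other k. Going up by two dimensions matches the recursion of [ball_vol]. *)
Lemma ball_count_step2 k S : (S <= M ^ 2)%N ->
  `|ball_count k.+2 S - pi * \sum_(i < S) ball_count k i| <=
    4 * (Num.sqrt S%:R + 1) * ball_count k S.
Proof.
move=> SM.
under eq_bigr do rewrite ball_count_iter.
rewrite -iter_step_id -iter_stepZ !ball_count_iter !iterSr.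
apply: (le_trans (iter_step_dist _ (h := fun s => 4 * (Num.sqrt s%:R + 1)) _)).
  by move=> s sS; apply: step2_bound; apply: leq_trans SM.
rewrite -iter_stepZ; apply: le_iter_step => s sS.
by rewrite mulr1 ler_pM2l // lerD2r ler_wsqrtr // ler_nat.
Qed.

End LatticePoints.

(** * Asymptotics of the number of lattice points in a ball *)

Section Asymptotics.
Variable R : realType.

Lemma ball_vol_gt0 k : 0 < ball_vol R k.
Proof.
suff: 0 < ball_vol R k /\ 0 < ball_vol R k.+1 by case.
elim: k => [|k [h1 h2]]; first by split => /=.
split => //=; rewrite mulr_gt0 // divr_gt0 //; first by have := pi_gt0 R; lra.
Qed.

(** With x = sqrt i and y = sqrt (i + 1) these are mean value bounds for s^((k+2)/2) on [i, i + 1],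
    to be telescoped. The induction goes by two, since only y^2 - x^2 = 1 is known exactly. *)
Lemma sqr_step_pow (x y : R) k : 0 <= x -> 0 <= y -> y ^+ 2 = x ^+ 2 + 1 ->
  k.+2%:R * x ^+ k <= 2 * (y ^+ k.+2 - x ^+ k.+2) <= k.+2%:R * y ^+ k.
Proof.
move=> x0 y0 e.
have xy : x <= y by nra.
have d : (y - x) * (y + x) = 1 by nra.
suff H m : (m.+2%:R * x ^+ m <= 2 * (y ^+ m.+2 - x ^+ m.+2) <= m.+2%:R * y ^+ m) /\
  (m.+3%:R * x ^+ m.+1 <= 2 * (y ^+ m.+3 - x ^+ m.+3) <= m.+3%:R * y ^+ m.+1).
  by case: (H k).
elim: m => [|m [/andP [l u] IH]].
  split; first by rewrite !expr0 e; lra.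
  rewrite !expr1.
  have -> : y ^+ 3 = y * y ^+ 2 by ring.
  have -> : x ^+ 3 = x * x ^+ 2 by ring.
  have h : 0 <= x * (y - x) ^+ 2 by rewrite mulr_ge0 // sqr_ge0.
  apply/andP; split; first by have := sqr_ge0 (y - x); nra.
  have : 2 * (x ^+ 2 * (y - x)) = x * ((y - x) * (y + x)) - x * (y - x) ^+ 2 by ring.
  rewrite d; nra.
split => //.
have ex : x ^+ m.+4 = x ^+ 2 * x ^+ m.+2 by rewrite -exprD.
have ey : y ^+ m.+4 = y ^+ 2 * y ^+ m.+2 by rewrite -exprD.
have ex2 : x ^+ m.+2 = x ^+ 2 * x ^+ m by rewrite -exprD.
have ey2 : y ^+ m.+2 = y ^+ 2 * y ^+ m by rewrite -exprD.
have lexy : x ^+ m.+2 <= y ^+ m.+2 by rewrite lerXn2r.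
rewrite -[m.+4]addn2 natrD !(mulrDl m.+2%:R).
apply/andP; split.
  have := ler_wpM2l (sqr_ge0 x) l.
  have -> : x ^+ 2 * (m.+2%:R * x ^+ m) = m.+2%:R * x ^+ m.+2 by rewrite ex2; ring.
  rewrite addn2 ex ey e; move: lexy.
  move: (x ^+ m.+2) (y ^+ m.+2) (x ^+ 2) (m.+2%:R) => a b c d1.
  lra.
have := ler_wpM2l (sqr_ge0 y) u.
have -> : y ^+ 2 * (m.+2%:R * y ^+ m) = m.+2%:R * y ^+ m.+2 by rewrite ey2; ring.
rewrite addn2 ex ey; move: lexy.
have -> : x ^+ 2 = y ^+ 2 - 1 by rewrite e addrK.
move: (x ^+ m.+2) (y ^+ m.+2) (y ^+ 2) (m.+2%:R) => a b c d1.
lra.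
Qed.

Lemma sum_sqrt_pow k S :
  `|\sum_(i < S) Num.sqrt (i%:R : R) ^+ k - 2 / k.+2%:R * Num.sqrt S%:R ^+ k.+2| <=
    Num.sqrt S%:R ^+ k.
Proof.
have sr (i : nat) : 0 <= Num.sqrt (i%:R : R) by rewrite sqrtr_ge0.
have s2 (i : nat) : Num.sqrt (i.+1%:R : R) ^+ 2 = Num.sqrt i%:R ^+ 2 + 1.
  by rewrite !sqr_sqrtr ?natr1.
have k0 : 0 < k.+2%:R :> R by rewrite ltr0n.
have H i := sqr_step_pow k (sr i) (sr i.+1) (s2 i).
have up : \sum_(i < S) Num.sqrt (i%:R : R) ^+ k <= 2 / k.+2%:R * Num.sqrt S%:R ^+ k.+2.
  elim: S => [|S IH]; first by rewrite big_ord0 sqrtr0 expr0n mulr0.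
  rewrite big_ord_recr /=; have /andP [h _] := H S.
  apply: (le_trans (lerD IH (lexx _))).
  rewrite -lerBrDl -mulrBr mulrAC mulrC ler_pdivlMl //; lra.
have dn : 2 / k.+2%:R * Num.sqrt S%:R ^+ k.+2 <=
    \sum_(i < S) Num.sqrt (i%:R : R) ^+ k + Num.sqrt S%:R ^+ k.
  elim: S {up} => [|S IH]; first by rewrite big_ord0 sqrtr0 expr0n mulr0 add0r exprn_ge0.
  rewrite big_ord_recr /=; have /andP [_ h] := H S.
  apply: (le_trans _ (lerD IH (lexx _))).
  rewrite -lerBlDl -mulrBr mulrAC mulrC ler_pdivrMl //; lra.
move: up dn (exprn_ge0 k (sr S)); rewrite ler_norml.
move: (\sum_(i < S) _) (2 / _ * _) (Num.sqrt _ ^+ k) => A B z; lra.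
Qed.

(** The error has the order of the surface of the ball, uniformly in M. Two consecutive dimensions
    are carried through the induction because [ball_count_step2] raises the dimension by two. *)
Lemma ball_count_asymp k : exists2 C : R, 0 <= C & forall M S, (S <= M ^ 2)%N ->
  `|ball_count R M k S - ball_vol R k * Num.sqrt S%:R ^+ k| <= C * (Num.sqrt S%:R + 1) ^+ k.-1.
Proof.
suff H m : (exists2 C : R, 0 <= C & forall M S, (S <= M ^ 2)%N ->
  `|ball_count R M m.+1 S - ball_vol R m.+1 * Num.sqrt S%:R ^+ m.+1| <=
     C * (Num.sqrt S%:R + 1) ^+ m) /\
  (exists2 C : R, 0 <= C & forall M S, (S <= M ^ 2)%N ->
  `|ball_count R M m.+2 S - ball_vol R m.+2 * Num.sqrt S%:R ^+ m.+2| <=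
     C * (Num.sqrt S%:R + 1) ^+ m.+1).
  case: k => [|k]; last by have [] := H k.
  by exists 0 => // M S _; rewrite ball_count0 /= expr0 !mulr1 subrr normr0.
elim: m => [|m [[C C0 HC] IH]]; [split|split => //].
- exists 1 => // M S SM; rewrite ball_count_iter !expr1 expr0 mul1r.
  exact: step1_bound.
- exists 4 => // M S SM; rewrite ball_count_iter expr1 /= sqr_sqrtr ?ler0n //.
  have -> : 2 * pi / 2 * 1 = pi :> R by lra.
  exact: step2_bound.
set w := ball_vol R m.+1.
have w0 : 0 < w by exact: ball_vol_gt0.
(* The three terms are the error of [ball_count_step2] (h6), the inductive error of the inner counts
   (h7) and that of the sum of powers (h8). *)
exists (4 * (w + C) + pi * C + pi * w).
  by have := pi_gt0 R; nra.
move=> M S SM.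
set r := Num.sqrt _; have r0 : 0 <= r by rewrite sqrtr_ge0.
have r2 : r ^+ 2 = S%:R by rewrite sqr_sqrtr.
have p0 := pi_gt0 R.
have e : ball_vol R m.+3 * r ^+ m.+3 = pi * (w * (2 / m.+3%:R * r ^+ m.+3)).
  rewrite -[ball_vol R m.+3]/(2 * pi / m.+3%:R * w).
  by move: (m.+3%:R^-1) (r ^+ m.+3) => a b; ring.
rewrite e.
have h1 := ball_count_step2 R m.+1 SM; rewrite -/r in h1.
have h2 : ball_count R M m.+1 S <= (w + C) * (r + 1) ^+ m.+1.
  have := HC M S SM; rewrite -/r -/w ler_norml => /andP [_ h].
  have a1 : r ^+ m.+1 <= (r + 1) ^+ m.+1 by rewrite lerXn2r ?nnegrE; lra.
  have a2 : (r + 1) ^+ m <= (r + 1) ^+ m.+1 by apply: ler_weXn2l => //; lra.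
  move: h (ler_wpM2l (ltW w0) a1) (ler_wpM2l C0 a2).
  by move: (ball_count _ _ _ _) (r ^+ m.+1) ((r + 1) ^+ m) ((r + 1) ^+ m.+1) => a b c d; lra.
have h3 : `|\sum_(i < S) ball_count R M m.+1 i - w * \sum_(i < S) Num.sqrt i%:R ^+ m.+1| <=
    C * (r + 1) ^+ m.+2.
  rewrite mulr_sumr -sumrB; apply: (le_trans (ler_norm_sum _ _ _)).
  apply: (@le_trans _ _ (\sum_(i < S) C * (r + 1) ^+ m)).
    apply: ler_sum => i _; apply: (le_trans (HC _ _ _)).
      by apply: leq_trans SM; exact: ltnW.
    apply: ler_wpM2l => //; apply: lerXn2r; rewrite ?nnegrE ?addr_ge0 ?sqrtr_ge0 //.
    by rewrite lerD2r ler_wsqrtr // ler_nat ltnW.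
  rewrite sumr_const card_ord -mulr_natr -r2 -mulrA ler_wpM2l // -[m.+2]addn2 exprD.
  rewrite ler_wpM2l ?exprn_ge0 ?addr_ge0 //; nra.
have h4 := sum_sqrt_pow m.+1 S; rewrite -/r in h4.
have h5 : r ^+ m.+1 <= (r + 1) ^+ m.+2.
  apply: (@le_trans _ _ ((r + 1) ^+ m.+1)); first by rewrite lerXn2r ?nnegrE; lra.
  by apply: ler_weXn2l => //; lra.
have h6 : 4 * (r + 1) * ball_count R M m.+1 S <= 4 * (w + C) * (r + 1) ^+ m.+2.
  have : 0 <= 4 * (r + 1) by lra.
  move=> /ler_wpM2l /(_ _ _ h2) /le_trans; apply.
  by rewrite (exprS _ m.+1) le_eqVlt; apply/orP; left; apply/eqP; ring.
set A := \sum_(i < S) ball_count _ _ _ _ in h1 h3 *.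
set B := \sum_(i < S) _ in h3 h4 *.
have h7 : `|pi * A - pi * (w * B)| <= pi * (C * (r + 1) ^+ m.+2).
  by rewrite -mulrBr normrM (ger0_norm (ltW p0)) ler_wpM2l // ltW.
have h8 : `|pi * (w * B) - pi * (w * (2 / m.+3%:R * r ^+ m.+3))| <= pi * (w * (r + 1) ^+ m.+2).
  rewrite -!mulrBr !normrM (ger0_norm (ltW p0)) (ger0_norm (ltW w0)).
  rewrite ler_wpM2l ?(ltW p0) // ler_wpM2l ?(ltW w0) //.
  exact: le_trans h4 h5.
apply: (le_trans (ler_distD (pi * A) _ _)).
apply: (le_trans (lerD (le_trans h1 h6) (ler_distD (pi * (w * B)) _ _))).
apply: (le_trans (lerD (lexx _) (lerD h7 h8))).
rewrite le_eqVlt; apply/orP; left; apply/eqP; ring.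
Qed.

End Asymptotics.

(** * Orthonormal frames and lattice points in simplices *)

Section Frames.
Variable R : realType.

Definition sqn n (x : 'rV[R]_n) : R := \sum_i x 0 i ^+ 2.

Lemma sqnE n (x : 'rV[R]_n) : x *m x^T = (sqn x)%:M.
Proof.
apply/rowP => i; rewrite ord1 !mxE eqxx mulr1n; apply: eq_bigr => j _.
by rewrite !mxE expr2.
Qed.

Lemma sqn_ge0 n (x : 'rV[R]_n) : 0 <= sqn x.
Proof. by apply: sumr_ge0 => i _; exact: sqr_ge0. Qed.

Lemma sqn_eq0 n (x : 'rV[R]_n) : sqn x = 0 -> x = 0.
Proof.
move=> /eqP; rewrite psumr_eq0; last by move=> i _; exact: sqr_ge0.
move=> /allP H; apply/rowP => i; have := H i; rewrite mem_index_enum => /(_ isT).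
by rewrite /= sqrf_eq0 mxE => /eqP.
Qed.

Lemma sqn_isometry k n (Q : 'M[R]_(k, n)) (x : 'rV_k) : Q *m Q^T = 1%:M -> sqn (x *m Q) = sqn x.
Proof.
move=> QQ; have : (sqn (x *m Q))%:M = (sqn x)%:M :> 'M[R]_1.
  by rewrite -!sqnE trmx_mul mulmxA -(mulmxA x) QQ mulmx1.
by move=> /matrixP /(_ 0 0); rewrite !mxE eqxx !mulr1n.
Qed.

(** Upper triangular with positive diagonal. The inductive form peels off the first coordinate,
    along which the lattice counts are sliced. *)
Inductive utri : forall k, 'M[R]_k -> Prop :=
| utri0 (L : 'M[R]_0) : utri L
| utriS k r (l : 'rV[R]_k) (L : 'M[R]_k) : 0 < r -> utri L ->
    utri (block_mx (r%:M : 'M[R]_1) l 0 L).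

Lemma utri_det k (L : 'M[R]_k) : utri L -> 0 < \det L.
Proof.
elim=> [L0|k' r l L0 r0 _ IH]; first by rewrite det_mx00.
by rewrite det_ublock det_scalar1 mulr_gt0.
Qed.

Lemma utri_unit k (L : 'M[R]_k) : utri L -> L \in unitmx.
Proof. by move=> /utri_det; rewrite unitmxE unitfE; case: ltgtP. Qed.

(** QR decomposition by rows. The first row is orthogonalised last, against the frame of the others,
    so L is upper triangular; det L is the volume of the parallelepiped spanned by the rows of V. *)
Lemma gram_schmidt k n (V : 'M[R]_(k, n)) : (forall x : 'rV_k, x *m V = 0 -> x = 0) ->
  exists L Q, [/\ utri L, Q *m Q^T = 1%:M & V = L *m Q].
Proof.
elim: k V => [|k IH] V V0.
  exists 1%:M, V; split; [exact: utri0| |by rewrite mul1mx].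
  by apply/matrixP => -[].
pose v := usubmx (V : 'M[R]_(1 + k, n)); pose V' := dsubmx (V : 'M[R]_(1 + k, n)).
have eV : V = col_mx v V' by rewrite vsubmxK.
have V0' (a : 'rV[R]_1) (x : 'rV_k) : a *m v + x *m V' = 0 -> a = 0 /\ x = 0.
  move=> ax; have e : (row_mx a x : 'rV_k.+1) *m V = a *m v + x *m V'.
    by have := mul_row_col a x v V'; rewrite eV.
  have /eqP : row_mx a x = 0 := V0 _ (etrans e ax).
  by rewrite row_mx_eq0 => /andP [/eqP ? /eqP ?].
have V'0 (x : 'rV_k) : x *m V' = 0 -> x = 0.
  by move=> xV; apply: (proj2 (V0' 0 x _)); rewrite mul0mx add0r.
have [L [Q [tL QQ eV']]] := IH _ V'0.
pose l := v *m Q^T; pose u := v - l *m Q.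
have u0 : sqn u != 0.
  (* If u vanished, the row (1, - l L^-1) would be a relation between the rows of V. *)
  apply/eqP => /sqn_eq0 /eqP; rewrite subr_eq0 => /eqP e.
  have := V0' 1%:M (- (l *m invmx L)).
  rewrite mul1mx eV' mulNmx mulmxA mulmxKV ?utri_unit // -e subrr => /(_ erefl) [/matrixP /(_ 0 0)].
  by rewrite !mxE eqxx => /eqP; rewrite oner_eq0.
have su : 0 < sqn u by rewrite lt_def u0 sqn_ge0.
pose r := Num.sqrt (sqn u); have r0 : 0 < r by rewrite sqrtr_gt0.
pose q := r^-1 *: u.
have uQ : u *m Q^T = 0 by rewrite /u mulmxBl -mulmxA QQ mulmx1 subrr.
have QQ1 : col_mx q Q *m (col_mx q Q)^T = 1%:M.
  rewrite tr_col_mx mul_col_row QQ.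
  have qQ : q *m Q^T = 0 by rewrite /q -scalemxAl uQ scaler0.
  have Qq : Q *m q^T = 0 by rewrite -[LHS]trmxK trmx_mul trmxK qQ trmx0.
  rewrite qQ Qq (scalar_mx_block 1 k 1); congr block_mx.
  rewrite /q linearZ /= -scalemxAl -scalemxAr sqnE scalerA.
  apply/matrixP => i j; rewrite !ord1 !mxE eqxx !mulr1n -(sqr_sqrtr (ltW su)) -/r.
  by field; rewrite gt_eqF.
have VLQ : block_mx (r%:M : 'M[R]_1) l 0 L *m col_mx q Q = col_mx v V'.
  rewrite mul_block_col mul0mx add0r -eV'; congr col_mx.
  by rewrite mul_scalar_mx /q scalerA divff ?gt_eqF // scale1r /u subrK.
exists (block_mx (r%:M : 'M[R]_1) l 0 L), (col_mx q Q); split; first exact: utriS.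
  exact: QQ1.
by rewrite eV -VLQ.
Qed.

Definition simplex k (a : R) (y : 'rV[R]_k) := (forall i, 0 <= y 0 i) /\ \sum_i y 0 i <= a.

Lemma simplex_row k (a c : R) (y : 'rV[R]_k) : 0 <= c ->
  simplex (a - c) y -> simplex a (row_mx (c%:M : 'M[R]_1) y).
Proof.
move=> c0 [y0 ys]; split.
  move=> i; rewrite mxE; case: fintype.splitP => j _; rewrite ?y0 //.
  by rewrite ord1 mxE eqxx.
rewrite (@big_split_ord _ _ _ 1 k) /= big_ord1 row_mxEl mxE eqxx.
under eq_bigr do rewrite row_mxEr.
by rewrite mulr1n; lra.
Qed.

Lemma simplex_rowK k (a : R) (y : 'rV[R]_(1 + k)) : simplex a y ->
  0 <= y 0 0 /\ simplex (a - y 0 0) (rsubmx y).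
Proof.
move=> [y0 ys]; split => //; split.
  by move=> i; rewrite mxE.
move: ys; rewrite (@big_split_ord _ _ _ 1 k) /= big_ord1.
have -> : lshift k (0 : 'I_1) = 0 by apply: val_inj.
under [in X in _ -> X]eq_bigr do rewrite mxE.
lra.
Qed.

Lemma exprB_le (x d : R) k : 0 <= d -> d <= x ->
  k.+1%:R * d * (x - d) ^+ k <= x ^+ k.+1 - (x - d) ^+ k.+1 <= k.+1%:R * d * x ^+ k.
Proof.
move=> d0 dx; have x0 : 0 <= x by lra.
have y0 : 0 <= x - d by lra.
elim: k => [|k IH]; first by rewrite !expr0 !expr1; lra.
move: IH => /andP [l u]; have h : (x - d) ^+ k.+1 <= x ^+ k.+1 by rewrite lerXn2r ?nnegrE //; lra.
rewrite -[k.+2%:R]natr1 !(exprS _ k.+1) !mulrDl mul1r.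
have := ler_wpM2l y0 l; have := ler_wpM2l x0 u.
have -> : x * (k.+1%:R * d * x ^+ k) = k.+1%:R * d * x ^+ k.+1 by rewrite exprS; ring.
have -> : (x - d) * (k.+1%:R * d * (x - d) ^+ k) = k.+1%:R * d * (x - d) ^+ k.+1.
  by rewrite exprS; ring.
have := ler_wpM2l d0 h.
move: (k.+1%:R : R) (x ^+ k.+1) ((x - d) ^+ k.+1) => a b c.
by move=> h1 h2 h3; apply/andP; split; lra.
Qed.

(** Upper Riemann sum of mesh d for the integral of s^k over [0, u], peeled off from the end u. The
    interval left over near 0 accounts for the term number m. *)
Lemma pow_sum_lower k m (d u : R) : 0 < d -> m%:R * d <= u < m.+1%:R * d ->
  u ^+ k.+1 <= k.+1%:R * d * \sum_(i < m.+1) (u - i%:R * d) ^+ k.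
Proof.
move=> d0; elim: m u => [|m IH] u /andP [h1 h2].
  rewrite big_ord1 /= mul0r subr0 exprS.
  have u0 : 0 <= u by lra.
  rewrite ler_wpM2r ?exprn_ge0 //.
  have : 1 <= k.+1%:R :> R by rewrite ler1n.
  nra.
rewrite -natr1 in h1; rewrite -natr1 in h2.
have ud : d <= u by have : 0 <= m%:R :> R by []; nra.
have := IH (u - d); have -> : m%:R * d <= u - d < m.+1%:R * d.
  by apply/andP; split; nra.
move=> /(_ isT) h.
have /andP [_ b] := exprB_le k (ltW d0) ud.
rewrite big_ord_recl /= mul0r subr0 mulrDr.
have -> : \sum_(i < m.+1) (u - (bump 0 i)%:R * d) ^+ k = \sum_(i < m.+1) (u - d - i%:R * d) ^+ k.
  by apply: eq_bigr => i _; congr (_ ^+ _); rewrite /bump /= -nat1r; ring.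
lra.
Qed.

Lemma pow_sum_upper k m (d u : R) : 0 < d -> m%:R * d <= u ->
  k.+1%:R * d * \sum_(i < m) (u - i.+1%:R * d) ^+ k <= u ^+ k.+1.
Proof.
move=> d0; elim: m u => [|m IH] u h.
  by rewrite big_ord0 mulr0 exprn_ge0 //; lra.
rewrite -natr1 in h.
have ud : d <= u by have : 0 <= m%:R :> R by []; nra.
have /IH h' : m%:R * d <= u - d by nra.
have /andP [b _] := exprB_le k (ltW d0) ud.
rewrite big_ord_recl /= mul1r mulrDr.
have -> : \sum_(i < m) (u - (bump 0 i).+1%:R * d) ^+ k = \sum_(i < m) (u - d - i.+1%:R * d) ^+ k.
  by apply: eq_bigr => i _; congr (_ ^+ _); rewrite /bump /= -[X in u - X * d]nat1r; ring.
lra.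
Qed.

End Frames.

Lemma ltz_addS (a b : int) (n : nat) : a < b + n%:Z -> a < b + n.+1%:Z.
Proof. lia. Qed.

Lemma ltz_addr (b : int) (n : nat) : b + n%:Z < b + n.+1%:Z.
Proof. lia. Qed.

Lemma eqz_addS (a b : int) (n : nat) : b + n%:Z <= a -> a < b + n.+1%:Z -> a = b + n%:Z.
Proof. lia. Qed.

(** * Lattice points in linear images of simplices *)

Section Counts.
Variable R : realType.

Definition zrow k (z : 'rV[int]_k) : 'rV[R]_k := map_mx intr z.

Lemma zrow_row k (j : int) (z : 'rV[int]_k) :
  zrow (row_mx (j%:M : 'M[int]_1) z) = row_mx ((j%:~R)%:M : 'M[R]_1) (zrow z).
Proof. by rewrite /zrow map_row_mx map_scalar_mx. Qed.

Lemma row_split k (y : 'rV[R]_(1 + k)) : y = row_mx ((y 0 0)%:M : 'M[R]_1) (rsubmx y).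
Proof.
rewrite -[LHS]hsubmxK; congr row_mx; apply/rowP => i; rewrite ord1 !mxE eqxx mulr1n.
by congr (y _ _); apply: val_inj.
Qed.

Let row_addE k (x g : 'rV[R]_k) (c t : R) i :
  (x + c *: g + const_mx t) 0 i = x 0 i + (c * g 0 i + t).
Proof. by rewrite !mxE addrA. Qed.

(** Once the first coordinate c is fixed, the contribution of the row l becomes a translation of the
    remaining coordinates. This is why the counts below allow an arbitrary offset w. *)
Lemma row_mul_utri k (r c : R) (l y : 'rV[R]_k) (L : 'M[R]_k) : L \in unitmx ->
  row_mx (c%:M : 'M[R]_1) y *m block_mx (r%:M : 'M[R]_1) l 0 L =
  row_mx ((c * r)%:M : 'M[R]_1) ((y + c *: (l *m invmx L)) *m L).
Proof.
move=> uL; rewrite mul_row_block mulmx0 addr0 -scalar_mxM mul_scalar_mx.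
by rewrite mulmxDl -scalemxAl mulmxKV // addrC.
Qed.

(** Induction on the dimension: the slice where the first lattice coordinate is j is again a
    triangular image of a simplex, and the slice volumes form a Riemann sum of mesh d = 1/r. *)
Lemma utri_lower k (L : 'M[R]_k) : utri L -> exists2 C : R, 0 <= C &
  forall (w : 'rV_k) (a : R), C <= a -> exists s : seq 'rV[int]_k,
  [/\ uniq s, forall z, z \in s -> exists2 y, simplex a y & zrow z = (y + w) *m L &
      \det L / k`!%:R * (a - C) ^+ k <= (size s)%:R].
Proof.
elim=> [L0|{L}k' r l L r0 tL [C C0 IH]].
  exists 0 => // w a a0; exists [:: 0]; split => //.
    move=> z _; exists 0; last by apply/rowP => -[].
    by split; [case | rewrite big_ord0].
  by rewrite det_mx00 expr0 fact0 divr1 mulr1.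
have uL := utri_unit tL; have D0 := utri_det tL.
pose d := r^-1; have d0 : 0 < d by rewrite invr_gt0.
exists (C + d); first by lra.
move=> w a aC; pose u := a - C - d.
have u0 : 0 <= u by rewrite /u; lra.
have [m /andP [m1 m2]] : exists m : nat, m%:R * d <= u < m.+1%:R * d.
  exists (Num.truncn (u / d)).
  by rewrite -ler_pdivlMr // -ltr_pdivrMr // truncn_itv // divr_ge0 // ltW.
pose w0 : R := w 0 0; pose w' := rsubmx w.
have ew : w = row_mx (w0%:M : 'M[R]_1) w' by exact: row_split.
have [j0 /andP [j1 j2]] : exists j0 : int, (j0%:~R - 1) < r * w0 <= j0%:~R.
  by exists (Num.ceil (r * w0)); rewrite -[1]/(1%:~R) -intrB; exact: ceil_itv.
(* Slices are added one at a time from j0, the first level with y0 >= 0. In slice n, y0 < (n + 1) d,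
   so its size a - y0 exceeds C + u - n d. The bound on z 0 0 keeps the slices disjoint. *)
have slice n : (n <= m.+1)%N -> exists s : seq 'rV[int]_(1 + k'),
  [/\ uniq s,
    forall z, z \in s -> z 0 0 < j0 + n%:Z /\ exists2 y, simplex a y &
      zrow z = (y + w) *m block_mx (r%:M : 'M[R]_1) l 0 L &
    \det L / k'`!%:R * \sum_(i < n) (u - i%:R * d) ^+ k' <= (size s)%:R].
  elim: n => [_|n IHn nm]; first by exists [::]; rewrite big_ord0 mulr0.
  have [s [us hs ss]] := IHn (ltnW nm).
  pose j := j0 + n%:Z; pose y0 := j%:~R * d - w0.
  have ej : j%:~R = j0%:~R + n%:R :> R by rewrite /j intrD.
  have rd : r * d = 1 by rewrite divff // gt_eqF.
  have y0l : n%:R * d <= y0 < (n%:R + 1) * d.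
    have e1 : w0 = r * w0 * d by rewrite mulrAC rd mul1r.
    rewrite /y0 ej e1 -mulrBl ler_pM2r // ltr_pM2r //; lra.
  have nd : n%:R * d <= u.
    by apply: (le_trans _ m1); rewrite ler_pM2r // ler_nat -ltnS.
  have y00 : 0 <= y0.
    by move: y0l => /andP [h _]; apply: le_trans h; rewrite mulr_ge0 // ltW.
  have ca : C <= a - y0 by move: nd; rewrite /u; nra.
  have [s' [us' hs' ss']] := IH (w' + (j%:~R * d) *: (l *m invmx L)) _ ca.
  pose f (z : 'rV[int]_k') := row_mx (j%:M : 'M[int]_1) z.
  have finj : injective f by move=> z1 z2 /eq_row_mx [].
  have f00 z : f z 0 0 = j.
    have -> : 0 = lshift k' 0 :> 'I_(1 + k') by apply: val_inj.
    by rewrite /f row_mxEl mxE eqxx.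
  exists (s ++ map f s'); split.
  - rewrite cat_uniq us map_inj_uniq // us' andbT /=.
    apply/hasPn => _ /mapP [z _ ->]; apply/negP => /hs [+ _].
    by rewrite f00 /j ltxx.
  - move=> z; rewrite mem_cat => /orP [/hs [h1 h2]|/mapP [z' /hs' [y ys ey] ->]].
      by split => //; exact: ltz_addS.
    split; first by rewrite f00 /j ltz_addr.
    exists (row_mx (y0%:M : 'M[R]_1) y); first exact: simplex_row.
    rewrite ew add_row_mx -raddfD /= row_mul_utri // zrow_row ey /y0 subrK.
    rewrite -mulrA [d * r]mulrC rd mulr1; congr (row_mx _ (_ *m _)).
    by rewrite addrA.
  - rewrite big_ord_recr /= mulrDr size_cat size_map natrD lerD //.
    apply: le_trans ss'.
    rewrite ler_wpM2l ?divr_ge0 ?(ltW D0) // lerXn2r ?nnegrE ?subr_ge0 //.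
    by rewrite /u; lra.
have [s [us hs ss]] := slice _ (leqnn _).
exists s; split => //; first by move=> z /hs [].
apply: le_trans ss.
rewrite det_ublock det_scalar1.
have -> : a - (C + d) = u by rewrite /u; lra.
have := @pow_sum_lower R k' m d u d0; rewrite m1 m2 => /(_ isT) h.
have F0 : 0 < k'`!%:R :> R by rewrite ltr0n fact_gt0.
have K0 : 0 < k'.+1%:R :> R by rewrite ltr0n.
rewrite factS natrM.
apply: (le_trans (ler_wpM2l _ h)).
  by rewrite divr_ge0 // ?mulr_ge0 ?ltW.
rewrite le_eqVlt; apply/orP; left; apply/eqP; rewrite /d.
move: (\sum_(i < _) _) (k'.+1%:R) K0 (k'`!%:R) F0 (\det L) => S K K0 F F0 D.
by field; rewrite !gt_eqF.
Qed.

(** Here the image is covered by unit lattice cubes with lower corners z. A level of the first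
    coordinate is now a slab of thickness d, across which the translation of the tail drifts; the
    simplex is enlarged to absorb that drift. *)
Lemma utri_upper k (L : 'M[R]_k) : utri L -> exists2 C : R, 0 <= C &
  forall (w : 'rV_k) (a : R), 0 <= a -> exists s : seq 'rV[int]_k,
  (forall y, simplex a y -> exists2 z, z \in s &
     forall i, zrow z 0 i <= ((y + w) *m L) 0 i <= zrow z 0 i + 1) /\
  (size s)%:R <= \det L / k`!%:R * (a + C) ^+ k.
Proof.
elim=> [L0|{L}k' r l L r0 tL [C C0 IH]].
  exists 0 => // w a a0; exists [:: 0]; split => //.
    by move=> y _; exists 0; [rewrite inE | case].
  by rewrite det_mx00 expr0 fact0 divr1 mulr1.
have uL := utri_unit tL; have D0 := utri_det tL.
pose d := r^-1; have d0 : 0 < d by rewrite invr_gt0.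
have rd : r * d = 1 by rewrite divff // gt_eqF.
pose g := l *m invmx L.
(* A bound for the drift of any coordinate of the tail across one slab. *)
pose t := d * \sum_i `|g 0 i|.
have t0 : 0 <= t by rewrite mulr_ge0 ?(ltW d0) // sumr_ge0.
have gt c i : 0 <= c <= d -> - t <= c * g 0 i <= t.
  move=> /andP [c0 cd]; rewrite -ler_norml normrM (ger0_norm c0).
  rewrite ler_pM // (bigD1 i) //= lerDl sumr_ge0 //.
pose C1 := C + k'%:R * (t + t).
have C10 : 0 <= C1 by rewrite addr_ge0 // mulr_ge0 // addr_ge0.
exists (C1 + (d + d)); first by lra.
move=> w a a0; pose u := a + C1.
have u0 : 0 <= u by rewrite /u; lra.
have [m /andP [m1 m2]] : exists m : nat, m%:R * d <= a < m.+1%:R * d.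
  exists (Num.truncn (a / d)).
  by rewrite -ler_pdivlMr // -ltr_pdivrMr // truncn_itv // divr_ge0 // ltW.
pose w0 : R := w 0 0; pose w' := rsubmx w.
have ew : w = row_mx (w0%:M : 'M[R]_1) w' by exact: row_split.
have [j0 /andP [j1 j2]] : exists j0 : int, j0%:~R <= r * w0 < j0%:~R + 1.
  by exists (Num.floor (r * w0)); rewrite -[1]/(1%:~R) -intrD; exact: floor_itv.
(* In slab n the first coordinate is only known to be at least (n - 1) d, so slabs 0 and 1 both get
   the full size. Hence [i.-1], and the extra d + d in the constant. *)
have slice n : (n <= m.+2)%N -> exists s : seq 'rV[int]_(1 + k'),
  (forall y : 'rV[R]_(1 + k'), simplex a y -> Num.floor (r * (y 0 0 + w0)) < j0 + n%:Z -> exists2 z, z \in s &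
     forall i, zrow z 0 i <= ((y + w) *m block_mx (r%:M : 'M[R]_1) l 0 L) 0 i <= zrow z 0 i + 1) /\
  (size s)%:R <= \det L / k'`!%:R * \sum_(i < n) (u - i.-1%:R * d) ^+ k'.
  elim: n => [_|n IHn nm].
    exists [::]; split; last by rewrite big_ord0 mulr0.
    move=> y [y0 _] /=; rewrite addr0 => h.
    have : j0 <= Num.floor (r * (y 0 0 + w0)).
      rewrite floor_ge_int; apply: (le_trans j1); rewrite ler_pM2l // lerDr; exact: y0.
    by rewrite leNgt h.
  have [s [hs ss]] := IHn (ltnW nm).
  pose j := j0 + n%:Z; pose a' := a - n.-1%:R * d.
  have ej : j%:~R = j0%:~R + n%:R :> R by rewrite /j intrD.
  have a'0 : 0 <= a'.
    rewrite subr_ge0; apply: (le_trans _ m1); rewrite ler_pM2r // ler_nat; by case: (n) nm.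
  have a''0 : 0 <= a' + k'%:R * (t + t) by rewrite addr_ge0 // mulr_ge0 // addr_ge0.
  pose tv : 'rV[R]_k' := const_mx t.
  have [s' [hs' ss']] := IH (w' + (j%:~R * d) *: g - tv) _ a''0.
  exists (s ++ map (fun z => row_mx (j%:M : 'M[int]_1) z) s'); split; last first.
    rewrite big_ord_recr /= mulrDr size_cat size_map natrD lerD //.
    apply: (le_trans ss'); rewrite /a' /u /C1 le_eqVlt; apply/orP; left; apply/eqP.
    by congr (_ * _ ^+ _); ring.
  move=> y ya; have [h|h] := ltP (Num.floor (r * (y 0 0 + w0))) (j0 + n%:Z).
    by move=> _; have [z zs hz] := hs _ ya h; exists z => //; rewrite mem_cat zs.
  move=> h'; have fj : Num.floor (r * (y 0 0 + w0)) = j by exact: eqz_addS.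
  have /andP [f1 f2] : j%:~R <= r * (y 0 0 + w0) < j%:~R + 1.
    by rewrite -[1]/(1%:~R) -intrD -fj; exact: floor_itv.
  have [y00 ys] := simplex_rowK ya.
  set y0 := y 0 0 in f1 f2 y00 ys.
  pose y' := rsubmx (y : 'rV_(1 + k')); rewrite -/y' in ys.
  have ey : y = row_mx (y0%:M : 'M[R]_1) y' by exact: row_split.
  pose c := y0 + w0 - j%:~R * d.
  have cd : 0 <= c <= d.
    have -> : c = (r * (y0 + w0) - j%:~R) * d by rewrite mulrBl mulrAC rd mul1r.
    rewrite mulr_ge0 ?subr_ge0 ?(ltW d0) //= -[leRHS]mul1r ler_pM2r //; lra.
  (* Adding t keeps the coordinates non-negative in spite of the drift c g, and the offset passed to
     the induction hypothesis subtracts it again. The sum of the coordinates grows by at most 2t for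
     each. *)
  have [|z zs hz] := hs' (y' + c *: g + tv).
    case: ys => yp ysum; split.
      move=> i; rewrite row_addE; move: (gt c i cd) (yp i).
      by move: (c * _) (y' 0 i) => A B; lra.
    have -> : \sum_i (y' + c *: g + tv) 0 i = \sum_i y' 0 i + \sum_i (c * g 0 i + t).
      by rewrite -big_split /=; apply: eq_bigr => i _; rewrite row_addE.
    apply: lerD.
      apply: (le_trans ysum); rewrite /a' lerD2l lerN2.
      have : n%:R * d <= y0 + d.
        have : n%:R <= r * y0 + 1 by move: f1; rewrite ej mulrDr; lra.
        move=> /(ler_wpM2r (ltW d0)); rewrite mulrDl mul1r [r * _]mulrC -mulrA rd mulr1 //.
      case: (n) => [|n'] /=; first by rewrite !mul0r.
      by rewrite -natr1; lra.
    apply: (@le_trans _ _ (\sum_(i < k') (t + t))).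
      by apply: ler_sum => i _; have := gt c i cd; lra.
    by rewrite sumr_const card_ord -[leLHS]mulr_natl.
  exists (row_mx (j%:M : 'M[int]_1) z); first by rewrite mem_cat map_f ?orbT.
  rewrite ey ew add_row_mx -raddfD /= row_mul_utri // zrow_row.
  have ee : y' + c *: g + tv + (w' + (j%:~R * d) *: g - tv) = y' + w' + (y0 + w0) *: g.
    rewrite /c scalerBl; move: (y') (w') (_ *: g) (_ *: g) (tv) => A B X Y Z.
    by apply/rowP => i; rewrite !mxE; ring.
  rewrite ee in hz.
  move=> i; rewrite !(mxE _ _ 0 i); case: fintype.splitP => i' _; last exact: hz.
  by rewrite ord1 !mxE eqxx !mulr1n; rewrite [_ * r]mulrC; lra.
have [s [hs ss]] := slice _ (leqnn _).
exists s; split.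
  move=> y ya; apply: hs => //.
  have [y00 [yp ys]] := simplex_rowK ya.
  have : 0 <= \sum_i rsubmx y 0 i by apply: sumr_ge0 => i _; exact: yp.
  move=> s0; have ya' : y 0 0 <= a by lra.
  have : r * (y 0 0 + w0) < (j0 + m.+2%:Z)%:~R.
    rewrite intrD -[m.+2%:Z%:~R]/(m.+2%:R) -natr1.
    have : r * y 0 0 < m.+1%:R.
      apply: (le_lt_trans (y := r * a)); first by rewrite ler_pM2l.
      by move: m2; rewrite -ltr_pdivrMr // /d invrK mulrC.
    rewrite mulrDr; lra.
  by rewrite floor_lt_int.
apply: (le_trans ss).
rewrite det_ublock det_scalar1 factS natrM.
have F0 : 0 < k'`!%:R :> R by rewrite ltr0n fact_gt0.
have K0 : 0 < k'.+1%:R :> R by rewrite ltr0n.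
rewrite big_ord_recl big_ord_recl /= !mul0r !subr0.
have mu : m%:R * d <= u by rewrite /u; lra.
have h1 := @pow_sum_upper R k' m d u d0 mu.
have -> : \sum_(i < m) (u - (bump 0 (bump 0 i)).-1%:R * d) ^+ k' = \sum_(i < m) (u - i.+1%:R * d) ^+ k'.
  by apply: eq_bigr => i _.
have d20 : 0 <= d + d by lra.
have ud : d + d <= u + (d + d) by lra.
have /andP [h2 _] := exprB_le k' d20 ud; rewrite addrK in h2.
have -> : a + (C1 + (d + d)) = u + (d + d) by rewrite /u; lra.
set Y := (u + (d + d)) ^+ k'.+1 in h2 *.
have key : k'.+1%:R * d * (u ^+ k' + (u ^+ k' + \sum_(i < m) (u - i.+1%:R * d) ^+ k')) <= Y.
  move: h1 h2; move: (\sum_(i < m) _) (u ^+ k') (u ^+ k'.+1) (k'.+1%:R) => A B E K; lra.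
have c0 : 0 <= r * \det L / (k'.+1%:R * k'`!%:R).
  by rewrite divr_ge0 // ?mulr_ge0 // ?ltW.
apply: (le_trans _ (ler_wpM2l c0 key)).
rewrite le_eqVlt; apply/orP; left; apply/eqP; rewrite /d.
move: (\sum_(i < _) _) (k'.+1%:R) K0 (k'`!%:R) F0 (\det L) => S K K0 F F0 D.
by field; rewrite !gt_eqF.
Qed.

End Counts.

(** * Finite covers *)

Section Covers.
Variable R : realType.

(* Each set of a cover comes with an upper bound on its diameter. *)
Definition fcover n (e : R) (A : set 'rV[R]_n) (s : seq (set 'rV[R]_n * R)) :=
  (forall x, A x -> exists2 p, p \in s & p.1 x) /\
  (forall p, p \in s -> 0 <= p.2 <= e /\
     forall x y, p.1 x -> p.1 y -> sqn (x - y) <= p.2 ^+ 2).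

Definition cost k n (s : seq (set 'rV[R]_n * R)) : R :=
  \sum_(p <- s) ball_vol R k * (p.2 / 2) ^+ k.

Definition hcov k n (e v : R) (A : set 'rV[R]_n) := exists2 s, fcover e A s & cost k s <= v.

Lemma hcov_sub k n e v (A B : set 'rV[R]_n) :
  (forall x, A x -> B x) -> hcov k e v B -> hcov k e v A.
Proof. by move=> AB [s [h1 h2] c]; exists s => //; split => // x /AB; exact: h1. Qed.

Lemma hcov_le k n e v e' v' (A : set 'rV[R]_n) : e <= e' -> v <= v' ->
  hcov k e v A -> hcov k e' v' A.
Proof.
move=> ee vv [s [h1 h2] c]; exists s; last exact: le_trans vv.
split=> // p /h2 [/andP [h3 h4] h5]; split => //.
by rewrite h3 (le_trans h4).
Qed.

Lemma hcovU k n e v w (A B : set 'rV[R]_n) : hcov k e v A -> hcov k e w B ->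
  hcov k e (v + w) (fun x => A x \/ B x).
Proof.
move=> [s [h1 h2] c] [s' [h1' h2'] c']; exists (s ++ s'); last by rewrite /cost big_cat lerD.
split; first by move=> x [/h1|/h1'] [p ps px]; exists p => //; rewrite mem_cat ps ?orbT.
by move=> p; rewrite mem_cat => /orP [/h2|/h2'].
Qed.

Lemma hcov_bigcup k n e (T : eqType) (r : seq T) (v : T -> R) (F : T -> set 'rV[R]_n) :
  (forall i, i \in r -> hcov k e (v i) (F i)) ->
  hcov k e (\sum_(i <- r) v i) (fun x => exists2 i, i \in r & F i x).
Proof.
elim: r => [_|i r IH H].
  by exists [::]; [split => // x []|rewrite /cost !big_nil].
rewrite big_cons.
apply: (@hcov_sub _ _ _ _ _ (fun x => F i x \/ exists2 i, i \in r & F i x)).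
  move=> x [j]; rewrite inE => /orP [/eqP -> |jr] Fx; [by left|by right; exists j].
by apply: hcovU; [apply: H; rewrite inE eqxx | apply: IH => j jr; apply: H; rewrite inE jr orbT].
Qed.

Lemma hcov_sim k m n e v c (A : set 'rV[R]_m) (f : 'rV[R]_m -> 'rV[R]_n) : 0 <= c ->
  (forall x y, sqn (f x - f y) = c ^+ 2 * sqn (x - y)) ->
  hcov k e v A -> hcov k (c * e) (c ^+ k * v) (fun z => exists2 x, A x & z = f x).
Proof.
move=> c0 fc [s [h1 h2] cs].
exists [seq ((fun z => exists2 x, p.1 x & z = f x) : set 'rV[R]_n, c * p.2) | p <- s].
  split.
    move=> _ [x /h1 [p ps px] ->].
    by exists ((fun z => exists2 x, p.1 x & z = f x) : set 'rV[R]_n, c * p.2); [apply/mapP; exists p|exists x].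
  move=> _ /mapP [p /h2 [/andP [h3 h4] h5] ->] /=; split.
    by rewrite mulr_ge0 // ler_wpM2l.
  move=> _ _ [x px ->] [y py ->]; rewrite fc exprMn ler_wpM2l ?sqr_ge0 //; exact: h5.
rewrite /cost big_map /=; apply: le_trans (ler_wpM2l (exprn_ge0 k c0) cs).
rewrite /cost mulr_sumr le_eqVlt; apply/orP; left; apply/eqP; apply: eq_bigr => p _.
by rewrite mulrCA -exprMn mulrA.
Qed.

Lemma hcov_single k n d (A : set 'rV[R]_n) : 0 <= d ->
  (forall x y, A x -> A y -> sqn (x - y) <= d ^+ 2) -> hcov k d (ball_vol R k * (d / 2) ^+ k) A.
Proof.
move=> d0 H; exists [:: (A, d)]; last by rewrite /cost big_seq1.
split; first by move=> x Ax; exists (A, d) => //; rewrite inE.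
by move=> p; rewrite inE => /eqP -> /=; rewrite d0 lexx.
Qed.

(** Passage from lattice counts at arbitrarily large scale x to volumes: shifts by C and terms of
    order x^k do not affect the leading coefficient. *)
Lemma leading_coef_le k (a b C K : R) : 0 <= a -> 0 <= C ->
  (forall B : R, exists x, [/\ B <= x, C <= x, 0 < x &
     a * (x - C) ^+ k.+1 <= b * x ^+ k.+1 + K * x ^+ k]) -> a <= b.
Proof.
move=> a0 C0 H; rewrite leNgt; apply/negP => ab.
have [x [Bx Cx x0 h]] := H ((K + a * (k.+1%:R * C) + 1) / (a - b)).
have /andP [_ h1] := exprB_le k C0 Cx.
rewrite ler_pdivrMr ?subr_gt0 // in Bx.
have h2 : a * (x ^+ k.+1 - k.+1%:R * C * x ^+ k) <= b * x ^+ k.+1 + K * x ^+ k.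
  by apply: le_trans h; apply: ler_wpM2l => //; lra.
have xk : 0 < x ^+ k by rewrite exprn_gt0.
have h3 : (a - b) * x * x ^+ k <= (K + a * (k.+1%:R * C)) * x ^+ k.
  move: h2; rewrite exprS; move: (x ^+ k) (k.+1%:R) => X Y; lra.
rewrite ler_pM2r // in h3; lra.
Qed.

Lemma sqn_le n (x : 'rV[R]_n) (c : R) : (forall i, `|x 0 i| <= c) -> sqn x <= n%:R * c ^+ 2.
Proof.
move=> H; apply: (@le_trans _ _ (\sum_(i < n) c ^+ 2)).
  apply: ler_sum => i _; rewrite -real_normK ?num_real // lerXn2r ?nnegrE //.
  exact: le_trans (H i).
by rewrite sumr_const card_ord mulr_natl.
Qed.

Lemma sqn_dist_le n (x y c : 'rV[R]_n) (r : R) : sqn (x - c) <= r ^+ 2 -> sqn (y - c) <= r ^+ 2 ->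
  sqn (x - y) <= (2 * r) ^+ 2.
Proof.
move=> hx hy; apply: (@le_trans _ _ (2 * sqn (x - c) + 2 * sqn (y - c))); last by nra.
rewrite /sqn !mulr_sumr -big_split /=; apply: ler_sum => i _; rewrite !mxE.
have := sqr_ge0 (x 0 i - c 0 i + (y 0 i - c 0 i)); nra.
Qed.

Definition ucube k : set 'rV[R]_k := fun x => forall i, 0 <= x 0 i <= 1.

(** The mesh is left free, since scaling the cube down makes it as small as desired. *)
Definition cubecov k v := exists e, hcov k e v (@ucube k).

(** The number of cells per side is odd, so one cell is central and [zc] gives positions relative to
    it. *)
Definition cell k m (c : {ffun 'I_k -> 'I_(m.*2.+1)}) (u : 'rV[R]_k) : 'rV[R]_k :=
  (m.*2.+1%:R)^-1 *: (\row_i (c i)%:R + u).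

Lemma ucube_cell k m x : @ucube k x -> exists c : {ffun 'I_k -> 'I_(m.*2.+1)},
  exists2 u, @ucube k u & x = cell c u.
Proof.
move=> hx; pose N : R := m.*2.+1%:R; have N0 : 0 < N by rewrite ltr0n.
have H i : exists j : 'I_(m.*2.+1), 0 <= N * x 0 i - j%:R <= 1.
  have /andP [x0 x1] := hx i.
  have [h|h] := ltP (N * x 0 i) (m.*2%:R).
    have p0 : 0 <= N * x 0 i by rewrite mulr_ge0 // ltW.
    have /andP [t1 t2] := truncn_itv p0.
    have tm : (Num.truncn (N * x 0%R i) < m.*2.+1)%N.
      by rewrite -(ltr_nat R); apply: (le_lt_trans t1); apply: (lt_trans h); rewrite ltr_nat.
    by exists (Ordinal tm) => /=; rewrite -natr1 in t2; lra.
  exists ord_max => /=; rewrite subr_ge0 h /=.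
  have : N * x 0 i <= N by rewrite ler_piMr // ltW.
  by rewrite /N -natr1; lra.
pose c := [ffun i => projT1 (cid (H i))].
exists c, (N *: x - \row_i (c i)%:R).
  by move=> i; rewrite !mxE ffunE; case: cid.
rewrite /cell addrC subrK scalerA mulVf ?scale1r // gt_eqF //.
Qed.

(** In units of cells, moving from the centre of a cell by at most 1/2 in a coordinate of size at
    most m raises its square by at most m + 1/4. The threshold works because m (m - k) + k (m + 1/4)
    <= (m + 1/2)^2, the squared radius of the inscribed ball. *)
Lemma good_cell_in_ball k m (c : {ffun 'I_k -> 'I_(m.*2.+1)}) u : (k <= m)%N ->
  norm2 c <= (m * (m - k))%N%:Z -> @ucube k u ->
  sqn (cell c u - const_mx (1 / 2)) <= (1 / 2) ^+ 2.
Proof.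
move=> km hc hu; pose N : R := m.*2.+1%:R; have N0 : 0 < N by rewrite ltr0n.
have NE : N = 2 * m%:R + 1 by rewrite /N -natr1 -mul2n natrM.
have e : sqn (cell c u - const_mx (1 / 2)) = (N^-1) ^+ 2 * \sum_i ((zc (c i))%:~R + (u 0 i - 1 / 2)) ^+ 2.
  rewrite /sqn mulr_sumr; apply: eq_bigr => i _; rewrite !mxE -exprMn; congr (_ ^+ 2).
  rewrite -/N /zc intrB -[(c i)%:Z%:~R]/((c i)%:R) -[m%:Z%:~R]/(m%:R).
  have -> : 1 / 2 = N^-1 * (N / 2) :> R by field; rewrite gt_eqF.
  rewrite -mulrBr; congr (_ * _); rewrite NE; field.
  by rewrite -NE gt_eqF.
have b : \sum_i ((zc (c i))%:~R + (u 0 i - 1 / 2)) ^+ 2 <= (m * (m - k))%N%:R + k%:R * (m%:R + 1 / 4) :> R.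
  apply: (@le_trans _ _ ((norm2 c)%:~R + \sum_(i < k) (m%:R + 1 / 4))).
    rewrite /norm2 rmorph_sum -big_split /=; apply: ler_sum => j _.
    rewrite rmorphXn /=.
    have zm : `|(zc (c j))%:~R| <= m%:R :> R.
      rewrite -intr_norm -[m%:R]/(m%:Z%:~R) ler_int.
      by rewrite /zc; have := ltn_ord (c j); clear; lia.
    move: zm; rewrite ler_norml; have := hu j; move: ((zc (c j))%:~R : R) (u 0 j) => z y.
    move=> /andP [y0 y1] /andP [z0 z1]; nra.
  rewrite sumr_const card_ord -[X in _ + X]mulr_natl lerD2r.
  by rewrite -[leRHS]/((m * (m - k))%N%:Z%:~R) ler_int.
rewrite e exprVn mulrC ler_pdivrMr ?exprn_gt0 //; apply: (le_trans b).
rewrite natrM natrB // NE.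
have : k%:R <= m%:R :> R by rewrite ler_nat.
move: (m%:R : R) (k%:R : R) (ler0n R m) => M K; nra.
Qed.

(** The inscribed ball is one set of the cover and takes care of all good cells; each remaining cell
    receives a scaled copy of the given cover. *)
Lemma cubecov_step k m v : (k <= m)%N -> cubecov k v ->
  cubecov k (ball_vol R k * (1 / 2) ^+ k +
    (1 - ball_count R m k (m * (m - k)) / m.*2.+1%:R ^+ k) * v).
Proof.
move=> km [e H]; pose N : R := m.*2.+1%:R; have N0 : 0 < N by rewrite ltr0n.
pose good := [pred c : {ffun 'I_k -> 'I_(m.*2.+1)} | norm2 c <= (m * (m - k))%N%:Z].
exists (Num.max 1 (N^-1 * e)).
apply: (@hcov_sub _ _ _ _ _ (fun x => sqn (x - const_mx (1 / 2)) <= (1 / 2) ^+ 2 \/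
   exists2 c, c \in [seq c <- enum {ffun 'I_k -> 'I_(m.*2.+1)} | ~~ good c] &
     exists2 u, @ucube k u & x = cell c u)).
  move=> x /ucube_cell => /(_ m) [c [u hu ->]].
  have [g|g] := boolP (good c); first by left; apply: good_cell_in_ball.
  by right; exists c; [rewrite mem_filter g mem_enum | exists u].
apply: hcovU.
  apply: (@hcov_le _ _ 1 (ball_vol R k * (1 / 2) ^+ k)) => //.
    by rewrite le_max lexx.
  apply: hcov_single => // x y hx hy; have := sqn_dist_le hx hy.
  by have -> : 2 * (1 / 2) = 1 :> R by lra.
have cs (c : {ffun 'I_k -> 'I_(m.*2.+1)}) : hcov k (N^-1 * e) (N^-1 ^+ k * v)
    (fun x => exists2 u, @ucube k u & x = cell c u).
  apply: hcov_sim => //; first by rewrite invr_ge0 ltW.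
  move=> x y; rewrite /cell -scalerBr opprD addrACA subrr add0r -/N.
  by rewrite /sqn mulr_sumr; apply: eq_bigr => i _; rewrite !mxE exprMn.
have := @hcov_bigcup k k (N^-1 * e) _ [seq c <- enum {ffun 'I_k -> 'I_(m.*2.+1)} | ~~ good c] (fun=> N^-1 ^+ k * v) _ (fun c _ => cs c).
apply: hcov_le; first by rewrite le_max lexx orbT.
rewrite big_const_seq iter_addr_0 count_predT -[leLHS]mulr_natr size_filter.
have cE : (count (fun c => ~~ good c) (enum {ffun 'I_k -> 'I_(m.*2.+1)}))%:R = N ^+ k - ball_count R m k (m * (m - k)) :> R.
  rewrite /ball_count -/good.
  have -> : #|good| = count good (enum {ffun 'I_k -> 'I_(m.*2.+1)}).
    by rewrite -sum1_card -sum1_count big_enum_cond /=; apply: eq_bigl => c; rewrite inE.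
  apply/eqP; rewrite eq_sym subr_eq -natrD addnC.
  have := count_predC good (enum {ffun 'I_k -> 'I_(m.*2.+1)}).
  by rewrite /predC /= => ->; rewrite -cardE card_ffun !card_ord natrX.
rewrite cE exprVn le_eqVlt; apply/orP; left; apply/eqP.
have Nk : N ^+ k != 0 by rewrite expf_neq0 // gt_eqF.
rewrite -/N; field; exact: Nk.
Qed.

Lemma ball_count_le k m S : ball_count R m k S <= m.*2.+1%:R ^+ k.
Proof.
rewrite /ball_count -natrX ler_nat; apply: leq_trans (max_card _) _.
by rewrite card_ffun !card_ord.
Qed.

Lemma ball_density k (ep : R) : 0 < ep -> exists2 m, (k.+1 <= m)%N &
  ball_vol R k.+1 * (1 / 2) ^+ k.+1 - ep <= ball_count R m k.+1 (m * (m - k.+1)) / m.*2.+1%:R ^+ k.+1.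
Proof.
move=> ep0; apply: contrapT => H.
have [C C0 HC] := ball_count_asymp R k.+1.
pose th := ball_vol R k.+1 * (1 / 2) ^+ k.+1.
have : th <= th - ep.
  (* The shift is chosen so that N - (2 (k + 1) + 1) = 2 (m - (k + 1)), which is at most 2 sqrt (m
     (m - (k + 1))). *)
  apply: (@leading_coef_le k _ _ (2 * k.+1%:R + 1) C) => //.
    by rewrite mulr_ge0 ?exprn_ge0 // ltW // ball_vol_gt0.
  move=> B; have [m0 hm0] : exists m0 : nat, B <= m0%:R.
    by exists (Num.truncn `|B|).+1; apply: (le_trans (ler_norm _)); rewrite ltW // truncnS_gt.
  pose m := (m0 + k.+1)%N; pose N : R := m.*2.+1%:R.
  have NE : N = 2 * m%:R + 1 by rewrite /N -natr1 -mul2n natrM.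
  have km : (k.+1 <= m)%N by rewrite /m leq_addl.
  have km' : k.+1%:R <= m%:R :> R by rewrite ler_nat.
  have N0 : 0 < N by rewrite ltr0n.
  exists N; split => //.
  - apply: (le_trans hm0); rewrite /N ler_nat /m; clear; lia.
  - by rewrite NE; lra.
  have h1 : ball_count R m k.+1 (m * (m - k.+1)) < (th - ep) * N ^+ k.+1.
    rewrite ltNge; apply/negP => h; apply: H; exists m => //.
    by rewrite ler_pdivlMr // exprn_gt0.
  have Sm : (m * (m - k.+1) <= m ^ 2)%N by rewrite expnS expn1 leq_mul2l leq_subr orbT.
  have := HC m _ Sm; rewrite ler_norml /= => /andP [h2 _].
  set r := Num.sqrt _ in h2.
  have r1 : m%:R - k.+1%:R <= r.
    rewrite -[leLHS]ger0_norm ?subr_ge0 // -sqrtr_sqr ler_wsqrtr // natrM natrB // expr2.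
    by rewrite ler_wpM2r ?subr_ge0 // gerBl.
  have r2 : r <= m%:R.
    rewrite -[leRHS]ger0_norm // -sqrtr_sqr ler_wsqrtr // -natrX ler_nat //.
  have h3 : th * (N - (2 * k.+1%:R + 1)) ^+ k.+1 <= ball_vol R k.+1 * r ^+ k.+1.
    rewrite /th -mulrA -exprMn ler_wpM2l ?(ltW (ball_vol_gt0 _ _)) // lerXn2r ?nnegrE ?sqrtr_ge0 //.
      by rewrite NE; lra.
    by rewrite NE; lra.
  have h4 : C * (r + 1) ^+ k <= C * N ^+ k.
    rewrite ler_wpM2l // lerXn2r ?nnegrE ?addr_ge0 ?sqrtr_ge0 ?(ltW N0) //.
    have : 0 <= m%:R :> R by []; rewrite NE; lra.
  move: h1 h2 h3 h4; move: (th * _) (_ * N ^+ k.+1) (ball_count _ _ _ _) (_ * r ^+ _) (C * (r + 1) ^+ k) (C * N ^+ k).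
  by move=> *; lra.
lra.
Qed.

Lemma cubecov0 k : exists v, cubecov k v.
Proof.
exists (ball_vol R k * (k%:R / 2) ^+ k), k%:R; apply: hcov_single => // x y hx hy.
apply: (le_trans (@sqn_le _ _ 1 _)).
  move=> i; rewrite !mxE ler_norml; have := hx i; have := hy i; lra.
rewrite expr1n mulr1; case: (k) => [|k']; first by rewrite expr0n.
by rewrite expr2 ler_peMr // ler1n.
Qed.

Lemma cubecov1 k (ep : R) : 0 < ep -> cubecov k.+1 (1 + ep).
Proof.
move=> ep0; pose E : set R := fun v => 0 <= v /\ cubecov k.+1 v.
have cost_ge0 n (s : seq (set 'rV[R]_n * R)) e A : fcover e A s -> 0 <= cost k.+1 s.
  move=> [_ H]; rewrite /cost big_seq; apply: sumr_ge0 => p /H [/andP [h _] _].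
  by rewrite mulr_ge0 ?(ltW (ball_vol_gt0 _ _)) // exprn_ge0 // divr_ge0.
have cc0 v : cubecov k.+1 v -> 0 <= v by move=> [e [s /cost_ge0 h1 h2]]; apply: le_trans h2.
have Ene : (E !=set0)%classic by have [v hv] := cubecov0 k.+1; exists v; split => //; exact: cc0.
have Elb : has_lbound E by exists 0 => v [].
have hE : has_inf E by split.
pose V := inf E.
have V0 : 0 <= V by apply: lb_le_inf => // v [].
pose th := ball_vol R k.+1 * (1 / 2) ^+ k.+1.
have th0 : 0 < th by rewrite mulr_gt0 ?ball_vol_gt0 ?exprn_gt0.
have key d : 0 < d -> V <= th + (1 - th + d) * (V + d).
  move=> d0; have [v [v0 hv] vV] := inf_adherent d0 hE; rewrite -/V in vV.
  have [m km hm] := ball_density k d0; rewrite -/th in hm.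
  have := cubecov_step km hv; rewrite -/th => h.
  have bl := ball_count_le k.+1 m (m * (m - k.+1)).
  have q1 : ball_count R m k.+1 (m * (m - k.+1)) / m.*2.+1%:R ^+ k.+1 <= 1.
    by rewrite ler_pdivrMr ?mul1r // exprn_gt0.
  apply: (@le_trans _ _ _ _ _ (_ : V <= th + (1 - ball_count R m k.+1 (m * (m - k.+1)) / m.*2.+1%:R ^+ k.+1) * v)).
    by apply: ge_inf => //; split => //; exact: cc0.
  move: hm q1; move: (ball_count _ _ _ _ / _) => q hm q1.
  rewrite lerD2l; apply: ler_pM => //; lra.
have V1 : V <= 1.
  rewrite leNgt; apply/negP => V1.
  (* For d <= 1, [key] gives th (V - 1) <= d (V + 2 - th), whereas this d makes d (V + 3) at most
     half of th (V - 1). *)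
  pose d := Num.min 1 (th * (V - 1) / (2 * (V + 3))).
  have q0 : 0 < th * (V - 1) / (2 * (V + 3)) by apply: divr_gt0; [apply: mulr_gt0; lra | lra].
  have d0 : 0 < d by rewrite lt_min ltr01 q0.
  have d1 : d <= 1 by rewrite ge_min lexx.
  have d2 : d * (2 * (V + 3)) <= th * (V - 1).
    by rewrite -ler_pdivlMr ?ge_min ?lexx ?orbT //; lra.
  have := key _ d0; nra.
have [v [v0 [e hv]] vV] := inf_adherent ep0 hE.
exists e; apply: hcov_le hv => //; rewrite -/V in vV; lra.
Qed.

End Covers.

(** * Optimal cost of covers of a simplex *)

Section SimplexVolume.
Variable R : realType.

Definition simp k n (w : 'rV[R]_n) (V : 'M[R]_(k, n)) : set 'rV[R]_n :=
  fun x => exists2 y, simplex 1 y & x = w + y *m V.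

Lemma sqnZ n c (x : 'rV[R]_n) : sqn (c *: x) = c ^+ 2 * sqn x.
Proof. by rewrite /sqn mulr_sumr; apply: eq_bigr => i _; rewrite mxE exprMn. Qed.

Lemma simplexZ k (a c : R) (y : 'rV[R]_k) : 0 <= c -> simplex a y -> simplex (c * a) (c *: y).
Proof.
move=> c0 [y0 ys]; split; first by move=> i; rewrite mxE mulr_ge0.
under eq_bigr do rewrite mxE.
by rewrite -mulr_sumr ler_wpM2l.
Qed.

Lemma exprD_ratio k (C ep : R) : 0 <= C -> 0 < ep ->
  exists B : R, forall x, B <= x -> 0 < x -> (x + C) ^+ k.+1 <= (1 + ep) * x ^+ k.+1.
Proof.
move=> C0 ep0; exists (Num.max C (k.+1%:R * C * 2 ^+ k / ep)) => x.
rewrite ge_max => /andP [Cx]; rewrite ler_pdivrMr // => h x0.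
have CC : C <= x + C by lra.
have /andP [_ h1] := exprB_le k C0 CC; rewrite addrK in h1.
have h2 : (x + C) ^+ k <= 2 ^+ k * x ^+ k.
  by rewrite -exprMn lerXn2r ?nnegrE; lra.
have kC : 0 <= k.+1%:R * C by rewrite mulr_ge0.
have h3 := ler_wpM2l kC h2.
have xk : 0 <= x ^+ k by rewrite exprn_ge0 // ltW.
have h4 := ler_wpM2r xk h.
have e : (1 + ep) * x ^+ k.+1 = x ^+ k.+1 + x * ep * x ^+ k by rewrite exprS; ring.
rewrite e; rewrite mulrA in h3.
move: h1 h3 h4; move: ((x + C) ^+ k.+1) (x ^+ k.+1) (_ * (x + C) ^+ k) (_ * x ^+ k) (_ * x ^+ k).
by move=> *; lra.
Qed.

Lemma ex_nat_ge (B : R) : exists2 N : nat, (0 < N)%N & B <= N%:R.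
Proof.
exists (Num.truncn `|B|).+1 => //.
by apply: (le_trans (ler_norm _)); rewrite ltW // truncnS_gt.
Qed.

(** The simplex dilated by N is covered by unit cubes of the frame Q, each cube is covered at cost 1
    + d, and everything is scaled back by 1/N. *)
Lemma simplex_upper k n (w : 'rV[R]_n) (V : 'M[R]_(k.+1, n)) L Q (e ep : R) :
  utri L -> Q *m Q^T = 1%:M -> V = L *m Q -> 0 < e -> 0 < ep ->
  hcov k.+1 e (\det L / k.+1`!%:R + ep) (simp w V).
Proof.
move=> tL QQ VLQ e0 ep0.
have [C C0 HC] := utri_upper tL.
pose D := \det L / k.+1`!%:R.
have D0 : 0 < D by rewrite divr_gt0 ?utri_det // ltr0n fact_gt0.
(* The factor 1 + d occurs twice, from the covers of cubes and from (N + C)^(k+1), and (1 + d)^2 <=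
   1 + 3 d. *)
pose d := Num.min 1 (ep / (3 * D)).
have d0 : 0 < d by rewrite lt_min ltr01 divr_gt0 // mulr_gt0.
have d1 : d <= 1 by rewrite ge_min lexx.
have d2 : 3 * D * d <= ep.
  have : d <= ep / (3 * D) by rewrite ge_min lexx orbT.
  have D3 : 0 < 3 * D by rewrite mulr_gt0.
  by rewrite (ler_pdivlMr _ _ D3) [d * _]mulrC.
have [e1 hcube] := cubecov1 k d0.
have [B HB] := exprD_ratio k C0 d0.
have [N N0 hN] := ex_nat_ge (Num.max B (e1 / e)).
move: hN; rewrite ge_max => /andP [BN eN].
have NR : 0 < N%:R :> R by rewrite ltr0n.
have [s [hs ss]] := HC 0 _ (ltW NR).
pose f (z : 'rV[int]_k.+1) (u : 'rV[R]_k.+1) := w + (N%:R^-1 *: (zrow R z + u)) *m Q.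
have fs z : hcov k.+1 (N%:R^-1 * e1) (N%:R^-1 ^+ k.+1 * (1 + d))
    (fun x => exists2 u, @ucube R k.+1 u & x = f z u).
  apply: hcov_sim => //.
  move=> x y; rewrite /f opprD addrACA subrr add0r -mulmxBl sqn_isometry //.
  by rewrite -scalerBr opprD addrACA subrr add0r sqnZ.
have := hcov_bigcup (r := s) (fun z _ => fs z).
move=> /(@hcov_le _ _ _ _ _ e (D + ep)).
have c1 : N%:R^-1 * e1 <= e by rewrite mulrC ler_pdivrMr // mulrC -ler_pdivrMr.
have c2 : \sum_(i <- s) N%:R^-1 ^+ k.+1 * (1 + d) <= D + ep.
  rewrite big_const_seq iter_addr_0 count_predT -[leLHS]mulr_natr.
  have h1 := HB _ BN NR.
  have NK : 0 < N%:R ^+ k.+1 :> R by rewrite exprn_gt0.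
  have h2 : (size s)%:R <= D * ((1 + d) * N%:R ^+ k.+1).
    by apply: (le_trans ss); rewrite ler_wpM2l // ltW.
  rewrite exprVn [_^-1 * _]mulrC mulrAC ler_pdivrMr //.
  apply: (@le_trans _ _ ((1 + d) * (D * ((1 + d) * N%:R ^+ k.+1)))).
    by rewrite ler_wpM2l //; lra.
  have dd : D * (d * d) <= D * d by rewrite ler_wpM2l ?(ltW D0) // ler_piMr // ltW.
  move: d2 dd (N%:R ^+ k.+1) NK; move: (D) (d) (ep) => D' d' ep' d2 dd X X0.
  have -> : (1 + d') * (D' * ((1 + d') * X)) = (1 + d') * (D' * (1 + d')) * X by ring.
  by rewrite ler_pM2r //; lra.
move=> /(_ c1 c2); apply: hcov_sub => x [y ys ->].
have ys' : simplex N%:R (N%:R *: y) by have := simplexZ (ltW NR) ys; rewrite mulr1.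
have [z zs hz] := hs _ ys'; rewrite addr0 in hz.
exists z => //; exists ((N%:R *: y) *m L - zrow R z).
  by move=> i; rewrite mxE [X in _ + X]mxE; have := hz i; move: (_ 0 i) (zrow _ _ _ _) => *; lra.
rewrite /f; congr (_ + _).
by rewrite [zrow _ _ + _]addrC subrK -!scalemxAl scalerA mulVf ?scale1r ?gt_eqF // VLQ mulmxA.
Qed.

Lemma card_le_sum_cover (T : finType) (I : eqType) (r : seq I) (Z : pred T) (A : I -> pred T) :
  (forall c, Z c -> exists2 i, i \in r & A i c) -> (#|Z| <= \sum_(i <- r) #|A i|)%N.
Proof.
move=> H; rewrite -sum1_card big_mkcond /=.
under [leqRHS]eq_bigr do rewrite -sum1_card big_mkcond /=.
rewrite exchange_big /=; apply: leq_sum => c _.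
case: ifP => // Zc; have [i ir Ac] := H _ Zc.
by rewrite (big_rem i) //= /in_mem /= Ac.
Qed.

Lemma norm_mulmx_simplex k (a : R) (y : 'rV[R]_k) (L : 'M[R]_k) i : 0 <= a -> simplex a y ->
  `|(y *m L) 0 i| <= a * \sum_j \sum_j' `|L j j'|.
Proof.
move=> a0 [y0 ys]; rewrite mxE; apply: (le_trans (ler_norm_sum _ _ _)).
rewrite mulr_sumr; apply: ler_sum => j _; rewrite normrM; apply: ler_pM => //.
  rewrite ger0_norm //; apply: le_trans ys.
  by rewrite (bigD1 j) //= lerDl sumr_ge0.
by rewrite (bigD1 i) //= lerDl sumr_ge0.
Qed.

Definition crow k M (c : {ffun 'I_k -> 'I_(M.*2.+1)}) : 'rV[R]_k := \row_i (zc (c i))%:~R.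

Lemma sqn_crow k M (c c' : {ffun 'I_k -> 'I_(M.*2.+1)}) :
  sqn (crow c - crow c') = (dist2 c c')%:~R.
Proof.
rewrite /sqn /dist2 rmorph_sum /=; apply: eq_bigr => i _.
by rewrite !mxE rmorphXn /= intrB.
Qed.

(** The inverse of [zc], meaningful only when all coordinates lie in [-M, M]; [inord] yields a
    default value otherwise. *)
Definition enc k M (z : 'rV[int]_k) : {ffun 'I_k -> 'I_(M.*2.+1)} :=
  [ffun i => inord (absz (z 0 i + M%:Z))].

Lemma zc_enc k M (z : 'rV[int]_k) i : (forall i, `|z 0 i| <= M%:Z) -> zc (enc M z i) = z 0 i.
Proof.
move=> H; rewrite /enc /zc ffunE; have := H i; move: (z 0 i) => a h.
rewrite inordK; lia.
Qed.

Lemma crow_enc k M (z : 'rV[int]_k) : (forall i, `|z 0 i| <= M%:Z) -> crow (enc M z) = zrow R z.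
Proof. by move=> H; apply/rowP => i; rewrite !mxE zc_enc. Qed.

(** The symmetrised set lies in a lattice ball of radius at most d/2. The assumption d <= 2M makes
    that ball fit into the box, as [ball_count_asymp] asks. *)
Lemma isodiametric_count k : exists2 K : R, 0 <= K & forall (M : nat) (A : pred {ffun 'I_k.+1 -> 'I_(M.*2.+1)}) (d : R),
  0 <= d <= 2 * M%:R -> (forall c c', A c -> A c' -> (dist2 c c')%:~R <= d ^+ 2) ->
  #|A|%:R <= ball_vol R k.+1 * (d / 2) ^+ k.+1 + K * (2 * M%:R + 1) ^+ k.
Proof.
have [C C0 HC] := ball_count_asymp R k.+1.
exists (C + k.+1%:R) => [|M A d /andP [d0 dM] H]; first by rewrite addr_ge0.
pose D := Num.floor (d ^+ 2).
have /andP [D1 D2] : D%:~R <= d ^+ 2 < D%:~R + 1 by rewrite -[1]/(1%:~R) -intrD; exact: floor_itv.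
have HA x y : A x -> A y -> dist2 x y <= D.
  by move=> Ax Ay; rewrite /D floor_ge_int; exact: H.
have := discrete_isodiametric HA => iso.
have D0 : 0 <= D by rewrite /D floor_ge_int sqr_ge0.
pose S := (absz D %/ 4)%N.
have SD : S%:R * 4 <= d ^+ 2.
  apply: le_trans D1; rewrite -natrM -[leLHS]/((S * 4)%N%:Z%:~R) ler_int.
  by move: D0; rewrite /S; clear; case: D => // a _; lia.
pose r := Num.sqrt (S%:R : R).
have r0 : 0 <= r by rewrite sqrtr_ge0.
have rd : r <= d / 2.
  rewrite -[leRHS]ger0_norm ?divr_ge0 // -sqrtr_sqr ler_wsqrtr // expr_div_n.
  by rewrite ler_pdivlMr //; apply: le_trans SD; rewrite -natrX.
have rM : r <= M%:R by apply: (le_trans rd); lra.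
have SM : (S <= M ^ 2)%N.
  by rewrite -(ler_nat R) natrX -(sqr_sqrtr (ler0n R S)) lerXn2r ?nnegrE.
have c1 : (#|[pred x : {ffun 'I_k.+1 -> 'I_(M.*2.+1)} | (norm2 x *+ 4 <= D)%R]|)%:R <= ball_count R M k.+1 S.
  rewrite /ball_count ler_nat; apply: subset_leq_card; apply/fintype.subsetP => x; rewrite !inE.
  have : 0 <= norm2 x by apply: sumr_ge0 => i _; exact: sqr_ge0.
  by move: D0; rewrite /S; clear; move: (norm2 x) => a; lia.
have := HC M S SM; rewrite -/r ler_norml /= => /andP [_ c2].
have w0 := ball_vol_gt0 R k.+1.
have c3 : ball_vol R k.+1 * r ^+ k.+1 <= ball_vol R k.+1 * (d / 2) ^+ k.+1.
  by rewrite ler_wpM2l ?(ltW w0) // lerXn2r ?nnegrE // divr_ge0.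
have c4 : C * (r + 1) ^+ k <= C * (2 * M%:R + 1) ^+ k.
  have M0 : 0 <= M%:R :> R by [].
  by rewrite ler_wpM2l // lerXn2r ?nnegrE; lra.
have c5 : (#|A|)%:R <= (#|[pred x : {ffun 'I_k.+1 -> 'I_(M.*2.+1)} | (norm2 x *+ 4 <= D)%R]|)%:R + k.+1%:R * (2 * M%:R + 1) ^+ k :> R.
  have -> : 2 * M%:R + 1 = M.*2.+1%:R :> R by rewrite -[in RHS]natr1 -mul2n natrM.
  by rewrite -natrX -natrM -natrD ler_nat.
apply: (le_trans c5); rewrite [(C + _) * _]mulrDl addrA lerD2r; apply: (le_trans c1).
rewrite lerBlDr addrC in c2; apply: (le_trans c2); exact: lerD.
Qed.

(** The lattice points of the simplex dilated by N are distributed over the sets of the cover. A set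
    of diameter p holds at most w (N p / 2)^(k+1) + O(N^k) of them, and the leading coefficients in
    N are compared. *)
Lemma simplex_lower k n (w : 'rV[R]_n) (V : 'M[R]_(k.+1, n)) L Q (e : R) s :
  utri L -> Q *m Q^T = 1%:M -> V = L *m Q -> fcover e (simp w V) s ->
  \det L / k.+1`!%:R <= cost k.+1 s.
Proof.
move=> tL QQ VLQ [s1 s2].
have [C C0 HC] := utri_lower tL.
have [K K0 HK] := isodiametric_count k.
have D0 : 0 < \det L / k.+1`!%:R by rewrite divr_gt0 ?utri_det // ltr0n fact_gt0.
have sum0 : 0 <= \sum_(p <- s) p.2.
  by rewrite big_seq; apply: sumr_ge0 => p /s2 [/andP []].
(* B bounds both the coordinates of points of the simplex in the frame and all diameters of the
   cover, so the box of half-width N B serves for every set. *)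
have [B B0 hB] := ex_nat_ge (\sum_j \sum_j' `|L j j'| + \sum_(p <- s) p.2).
have L0 : 0 <= \sum_j \sum_j' `|L j j'| by apply: sumr_ge0 => j _; apply: sumr_ge0.
apply: (@leading_coef_le R k _ _ C ((size s)%:R * (K * (2 * B%:R + 1) ^+ k))) => //; first exact: ltW.
move=> b; have [N N0 hN] := ex_nat_ge (Num.max b C).
move: hN; rewrite ge_max => /andP [bN CN].
have NR : 0 < N%:R :> R by rewrite ltr0n.
exists N%:R; split => //.
have [t [ut ht st]] := HC 0 _ CN; apply: (le_trans st).
pose M := (N * B)%N.
have ME : M%:R = N%:R * B%:R :> R by rewrite natrM.
have tM z : z \in t -> forall i, `|z 0 i| <= M%:Z.
  move=> zt i; have [y ys ez] := ht _ zt; rewrite addr0 in ez.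
  rewrite -(ler_int R) intr_norm -[X in _ <= X]/(M%:R).
  have -> : (z 0 i)%:~R = (y *m L) 0 i by rewrite -ez mxE.
  apply: (le_trans (norm_mulmx_simplex _ _ (ltW NR) ys)).
  by rewrite ME ler_pM2l //; apply: le_trans hB; rewrite lerDl.
pose A (p : set 'rV[R]_n * R) : pred {ffun 'I_k.+1 -> 'I_(M.*2.+1)} :=
  fun c => `[< p.1 (w + (N%:R^-1 *: crow c) *m Q) >].
have encinj : {in t &, injective (@enc k.+1 M)}.
  move=> z z' zt z't ez; apply/rowP => i.
  by rewrite -(@zc_enc _ M z) ?ez ?zc_enc //; exact: tM.
have le1 : (size t <= \sum_(p <- s) #|A p|)%N.
  have -> : size t = #|[pred c | c \in [seq enc M z | z <- t]]|.
    rewrite -(size_map (@enc k.+1 M)); apply/esym/card_uniqP.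
    by rewrite map_inj_in_uniq.
  apply: card_le_sum_cover => _ /mapP [z zt ->].
  have [y ys ez] := ht _ zt; rewrite addr0 in ez.
  have [|p ps px] := s1 (w + (N%:R^-1 *: zrow R z) *m Q).
    exists (N%:R^-1 *: y); last by rewrite ez VLQ -!scalemxAl mulmxA.
    have := @simplexZ _ _ (N%:R^-1) _ _ ys; rewrite mulVf ?gt_eqF //; apply.
    by rewrite invr_ge0 ltW.
  by exists p => //; apply/asboolP; rewrite crow_enc //; exact: tM.
have le2 p : p \in s -> #|A p|%:R <= ball_vol R k.+1 * (p.2 / 2) ^+ k.+1 * N%:R ^+ k.+1 +
    K * (2 * B%:R + 1) ^+ k * N%:R ^+ k.
  move=> ps; have [/andP [p0 _] pd] := s2 _ ps.
  have pB : p.2 <= B%:R.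
    apply: le_trans hB; rewrite -[leLHS]add0r lerD // (big_rem p) //= lerDl.
    rewrite big_seq; apply: sumr_ge0 => q /mem_rem /s2 [/andP []] //.
  have := HK M (A p) (N%:R * p.2).
  have -> : 0 <= N%:R * p.2 <= 2 * M%:R.
    rewrite mulr_ge0 //= ME mulrCA ler_pM2l //; lra.
  move=> /(_ isT) h; apply: (le_trans (h _)).
    move=> c c' /asboolP hc /asboolP hc'; have := pd _ _ hc hc'.
    rewrite opprD addrACA subrr add0r -mulmxBl sqn_isometry // -scalerBr sqnZ sqn_crow.
    by rewrite exprVn mulrC ler_pdivrMr ?exprn_gt0 // exprMn mulrC.
  have -> : N%:R * p.2 / 2 = p.2 / 2 * N%:R by ring.
  apply: lerD; first by rewrite exprMn mulrA.
  rewrite -mulrA ler_wpM2l // -exprMn lerXn2r ?nnegrE ?addr_ge0 ?mulr_ge0 //.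
  rewrite ME; have : 1 <= N%:R :> R by rewrite ler1n.
  have : 0 <= B%:R :> R by [].
  nra.
apply: (@le_trans _ _ (\sum_(p <- s) #|A p|)%N%:R); first by rewrite ler_nat.
rewrite natr_sum /cost; apply: (@le_trans _ _ (\sum_(p <- s) (ball_vol R k.+1 * (p.2 / 2) ^+ k.+1 * N%:R ^+ k.+1 +
    K * (2 * B%:R + 1) ^+ k * N%:R ^+ k))).
  by rewrite big_seq [leRHS]big_seq; exact: ler_sum.
rewrite big_split /= -mulr_suml lerD2l big_const_seq iter_addr_0 count_predT.
by rewrite -[leLHS]mulr_natl mulrA.
Qed.

End SimplexVolume.

Local Open Scope classical_set_scope.
Local Open Scope ring_scope.

(** * Hausdorff measure through finite covers *)

Section Hausdorff.
Variable R : realType.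

Definition torow n (x : 'I_n -> R) : 'rV[R]_n := \row_i x i.
Definition rowset n (A : set ('I_n -> R)) : set 'rV[R]_n := fun r => A (fun i => r 0 i).

Lemma torowK n (x : 'I_n -> R) : (fun i => torow x 0 i) = x.
Proof. by apply/funext => i; rewrite mxE. Qed.

Lemma rowset_torow n (A : set ('I_n -> R)) x : A x -> rowset A (torow x).
Proof. by rewrite /rowset torowK. Qed.

Lemma edist_sqn n (x y : 'I_n -> R) : Defs.edist x y = Num.sqrt (sqn (torow x - torow y)).
Proof. by rewrite /edist /sqn; congr Num.sqrt; apply: eq_bigr => i _; rewrite !mxE. Qed.

Lemma edist_le n (x y : 'I_n -> R) c : 0 <= c ->
  (Defs.edist x y <= c) = (sqn (torow x - torow y) <= c ^+ 2).
Proof.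
move=> c0; rewrite edist_sqn -[c in LHS]ger0_norm // -sqrtr_sqr.
by rewrite ler_sqrt // sqr_ge0.
Qed.

Lemma diam_ge0 n (U : set ('I_n -> R)) : (0 <= diam U)%E.
Proof. by apply: ereal_sup_ubound; left. Qed.

Lemma diam_le n (U : set ('I_n -> R)) c : 0 <= c ->
  (forall x y, U x -> U y -> Defs.edist x y <= c) -> (diam U <= c%:E)%E.
Proof.
move=> c0 H; apply: ge_ereal_sup => e [->|[x [y [Ux [Uy ->]]]]]; first by rewrite lee_fin.
by rewrite lee_fin H.
Qed.

Lemma edist_le_diam n (U : set ('I_n -> R)) x y : U x -> U y -> ((Defs.edist x y)%:E <= diam U)%E.
Proof. by move=> Ux Uy; apply: ereal_sup_ubound; right; exists x, y. Qed.

Lemma diam0 n : diam (@set0 ('I_n -> R)) = 0%E.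
Proof. by apply/eqP; rewrite eq_le diam_ge0 andbT; apply: diam_le. Qed.

Lemma htermE n k (U : set ('I_n -> R)) :
  hterm k.+1 U = (ball_vol R k.+1 * (fine (diam U) / 2) ^+ k.+1)%:E.
Proof.
rewrite /hterm; case: pselect => [->|_]; first by rewrite diam0 /= mul0r expr0n mulr0.
by rewrite expr_div_n mulrA mulrAC.
Qed.

Lemma hterm_ge0 n k (U : set ('I_n -> R)) : (0 <= hterm k.+1 U)%E.
Proof.
rewrite htermE lee_fin mulr_ge0 ?(ltW (ball_vol_gt0 _ _)) // exprn_ge0 // divr_ge0 //.
by rewrite fine_ge0 // diam_ge0.
Qed.

Lemma hausdorff_le k n (A : set ('I_n -> R)) v :
  (forall e ep : R, 0 < e -> 0 < ep -> hcov k.+1 e (v + ep) (rowset A)) ->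
  (hausdorff k.+1 A <= v%:E)%E.
Proof.
move=> H; apply: ge_ereal_sup => _ [d d0 ->].
apply/lee_addgt0Pr => ep ep0.
have [s [s1 s2] cs] := H _ _ d0 ep0.
(* The finite cover is padded with empty sets, whose terms vanish because the exponent is
   positive. *)
pose dflt : set 'rV[R]_n * R := (set0, 0).
pose U i : set ('I_n -> R) := fun x => (nth dflt s i).1 (torow x).
have Ud i : (i < size s)%N -> 0 <= (nth dflt s i).2 <= d /\ (diam (U i) <= ((nth dflt s i).2)%:E)%E.
  move=> il; have [/andP [p0 pd] pp] := s2 _ (mem_nth dflt il); split; first by rewrite p0.
  apply: diam_le => // x y Ux Uy; rewrite edist_le //; exact: pp.
have U0 i : (size s <= i)%N -> U i = set0.
  by move=> il; apply/seteqP; split => // x; rewrite /U nth_default.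
apply: (@le_trans _ _ (\sum_(0 <= i <oo) hterm k.+1 (U i))%E).
  apply: ereal_inf_lbound; exists U; split.
    move=> x Ax; have [p ps px] := s1 _ (rowset_torow Ax).
    by exists (index p s) => //; rewrite /U nth_index.
  split => // i; have [il|il] := ltnP i (size s).
    by have [/andP [_ pd] h] := Ud _ il; apply: (le_trans h); rewrite lee_fin.
  by rewrite U0 // diam0 lee_fin ltW.
rewrite (nneseries_split 0 (size s)); last by move=> i _; exact: hterm_ge0.
rewrite add0n (@eseries0 _ _ (size s)) ?adde0; last first.
  by move=> i il _; rewrite U0 // htermE diam0 /= mul0r expr0n mulr0.
apply: (@le_trans _ _ (cost k.+1 s)%:E); last by rewrite -EFinD lee_fin.
rewrite /cost (big_nth dflt) -sumEFin big_nat_cond [leRHS]big_nat_cond.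
apply: lee_sum => i /andP [/andP [_ il] _]; have [/andP [p0 pd] h] := Ud _ il.
have fd : fine (diam (U i)) <= (nth dflt s i).2.
  rewrite -lee_fin fineK // ge0_fin_numE ?diam_ge0 //; exact: le_lt_trans h (ltry _).
rewrite htermE lee_fin ler_wpM2l ?(ltW (ball_vol_gt0 _ _)) // lerXn2r ?nnegrE //.
- by rewrite divr_ge0 // fine_ge0 // diam_ge0.
- by rewrite divr_ge0.
- by rewrite ler_pM2r // invr_gt0.
Qed.

Lemma dot_le n (x y : 'rV[R]_n) a b : 0 <= a -> 0 <= b -> sqn x <= a ^+ 2 -> sqn y <= b ^+ 2 ->
  \sum_i x 0 i * y 0 i <= a * b.
Proof.
move=> a0 b0 hx hy.
have z0 (u v : 'rV[R]_n) : sqn u <= 0 -> \sum_i u 0 i * v 0 i = 0.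
  move=> h; have /sqn_eq0 -> : sqn u = 0 by apply/eqP; rewrite eq_le h sqn_ge0.
  by rewrite big1 // => i _; rewrite mxE mul0r.
move: a0; rewrite le_eqVlt => /orP [/eqP a0|a0].
  by rewrite z0 ?mulr_ge0 // -?a0 ?mul0r //; move: hx; rewrite -a0 expr0n.
move: b0; rewrite le_eqVlt => /orP [/eqP b0|b0].
  rewrite -b0 mulr0; under eq_bigr do rewrite mulrC.
  by rewrite z0 //; move: hy; rewrite -b0 expr0n.
have ab : 0 < 2 * (a * b) by rewrite !mulr_gt0.
rewrite -(ler_pM2l ab) mulr_sumr.
apply: (@le_trans _ _ (b ^+ 2 * sqn x + a ^+ 2 * sqn y)).
  rewrite /sqn !mulr_sumr -big_split /=; apply: ler_sum => i _.
  have := sqr_ge0 (b * x 0 i - a * y 0 i); lra.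
have := ler_wpM2l (sqr_ge0 b) hx; have := ler_wpM2l (sqr_ge0 a) hy; lra.
Qed.

Lemma sqn_triangle n (x y : 'rV[R]_n) a b : 0 <= a -> 0 <= b ->
  sqn x <= a ^+ 2 -> sqn y <= b ^+ 2 -> sqn (x + y) <= (a + b) ^+ 2.
Proof.
move=> a0 b0 hx hy.
have -> : sqn (x + y) = sqn x + sqn y + 2 * \sum_i x 0 i * y 0 i.
  rewrite /sqn mulr_sumr -!big_split /=; apply: eq_bigr => i _; rewrite mxE; ring.
have := dot_le a0 b0 hx hy; lra.
Qed.

Lemma coordB_continuous n (u : 'rV[R]_n) i : continuous (fun r : 'rV[R]_n => r 0 i - u 0 i).
Proof.
by move=> r; apply: continuousB; [exact: coord_continuous | exact: cst_continuous].
Qed.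

Lemma sqn_continuous n (u : 'rV[R]_n) : continuous (fun r : 'rV[R]_n => sqn (r - u)).
Proof.
have -> : (fun r : 'rV[R]_n => sqn (r - u)) =
    (fun r => \sum_i (r 0 i - u 0 i) * (r 0 i - u 0 i)).
  by apply/funext => r; apply: eq_bigr => i _; rewrite !mxE expr2.
move=> r; apply: cvg_big; [exact: add_continuous | exact: nbhs_filter |].
by move=> i _; have := continuousM (@coordB_continuous n u i r) (@coordB_continuous n u i r).
Qed.

Lemma open_thickening n (U : set ('I_n -> R)) c :
  open [set r : 'rV[R]_n | exists2 u, U u & sqn (r - torow u) < c].
Proof.
have -> : [set r : 'rV[R]_n | exists2 u, U u & sqn (r - torow u) < c] =
  \bigcup_(u in U) ((fun r : 'rV[R]_n => sqn (r - torow u)) @^-1` [set x | x < c]).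
  by apply/seteqP; split => r [u Uu h]; exists u.
apply: bigcup_open => u _; apply: open_comp; last exact: open_lt.
by move=> r _; exact: sqn_continuous.
Qed.

Lemma sum_fset_le (r : seq nat) (f : nat -> R) m : uniq r -> (forall i, i \in r -> (i < m)%N) ->
  (forall i, 0 <= f i) -> \sum_(i <- r) f i <= \sum_(0 <= i < m) f i.
Proof.
move=> ur rm f0.
have -> : \sum_(i <- r) f i = \sum_(i <- [seq i <- iota 0 m | i \in r]) f i.
  apply: perm_big; apply: uniq_perm => //; first exact: filter_uniq (iota_uniq _ _).
  move=> i; rewrite mem_filter mem_iota add0n /=.
  by case ir : (i \in r) => //; rewrite rm.
rewrite big_filter big_mkcond /= /index_iota subn0; apply: ler_sum => i _.
by case: ifP.
Qed.

Lemma sum_geo_half (ep : R) m : 0 <= ep -> \sum_(0 <= i < m) ep / 2 ^+ i.+1 <= ep.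
Proof.
move=> ep0; suff -> : \sum_(0 <= i < m) ep / 2 ^+ i.+1 = ep - ep / 2 ^+ m.
  by rewrite gerBl divr_ge0 // exprn_ge0.
elim: m => [|m IH]; first by rewrite big_geq // expr0 divr1 subrr.
have X0 : 2 ^+ m != 0 :> R by rewrite expf_neq0.
by rewrite big_nat_recr //= IH exprS; field.
Qed.

(** Room for replacing a set by an open neighbourhood of radius rho at a prescribed extra cost. *)
Lemma enlarge_diam k (d e ep : R) : 0 <= d -> d < e -> 0 < ep ->
  exists2 rho : R, 0 < rho & d + 2 * rho <= e /\
  ball_vol R k.+1 * ((d + 2 * rho) / 2) ^+ k.+1 <= ball_vol R k.+1 * (d / 2) ^+ k.+1 + ep.
Proof.
move=> d0 de ep0; have w0 := ball_vol_gt0 R k.+1; set w := ball_vol _ _ in w0 *.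
pose K := w * (k.+1%:R * e ^+ k).
have e0 : 0 < e by lra.
have K0 : 0 < K by rewrite !mulr_gt0 // exprn_gt0.
pose rho := Num.min ((e - d) / 2) (ep / K).
have r0 : 0 < rho by rewrite lt_min !divr_gt0 // subr_gt0.
have r1 : rho <= (e - d) / 2 by rewrite ge_min lexx.
have r2 : rho * K <= ep by rewrite -ler_pdivlMr // ge_min lexx orbT.
exists rho => //; split; first by lra.
have E : (d + 2 * rho) / 2 = d / 2 + rho by lra.
have rr : rho <= d / 2 + rho by lra.
have /andP [_ h] := exprB_le k (ltW r0) rr; rewrite addrK in h.
have h2 : (d / 2 + rho) ^+ k <= e ^+ k by rewrite lerXn2r ?nnegrE; lra.
have h3 : w * (k.+1%:R * rho * (d / 2 + rho) ^+ k) <= ep.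
  apply: le_trans r2; have -> : rho * K = w * (k.+1%:R * rho * e ^+ k) by rewrite /K; ring.
  by rewrite ler_wpM2l ?(ltW w0) // ler_wpM2l // mulr_ge0 // ltW.
rewrite E; have := ler_wpM2l (ltW w0) h; rewrite mulrBr => h4.
by rewrite -lerBlDl; apply: (le_trans h4).
Qed.

(** Compactness reduces countable covers to finite ones. Sets of diameter at most e/2 are thickened
    to open sets of diameter at most e, at extra cost ep / 2^(i+1), and finitely many of these cover
    A. *)
Lemma hausdorff_ge k n (A : set ('I_n -> R)) v e : compact (rowset A) -> 0 < e ->
  (forall s, fcover e (rowset A) s -> v <= cost k.+1 s) ->
  (v%:E <= hausdorff k.+1 A)%E.
Proof.
move=> cA e0 H; have e2 : 0 < e / 2 by lra.
apply: (@le_trans _ _ (hcontent k.+1 (e / 2) A)); last first.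
  by apply: ereal_sup_ubound; exists (e / 2).
apply: le_ereal_inf_tmp => _ [U [AU [Ud ->]]].
apply/lee_addgt0Pr => ep ep0.
pose d i := fine (diam (U i)).
have dfin i : diam (U i) \is a fin_num.
  by rewrite ge0_fin_numE ?diam_ge0 //; exact: le_lt_trans (Ud i) (ltry _).
have d0 i : 0 <= d i by rewrite fine_ge0 // diam_ge0.
have de i : d i < e.
  apply: (@le_lt_trans _ _ (e / 2)); last lra.
  by rewrite -lee_fin fineK.
have ep2 i : 0 < ep / 2 ^+ i.+1 by rewrite divr_gt0 // exprn_gt0.
have /choice [rho rhoP] : forall i, exists rho : R, [/\ 0 < rho, d i + 2 * rho <= e &
    ball_vol R k.+1 * ((d i + 2 * rho) / 2) ^+ k.+1 <= ball_vol R k.+1 * (d i / 2) ^+ k.+1 + ep / 2 ^+ i.+1].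
  by move=> i; have [r r0 [h1 h2]] := enlarge_diam k (d0 i) (de i) (ep2 i); exists r.
pose W i : set 'rV[R]_n := [set r | exists2 u, U i u & sqn (r - torow u) < rho i ^+ 2].
move: cA; rewrite compact_cover cover_compactE => cA.
have [|r Ar|D _ AD] := cA nat setT (fun i => rowset A `&` W i).
- by exists W => // i _; exact: open_thickening.
- have [i _ Ui] := AU _ Ar; exists i => //; split => //; exists (fun i => r 0 i) => //.
  have -> : r - torow (fun i => r 0 i) = 0 by apply/rowP => j; rewrite !mxE subrr.
  rewrite /sqn big1; last by move=> j _; rewrite mxE expr0n.
  by rewrite exprn_gt0 //; have [] := rhoP i.
pose E : seq nat := finmap.enum_fset D.
pose s := [seq (W i, d i + 2 * rho i) | i <- E].
have sc : fcover e (rowset A) s.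
  split; first by move=> r Ar; have [i iD [_ Wr]] := AD _ Ar; exists (W i, d i + 2 * rho i) => //; apply/mapP; exists i.
  move=> _ /mapP [i _ ->] /=; have [r0 re _] := rhoP i; split.
    by rewrite re andbT addr_ge0 // mulr_ge0 // ltW.
  move=> x y [u Uu xu] [u' Uu' yu].
  have uu : sqn (torow u - torow u') <= d i ^+ 2.
    by rewrite -edist_le // -lee_fin fineK //; exact: edist_le_diam.
  have yu' : sqn (torow u' - y) <= rho i ^+ 2.
    have -> : sqn (torow u' - y) = sqn (y - torow u').
      by rewrite /sqn; apply: eq_bigr => j _; rewrite !mxE; ring.
    exact: ltW.
  have := sqn_triangle (d0 i) (ltW r0) uu yu'.
  move=> /(sqn_triangle (ltW r0) (addr_ge0 (d0 i) (ltW r0)) (ltW xu)).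
  have -> : x - torow u + (torow u - torow u' + (torow u' - y)) = x - y.
    by apply/rowP => j; rewrite !mxE; ring.
  by have -> : rho i + (d i + rho i) = d i + 2 * rho i by lra.
have := H _ sc; rewrite /cost big_map /= => vle.
have [m hm] : exists m, forall i, i \in E -> (i < m)%N.
  by exists (\max_(i <- E) i).+1 => i iD; rewrite ltnS; apply: leq_bigmax_seq.
pose g i := ball_vol R k.+1 * (d i / 2) ^+ k.+1.
have g0 i : 0 <= g i.
  by rewrite mulr_ge0 ?(ltW (ball_vol_gt0 _ _)) // exprn_ge0 // divr_ge0.
have vle2 : v <= \sum_(0 <= i < m) g i + ep.
  apply: (le_trans vle).
  apply: (@le_trans _ _ (\sum_(i <- E) (g i + ep / 2 ^+ i.+1))).
    by apply: ler_sum => i _; have [] := rhoP i.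
  have := @sum_fset_le E (fun i => g i + ep / 2 ^+ i.+1) m (finmap.fset_uniq D) hm.
  move=> h; apply: (le_trans (h _)); first by move=> i; rewrite addr_ge0 // ltW.
  by rewrite big_split /= lerD2l sum_geo_half // ltW.
apply: (@le_trans _ _ ((\sum_(0 <= i < m) g i + ep)%:E)); first by rewrite lee_fin.
rewrite EFinD leeD2r // -sumEFin.
apply: (@le_trans _ _ (\sum_(0 <= i < m) hterm k.+1 (U i))%E).
  by apply: lee_sum => i _; rewrite htermE.
by apply: nneseries_lim_ge => i _ _; exact: hterm_ge0.
Qed.

End Hausdorff.

(** * Sections of the boundary of the cross-polytope *)

Section Facets.
Variable R : realType.

(* The rows of row_mx A B are two normals of the k-dimensional row space of row_mx C E. *)
Lemma gram_block k (C : 'M[R]_(k, 2)) (E : 'M[R]_k) (A : 'M[R]_2) (B : 'M[R]_(2, k)) :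
  C *m A^T + E *m B^T = 0 -> \det (row_mx C E *m (row_mx C E)^T) != 0 ->
  \det (row_mx C E *m (row_mx C E)^T) * \det A ^+ 2 =
  \det E ^+ 2 * \det (row_mx A B *m (row_mx A B)^T).
Proof.
rewrite !tr_row_mx !mul_row_col => o.
have o' : A *m C^T + B *m E^T = 0.
  by rewrite -[LHS]trmxK linearD /= !trmx_mul !trmxK o trmx0.
set G := \det (C *m C^T + _); set H := \det (A *m A^T + _) => G0.
pose M := block_mx A B C E.
have e1 : \det M ^+ 2 = H * G.
  rewrite expr2 -{2}det_tr -det_mulmx /M tr_block_mx mulmx_block o o' det_ublock.
  by [].
have e2 : \det E * \det M = \det A * G.
  have : \det (block_mx 1%:M 0 C E *m M^T) = \det A * G.
    by rewrite /M tr_block_mx mulmx_block o !mul1mx !mul0mx !addr0 det_ublock det_tr.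
  by rewrite det_mulmx det_lblock det1 mul1r det_tr.
have : (\det E * \det M) ^+ 2 = (\det A * G) ^+ 2 by rewrite e2.
rewrite !exprMn e1 => e3; apply: (mulIf G0); rewrite -[RHS]mulrA e3; ring.
Qed.

Definition sg (b : bool) : R := (-1) ^+ b.

Lemma sgK b x : sg b * (sg b * x) = x.
Proof. by rewrite mulrA -expr2 sqrr_sign mul1r. Qed.

Variable k : nat.
Variables (a : 'I_k.+2 -> R) (ep : {ffun 'I_k.+1 -> bool}) (b : R).

Definition fcoef j := a ord0 - sg (ep j) * a (lift ord0 j).
Definition fproj := a ord0 + \sum_j sg (ep j) * a (lift ord0 j).

(** The rows of [facetV] are the edges from the vertex [facetP], of index 0, to the other vertices.
    Splitting off two columns leaves the diagonal block [facetE], so that [gram_block] applies. *)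
Definition facetC : 'M[R]_(k, 2) :=
  \matrix_(i, j) if j == 0 then b / fcoef ord0 - b / fcoef (lift ord0 i)
                 else - (sg (ep ord0) * (b / fcoef ord0)).
Definition facetE : 'M[R]_k := diag_mx (\row_i (sg (ep (lift ord0 i)) * (b / fcoef (lift ord0 i)))).
Definition facetV : 'M[R]_(k, 2 + k) := row_mx facetC facetE.
Definition facetP : 'rV[R]_(2 + k) :=
  row_mx (\row_(j < 2) if j == 0 then 1 - b / fcoef ord0 else sg (ep ord0) * (b / fcoef ord0)) 0.

(** The two normals of the simplex, split in the same way: row 0 is the sign vector (1, ep), normal
    to the facet, and row 1 is a. *)
Let nA : 'M[R]_2 := \matrix_(i, j)
  if i == 0 then (if j == 0 then 1 else sg (ep ord0)) else (if j == 0 then a ord0 else a (lift ord0 ord0)).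
Let nB : 'M[R]_(2, k) := \matrix_(i, j)
  if i == 0 then sg (ep (lift ord0 j)) else a (lift ord0 (lift ord0 j)).

Hypothesis b0 : 0 < b.
Hypothesis c0 : forall j, 0 < fcoef j.

Lemma det_mx22 (M : 'M[R]_2) : \det M = M 0 0 * M 1 1 - M 0 1 * M 1 0.
Proof.
rewrite (expand_det_row _ 0) !big_ord_recl big_ord0 addr0 /cofactor !det_mx11 !mxE /=.
have -> : lift 0 0 = 1 :> 'I_2 by apply: val_inj.
have -> : lift 1 0 = 0 :> 'I_2 by apply: val_inj.
rewrite addn0 expr0 addn1 expr1; ring.
Qed.

(** All vertices have product 1 with the sign vector and a_0 - b with a, because (b / c_j) c_j =
    b. *)
Lemma facet_normal : facetC *m nA^T + facetE *m nB^T = 0.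
Proof.
apply/matrixP => i j; rewrite mxE [X in X + _]mxE !big_ord_recl big_ord0 addr0.
rewrite mul_diag_mx !mxE /=.
have n0 : fcoef ord0 != 0 by rewrite gt_eqF.
have ni : fcoef (lift ord0 i) != 0 by rewrite gt_eqF.
case: (j =P 0) => _ /=.
  have s1 := sqrr_sign R (ep ord0); have s2 := sqrr_sign R (ep (lift ord0 i)).
  rewrite mulr1 mulNr mulrAC -expr2 s1 mul1r mulrAC -expr2 s2 mul1r; ring.
have e1 : b / fcoef ord0 * (a ord0 - sg (ep ord0) * a (lift ord0 ord0)) = b by exact: divfK.
have e2 : b / fcoef (lift ord0 i) * (a ord0 - sg (ep (lift ord0 i)) * a (lift ord0 (lift ord0 i))) = b.
  exact: divfK.
rewrite -[RHS](subrr b) -[X in _ = X - _]e1 -[X in _ = _ - X]e2.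
by move: (b / _) (b / _) (sg _) (sg _) (a _) (a _) (a _) => *; ring.
Qed.

Lemma facet_inj (x : 'rV[R]_k) : x *m facetV = 0 -> x = 0.
Proof.
rewrite mul_mx_row => /eqP; rewrite row_mx_eq0 => /andP [_ /eqP /matrixP H].
apply/rowP => i; have := H 0 i; rewrite mul_mx_diag !mxE => /eqP.
rewrite !mulf_eq0 signr_eq0 invr_eq0 (gt_eqF b0) (gt_eqF (c0 _)) !orbF => /eqP ->.
by [].
Qed.

Lemma det_nA : \det nA ^+ 2 = fcoef ord0 ^+ 2.
Proof.
rewrite det_mx22 !mxE /= /fcoef mul1r.
have s1 : sg (ep ord0) * sg (ep ord0) = 1 by rewrite -expr2 sqrr_sign.
rewrite !sqrrB; move: (sg _) (a _) (a _) s1 => s x y s1.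
have -> : (s * x) ^+ 2 = (s * s) * x ^+ 2 by ring.
have -> : (s * y) ^+ 2 = (s * s) * y ^+ 2 by ring.
rewrite s1; ring.
Qed.

Hypothesis ha : on_sphere a.

(** The Gram determinant of two vectors of squared norms k + 2 and 1 with scalar product X. *)
Lemma det_nN : \det (row_mx nA nB *m (row_mx nA nB)^T) = k.+2%:R - fproj ^+ 2.
Proof.
rewrite tr_row_mx mul_row_col det_mx22 !mxE.
rewrite !big_ord_recl !big_ord0 !mxE /=.
have s1 : sg (ep ord0) * sg (ep ord0) = 1 by rewrite -expr2 sqrr_sign.
have t1 : \sum_i nB 0 i * nB^T i 0 = k%:R.
  rewrite -[k in RHS]card_ord -sum1_card natr_sum; apply: eq_bigr => i _.
  by rewrite !mxE /= -expr2 sqrr_sign.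
have t2 : \sum_i nB 1 i * nB^T i 1 = \sum_(i < k) a (lift ord0 (lift ord0 i)) ^+ 2.
  by apply: eq_bigr => i _; rewrite !mxE /= -expr2.
have t3 : \sum_i nB 0 i * nB^T i 1 = \sum_(i < k) sg (ep (lift ord0 i)) * a (lift ord0 (lift ord0 i)).
  by apply: eq_bigr => i _; rewrite !mxE.
have t4 : \sum_i nB 1 i * nB^T i 0 = \sum_(i < k) sg (ep (lift ord0 i)) * a (lift ord0 (lift ord0 i)).
  by apply: eq_bigr => i _; rewrite !mxE mulrC.
rewrite t1 t2 t3 t4 /fproj big_ord_recl.
move: ha; rewrite /on_sphere !big_ord_recl => ha'.
move: ha'; set S2 := \sum_i _ => ha'; set S1 := \sum_i _.
rewrite -2!natr1 -[X in _ = X - _]mulr1 -[X in _ = _ * X - _]ha' s1; ring.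
Qed.

(** [gram_block] yields det L^2 c_0^2 = (prod_{j>0} b / c_j)^2 (k + 2 - X^2). This also shows that
    the radicand is non-negative. *)
Lemma facet_frame : exists L Q, [/\ utri L, Q *m Q^T = 1%:M, facetV = L *m Q,
   0 <= k.+2%:R - fproj ^+ 2 &
   \det L = b ^+ k / (\prod_j fcoef j) * Num.sqrt (k.+2%:R - fproj ^+ 2)].
Proof.
have [L [Q [tL QQ VLQ]]] := gram_schmidt facet_inj.
have D0 := utri_det tL.
have G : \det (facetV *m facetV^T) = \det L ^+ 2.
  by rewrite VLQ trmx_mul mulmxA -(mulmxA L) QQ mulmx1 det_mulmx det_tr expr2.
have G0 : \det (facetV *m facetV^T) != 0 by rewrite G expf_neq0 // gt_eqF.
have := gram_block facet_normal G0; rewrite -/facetV G det_nA det_nN.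
pose P : R := \prod_(i < k) (b / fcoef (lift ord0 i)).
have Pp : 0 < P by apply: prodr_gt0 => i _; rewrite divr_gt0.
have -> : \det facetE ^+ 2 = P ^+ 2.
  rewrite /facetE det_diag -!prodrXl; apply: eq_bigr => i _.
  by rewrite mxE exprMn sqrr_sign mul1r.
move=> e; have C0 := c0 ord0.
have H0 : 0 <= k.+2%:R - fproj ^+ 2.
  by rewrite -(pmulr_rge0 _ (exprn_gt0 2 Pp)) -e mulr_ge0 // sqr_ge0.
exists L, Q; split => //.
have -> : b ^+ k / (\prod_j fcoef j) = P / fcoef ord0.
  rewrite big_ord_recl invfM mulrCA mulrC; congr (_ / _).
  by rewrite /P big_split /= prodfV prodr_const card_ord.
apply/eqP; rewrite -(eqrXn2 (n := 2)) //; [|exact: ltW|]; last first.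
  by rewrite mulr_ge0 ?sqrtr_ge0 // ltW // divr_gt0.
by rewrite exprMn sqr_sqrtr // expr_div_n mulrAC -e mulfK // expf_neq0 // gt_eqF.
Qed.

End Facets.

Section FacetCoordinates.
Variable R : realType.
Variable k : nat.
Implicit Types (a x : 'I_k.+2 -> R) (ep : {ffun 'I_k.+1 -> bool}) (b : R).

Lemma facet_point a ep b (y : 'rV[R]_k) :
  let p : 'rV[R]_k.+2 := facetP a ep b + y *m facetV a ep b in
  let c := b / fcoef a ep ord0 in
  [/\ p 0 ord0 = 1 - c * (1 - \sum_i y 0 i) - \sum_i y 0 i * (b / fcoef a ep (lift ord0 i)),
      p 0 (lift ord0 ord0) = sg R (ep ord0) * (c * (1 - \sum_i y 0 i)) &
      forall i, p 0 (lift ord0 (lift ord0 i)) =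
        sg R (ep (lift ord0 i)) * (y 0 i * (b / fcoef a ep (lift ord0 i)))].
Proof.
move=> p c.
have E : p = row_mx (\row_(j < 2) if j == 0 then 1 - c else sg R (ep ord0) * c) 0 +
   row_mx (y *m facetC a ep b) (y *m facetE a ep b) :> 'rV[R]_(2 + k).
  by rewrite -mul_mx_row.
have j0 : ord0 = lshift k ord0 :> 'I_(2 + k) by apply: val_inj.
have j1 : lift ord0 ord0 = lshift k 1 :> 'I_(2 + k) by apply: val_inj.
have j2 i : lift ord0 (lift ord0 i) = rshift 2 i :> 'I_(2 + k) by apply: val_inj.
split.
- rewrite E j0 mxE !row_mxEl !mxE /=.
  have -> : \sum_i y 0 i * facetC a ep b i ord0 =
      c * (\sum_i y 0 i) - \sum_i y 0 i * (b / fcoef a ep (lift ord0 i)).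
    by rewrite mulr_sumr -sumrB; apply: eq_bigr => i _; rewrite mxE /= -/c; ring.
  by move: (\sum_i _) (\sum_i _) => s1 s2; ring.
- rewrite E j1 mxE !row_mxEl !mxE /=.
  have -> : \sum_i y 0 i * facetC a ep b i 1 = - (sg R (ep ord0) * (c * \sum_i y 0 i)).
    by rewrite !mulr_sumr -sumrN; apply: eq_bigr => i _; rewrite mxE /= -/c; ring.
  by move: (\sum_i _) => s1; ring.
- move=> i; rewrite E j2 mxE !row_mxEr mul_mx_diag !mxE add0r; ring.
Qed.

Definition section a t : set ('I_k.+2 -> R) := hyperplane a t `&` @cross_boundary R k.+2.

(** The equation l1norm x = 1 eliminates x_0 from dotp a x = t. *)
Lemma section_sum a t x : section a t x -> 0 <= x ord0 ->
  \sum_j (a ord0 * `|x (lift ord0 j)| - a (lift ord0 j) * x (lift ord0 j)) = a ord0 - t.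
Proof.
move=> [h1 h2] x0.
have <- : a ord0 * x ord0 + \sum_j a (lift ord0 j) * x (lift ord0 j) = t.
  by rewrite -[RHS]h1 [RHS]big_ord_recl.
have e : \sum_j `|x (lift ord0 j)| = 1 - x ord0.
  by rewrite -[1]h2 /l1norm [in RHS]big_ord_recl (ger0_norm x0) addrC addKr.
by rewrite sumrB -mulr_sumr e; ring.
Qed.

(** With ep the signs of x, [section_sum] reads sum_j c_j |x_j| = b, so the numbers c_j |x_j| / b
    are barycentric coordinates of x. *)
Lemma section_facet a t x : t < a ord0 -> 
  (forall ep j, 0 < fcoef a ep j) -> section a t x -> 0 <= x ord0 ->
  exists ep, simp (facetP a ep (a ord0 - t)) (facetV a ep (a ord0 - t)) (torow x).
Proof.
move=> ta c0 xs x0; pose b := a ord0 - t; have b0 : 0 < b by rewrite subr_gt0.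
pose ep : {ffun 'I_k.+1 -> bool} := [ffun j => x (lift ord0 j) < 0].
have sgx j : x (lift ord0 j) = sg R (ep j) * `|x (lift ord0 j)|.
  by rewrite ffunE /sg; exact: numEsign.
have sumc : \sum_j fcoef a ep j * `|x (lift ord0 j)| = b.
  rewrite /b -(section_sum xs x0); apply: eq_bigr => j _.
  by rewrite mulrBl; congr (_ - _); rewrite [in RHS]sgx; ring.
have cn j : fcoef a ep j != 0 by rewrite gt_eqF.
pose y : 'rV[R]_k := \row_i (fcoef a ep (lift ord0 i) * `|x (lift ord0 (lift ord0 i))| / b).
have ysum : b * (1 - \sum_i y 0 i) = fcoef a ep ord0 * `|x (lift ord0 ord0)|.
  rewrite mulrBr mulr1 mulr_sumr -[X in X - _]sumc big_ord_recl -addrA -sumrB big1 ?addr0 //.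
  by move=> i _; rewrite mxE [b * _]mulrC divfK ?subrr // gt_eqF.
have yb i : y 0 i * (b / fcoef a ep (lift ord0 i)) = `|x (lift ord0 (lift ord0 i))|.
  by rewrite mxE; field; rewrite cn gt_eqF.
exists ep, y.
  split; first by move=> i; rewrite mxE !mulr_ge0 ?invr_ge0 ?(ltW b0) // ltW.
  rewrite -subr_ge0 -(pmulr_rge0 _ b0) ysum mulr_ge0 // ltW //; exact: c0.
have := facet_point a ep b y; rewrite /= -/b; set p : 'rV[R]_k.+2 := facetP _ _ _ + _ => -[p0 p1 p2].
have e1 : b / fcoef a ep ord0 * (1 - \sum_i y 0 i) = `|x (lift ord0 ord0)|.
  by rewrite mulrAC ysum mulrC mulKf.
apply/rowP => j; rewrite mxE.
case: (unliftP ord0 j) => [j' ->|->]; last first.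
  rewrite p0 e1; under eq_bigr do rewrite yb.
  move: xs => [_]; rewrite /cross_boundary /= /l1norm !big_ord_recl (ger0_norm x0); lra.
case: (unliftP ord0 j') => [i ->|->]; first by rewrite p2 yb -sgx.
by rewrite p1 e1 -sgx.
Qed.

End FacetCoordinates.

(** * Covers of the whole section *)

Section SectionVolume.
Variable R : realType.
Variable k : nat.
Implicit Types (a x : 'I_k.+3 -> R) (ep : {ffun 'I_k.+2 -> bool}) (b : R).

Definition facet_vol a b ep : R :=
  b ^+ k.+1 / (\prod_j fcoef a ep j) * Num.sqrt (k.+3%:R - fproj a ep ^+ 2) / k.+1`!%:R.

Lemma section_hcov a t : on_sphere a -> t < a ord0 -> (forall ep j, 0 < fcoef a ep j) ->
  (forall x, section a t x -> 0 <= x ord0) -> forall e d : R, 0 < e -> 0 < d ->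
  hcov k.+1 e (\sum_(ep : {ffun 'I_k.+2 -> bool}) facet_vol a (a ord0 - t) ep + d)
    (rowset (section a t)).
Proof.
move=> ha ta c0 x0 e d e0 d0.
have b0 : 0 < a ord0 - t by rewrite subr_gt0.
pose K : R := #|{ffun 'I_k.+2 -> bool}|%:R.
have K0 : 0 < K by rewrite ltr0n card_ffun expn_gt0 card_bool.
pose F ep := simp (facetP a ep (a ord0 - t)) (facetV a ep (a ord0 - t)).
have Fc ep : hcov k.+1 e (facet_vol a (a ord0 - t) ep + d / K) (F ep).
  have [L [Q [tL QQ VLQ _ dL]]] := facet_frame b0 (c0 ep) ha.
  have dK : 0 < d / K by rewrite divr_gt0.
  rewrite /facet_vol -dL; exact: (simplex_upper _ tL QQ VLQ e0 dK).
have := hcov_bigcup (r := enum {ffun 'I_k.+2 -> bool}) (fun ep _ => Fc ep).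
have -> : \sum_(i <- enum {ffun 'I_k.+2 -> bool}) (facet_vol a (a ord0 - t) i + d / K) =
    \sum_(ep : {ffun 'I_k.+2 -> bool}) facet_vol a (a ord0 - t) ep + d.
  rewrite big_enum /= big_split /= sumr_const -/K; congr (_ + _).
  by rewrite -[LHS]mulr_natr divfK // gt_eqF.
apply: hcov_sub => r rs.
have [ep h] := section_facet ta c0 rs (x0 _ rs).
exists ep; first by rewrite mem_enum.
by move: h; rewrite /F; congr (simp _ _ _); apply/rowP => i; rewrite mxE.
Qed.

Lemma on_sphere_e1 : on_sphere (@e1 R k.+3).
Proof.
by rewrite /on_sphere big_ord_recl /e1 /= expr1n big1 ?addr0 // => i _; rewrite expr0n.
Qed.

Lemma fcoef_e1 ep j : fcoef (@e1 R k.+3) ep j = 1.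
Proof. by rewrite /fcoef /e1 /= mulr0 subr0. Qed.

Lemma fproj_e1 ep : fproj (@e1 R k.+3) ep = 1.
Proof. by rewrite /fproj /e1 /= big1 ?addr0 // => j _; rewrite mulr0. Qed.

Lemma facet_vol_e1 b ep : facet_vol (@e1 R k.+3) b ep = Num.sqrt k.+2%:R / k.+1`!%:R * b ^+ k.+1.
Proof.
rewrite /facet_vol fproj_e1 big1 ?divr1; last by move=> j _; rewrite fcoef_e1.
by rewrite expr1n -[k.+3%:R]natr1 addrK -mulrA mulrC.
Qed.

Lemma sum_facet_vol_e1 b : \sum_(ep : {ffun 'I_k.+2 -> bool}) facet_vol (@e1 R k.+3) b ep =
  Num.sqrt k.+2%:R / k.+1`!%:R * 2 ^+ k.+2 * b ^+ k.+1.
Proof.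
under eq_bigr do rewrite facet_vol_e1.
by rewrite sumr_const card_ffun card_bool card_ord -[LHS]mulr_natr natrX mulrAC.
Qed.

Lemma section_e1 t x : section (@e1 R k.+3) t x <->
  x ord0 = t /\ `|t| + \sum_j `|x (lift ord0 j)| = 1.
Proof.
rewrite /section /hyperplane /cross_boundary /setI /= /dotp /l1norm big_ord_recl big1.
  rewrite addr0 /e1 /= mul1r big_ord_recl; split=> [[<-]|[<-]] //.
by move=> i _; rewrite /e1 /= mul0r.
Qed.

(* The base vertex of the part of facet ep at distance at least eta from the hyperplanes x_j = 0,
   j > 0: sets of diameter < 2 eta meet at most one such part. *)
Definition pieceP (b eta : R) ep : 'rV[R]_(2 + k.+1) :=
  facetP (@e1 R k.+3) ep b +
  (\row_(i < k.+3) (if unlift ord0 i is Some j then sg R (ep j) * eta else - (k.+2%:R * eta))).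

Lemma piece_coords b eta ep (y : 'rV[R]_k.+1) : 0 <= b -> simplex 1 y ->
  let p : 'rV[R]_k.+3 := pieceP b eta ep + y *m facetV (@e1 R k.+3) ep b in
  p 0 ord0 = 1 - b - k.+2%:R * eta /\
  exists z : 'I_k.+2 -> R, [/\ forall j, 0 <= z j, \sum_j z j = b &
    forall j, p 0 (lift ord0 j) = sg R (ep j) * (eta + z j)].
Proof.
move=> b0 [y0 ys] p.
have [] := facet_point (@e1 R k.+3) ep b y.
set q : 'rV[R]_k.+3 := facetP _ _ _ + _.
have pE i : p 0 i = q 0 i + (if unlift ord0 i is Some j then sg R (ep j) * eta else - (k.+2%:R * eta)).
  by rewrite /p /q /pieceP !mxE addrAC.
rewrite fcoef_e1 divr1.
have -> : \sum_i y 0 i * (b / fcoef (@e1 R k.+3) ep (lift ord0 i)) = (\sum_i y 0 i) * b.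
  by rewrite mulr_suml; apply: eq_bigr => i _; rewrite fcoef_e1 divr1.
move=> q0 q1 q2; split.
  by rewrite pE unlift_none q0; move: (\sum_i _) => s; ring.
exists (fun j => if unlift ord0 j is Some i then y 0 i * b else b * (1 - \sum_i y 0 i)); split.
- move=> j; case: unliftP => [i _|_]; first by rewrite mulr_ge0.
  by rewrite mulr_ge0 // subr_ge0.
- rewrite big_ord_recl unlift_none.
  rewrite [X in _ + X](eq_bigr (fun i => y 0 i * b)); last by move=> i _; rewrite liftK.
  by rewrite -mulr_suml; move: (\sum_i _) => s; ring.
- move=> j; rewrite pE liftK; case: (unliftP ord0 j) => [i ->|->].
    by rewrite q2 fcoef_e1 divr1; ring.
  by rewrite q1; ring.
Qed.

Lemma section_e1_lower t e eta s : 0 <= t -> 0 < eta -> k.+2%:R * eta < 1 - t -> e < 2 * eta ->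
  fcover e (rowset (section (@e1 R k.+3) t)) s ->
  Num.sqrt k.+2%:R / k.+1`!%:R * 2 ^+ k.+2 * (1 - t - k.+2%:R * eta) ^+ k.+1 <= cost k.+1 s.
Proof.
move=> t0 eta0 tk ee [s1 s2].
pose b := 1 - t - k.+2%:R * eta; have b0 : 0 < b by rewrite /b; lra.
rewrite -/b -sum_facet_vol_e1.
pose P ep : set 'rV[R]_k.+3 := simp (pieceP b eta ep) (facetV (@e1 R k.+3) ep b).
have Psec ep r : P ep r -> rowset (section (@e1 R k.+3) t) r /\
    forall j, eta <= sg R (ep j) * r 0 (lift ord0 j).
  move=> [y ys ->]; have [p0 [z [z0 zs pz]]] := piece_coords eta ep (ltW b0) ys.
  split; last by move=> j; rewrite pz sgK lerDl.
  apply/section_e1; split; first by rewrite p0 /b; ring.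
  rewrite (ger0_norm t0).
  have -> : \sum_j `|(pieceP b eta ep + y *m facetV (@e1 R k.+3) ep b : 'rV[R]_k.+3) 0 (lift ord0 j)| =
     \sum_(j < k.+2) (eta + z j).
    apply: eq_bigr => j _; rewrite pz normrM normr_sign mul1r ger0_norm //.
    by rewrite addr_ge0 // ltW.
  by rewrite big_split /= zs sumr_const card_ord -[_ *+ _]mulr_natl /b; ring.
pose meets ep (p : set 'rV[R]_k.+3 * R) := `[< exists2 r, P ep r & p.1 r >].
have lower ep : facet_vol (@e1 R k.+3) b ep <= cost k.+1 [seq p <- s | meets ep p].
  have c0 j : 0 < fcoef (@e1 R k.+3) ep j by rewrite fcoef_e1.
  have [L [Q [tL QQ VLQ _ dL]]] := facet_frame b0 c0 on_sphere_e1.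
  rewrite /facet_vol -dL.
  apply: (simplex_lower (w := pieceP b eta ep) (e := e) tL QQ VLQ); split.
    move=> r Pr; have [p ps pr] := s1 _ (Psec _ _ Pr).1.
    by exists p => //; rewrite mem_filter ps andbT; apply/asboolP; exists r.
  by move=> p; rewrite mem_filter => /andP [_ /s2].
apply: (le_trans (ler_sum _ (fun ep _ => lower ep))).
(* After the exchange of sums, a set of the cover is charged once for each piece that it meets,
   hence at most once. *)
rewrite /cost; under eq_bigr do rewrite big_filter big_mkcond /=.
rewrite exchange_big /= big_seq [leRHS]big_seq; apply: ler_sum => p ps.
have [/andP [p0 pe] pd] := s2 _ ps.
have C0 : 0 <= ball_vol R k.+1 * (p.2 / 2) ^+ k.+1.
  by rewrite mulr_ge0 ?(ltW (ball_vol_gt0 _ _)) // exprn_ge0 // divr_ge0.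
have uniqm ep ep' : meets ep p -> meets ep' p -> ep = ep'.
  move=> /asboolP [r /Psec [_ hr] pr] /asboolP [r' /Psec [_ hr'] pr'].
  apply/ffunP => j; apply/eqP; apply: contraT => ne.
  have := pd _ _ pr pr'.
  have : (2 * eta) ^+ 2 <= sqn (r - r').
    rewrite /sqn (bigD1 (lift ord0 j)) //= -[leLHS]addr0; apply: lerD; last first.
      by apply: sumr_ge0 => i _; exact: sqr_ge0.
    rewrite !mxE; have := hr j; have := hr' j.
    move: ne; case: (ep j); case: (ep' j) => // _; rewrite /sg ?expr1 ?expr0; nra.
  move=> h1 h2; have : (2 * eta) ^+ 2 <= p.2 ^+ 2 by exact: le_trans h2.
  rewrite ler_pXn2r ?nnegrE //; last by lra.
  lra.
case: (pickP (fun ep => meets ep p)) => [ep0 m0|none]; last first.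
  by rewrite big1 // => ep _; rewrite none.
rewrite (bigD1 ep0) //= m0 big1 ?addr0 // => ep ne.
by case: ifP => // m1; rewrite (uniqm _ _ m1 m0) eqxx in ne.
Qed.

End SectionVolume.

(** * Comparison with the section orthogonal to e1 *)

Section Inequality.
Variable R : realType.

Lemma sqr_ratio_le (a t c : R) : 0 < c -> c ^+ 2 = 1 / 2 -> c <= t -> t <= a -> a <= 1 ->
  (a - t) ^+ 2 <= (1 - t) ^+ 2 * (a * (2 * a ^+ 2 - 1)).
Proof.
move=> c0 c2 ct ta a1.
have c6 : 3 / 5 <= c by nra.
have c1 : c < 1 by nra.
(* The ratio (a - t) / (1 - t) decreases in t, which reduces the claim to t = c. *)
have h1 : (a - t) * (1 - c) <= (1 - t) * (a - c) by nra.
(* What remains after cancelling a - c, by 2 a^2 - 1 = 2 (a - c)(a + c). It is quadratic in a with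
   root 1; the other factor is at least 5 c - 3 on a <= 1, hence the bound 3/5 above. *)
have h2 : (a - c) <= 2 * (1 - c) ^+ 2 * (a * (a + c)).
  have : 0 <= (1 - a) * (c - (3 - 4 * c) * a).
    apply: mulr_ge0; first lra.
    have : 0 <= 3 - 4 * c by nra.
    nra.
  have -> : (1 - c) ^+ 2 = 3 / 2 - 2 * c by rewrite sqrrB c2; lra.
  have -> : (1 - a) * (c - (3 - 4 * c) * a) =
    2 * (3 / 2 - 2 * c) * (a * (a + c)) - (a - c) + (4 * c ^+ 2 - 2) * a by field.
  rewrite c2; lra.
have h3 : (a - c) ^+ 2 <= (1 - c) ^+ 2 * (a * (2 * a ^+ 2 - 1)).
  have -> : 2 * a ^+ 2 - 1 = 2 * ((a - c) * (a + c)) by rewrite -subr_sqr c2; lra.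
  have -> : (1 - c) ^+ 2 * (a * (2 * ((a - c) * (a + c)))) =
    (a - c) * (2 * (1 - c) ^+ 2 * (a * (a + c))) by ring.
  by rewrite expr2 ler_wpM2l //; lra.
have d0 : 0 < (1 - c) ^+ 2 by rewrite exprn_gt0 //; lra.
rewrite -(ler_pM2r d0) -exprMn.
apply: (@le_trans _ _ (((1 - t) * (a - c)) ^+ 2)).
  by rewrite lerXn2r ?nnegrE ?mulr_ge0 //; lra.
rewrite exprMn -[leRHS]mulrA; apply: ler_wpM2l; first exact: sqr_ge0.
by rewrite [leRHS]mulrC.
Qed.

(** For k >= 1 two factors are handled by [sqr_ratio_le], and the others by a - t <= (1 - t) a. *)
Lemma pow_ratio_le k (a t c : R) : 0 < c -> c ^+ 2 = 1 / 2 -> c <= t -> t <= a -> a <= 1 ->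
  (k = 0%N -> 3 / 4 <= t) ->
  (a - t) ^+ k.+1 * a <= ((1 - t) * a) ^+ k.+1 * (2 * a ^+ 2 - 1).
Proof.
move=> c0 c2 ct ta a1; case: k => [|k] H.
  have := H erefl => t34; rewrite !expr1.
  have : a - t <= (1 - t) * (2 * a ^+ 2 - 1).
    (* The product is the difference of the two sides. At a = 1 its second factor is 4 t - 3, the
       origin of 3/4. *)
    have : 0 <= (1 - a) * ((2 * t - 1) - 2 * (1 - t) * a) by apply: mulr_ge0; nra.
    lra.
  move=> h; rewrite [leRHS]mulrAC; apply: ler_wpM2r => //; lra.
have a0 : 0 <= a by lra.
have h := sqr_ratio_le c0 c2 ct ta a1.
have le1 : (a - t) ^+ k <= ((1 - t) * a) ^+ k by rewrite lerXn2r ?nnegrE //; nra.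
have le2 : (a - t) ^+ 2 * a <= ((1 - t) * a) ^+ 2 * (2 * a ^+ 2 - 1).
  apply: (le_trans (ler_wpM2r a0 h)).
  by rewrite le_eqVlt; apply/orP; left; apply/eqP; ring.
rewrite -[k.+2]addn2 !exprD -[leLHS]mulrA -[leRHS]mulrA; apply: ler_pM => //.
  by rewrite exprn_ge0 //; lra.
by apply: mulr_ge0 => //; exact: sqr_ge0.
Qed.

(** Weierstrass' inequality prod (1 - y_j / A) >= 1 - sum y_j / A, cleared of denominators. *)
Lemma prod_sub_ge m (A : R) (y : 'I_m -> R) : (forall j, 0 <= y j <= A) ->
  A ^+ m * (A - \sum_j y j) <= A * \prod_j (A - y j).
Proof.
elim: m y => [|m IH] y H; first by rewrite !big_ord0 expr0 mulr1 mul1r subr0.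
rewrite big_ord_recl [X in _ <= _ * X]big_ord_recl.
have := IH (fun j => y (lift ord0 j)) (fun j => H _).
have /andP [y0 yA] := H ord0.
set S := \sum_(i < m) _; set P := \prod_(i < m) _ => h.
have S0 : 0 <= S by apply: sumr_ge0 => j _; have /andP [] := H (lift ord0 j).
have Ay : 0 <= A - y ord0 by rewrite subr_ge0.
have A0 : 0 <= A ^+ m by rewrite exprn_ge0 // (le_trans y0).
have := ler_wpM2l Ay h => h2.
have -> : A * ((A - y ord0) * P) = (A - y ord0) * (A * P) by ring.
apply: le_trans h2.
have -> : (A - y ord0) * (A ^+ m * (A - S)) = A ^+ m * ((A - y ord0) * (A - S)) by ring.
rewrite exprS [A * _]mulrC -mulrA ler_wpM2l //.
have := mulr_ge0 y0 S0; lra.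
Qed.

(** With q, r the two roots, 2 q r <= q^2 + r^2 = 2 N + 1 - X^2 <= 2 N + 2 - 2 X. *)
Lemma sqrt_tangent (N X : R) : 0 < N -> 0 <= N + 1 - X ^+ 2 ->
  Num.sqrt (N + 1 - X ^+ 2) <= Num.sqrt N + (1 - X) / Num.sqrt N.
Proof.
move=> N0 u0; set r := Num.sqrt N; set q := Num.sqrt _.
have r0 : 0 < r by rewrite sqrtr_gt0.
have r2 : r ^+ 2 = N by rewrite sqr_sqrtr // ltW.
have q2 : q ^+ 2 = N + 1 - X ^+ 2 by rewrite sqr_sqrtr.
rewrite -(ler_pM2r r0) mulrDl divfK ?gt_eqF //.
have := sqr_ge0 (q - r); have := sqr_ge0 (X - 1); rewrite !sqrrB q2 r2; nra.
Qed.

Section Weights.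
Variables (m : nat) (z : R) (u : 'I_m -> R).
Hypothesis z0 : 0 < z.
Hypothesis uz : forall j, u j ^+ 2 < z ^+ 2.

Let fc (ep : {ffun 'I_m -> bool}) j : R := z - sg R (ep j) * u j.
Let W : R := \prod_j (2 * z / (z ^+ 2 - u j ^+ 2)).

Let nz j : z - u j != 0 /\ z + u j != 0.
Proof.
have : z ^+ 2 - u j ^+ 2 != 0 by rewrite gt_eqF // subr_gt0.
by rewrite subr_sqr mulf_eq0 negb_or => /andP.
Qed.

Let sumb j : \sum_(b : bool) (z - sg R b * u j)^-1 = 2 * z / (z ^+ 2 - u j ^+ 2).
Proof.
have [n1 n2] := nz j.
rewrite big_bool /= /sg expr1 expr0 mul1r mulN1r opprK subr_sqr.
by field; rewrite n1 n2.
Qed.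

Let sumb_sg j : \sum_(b : bool) (z - sg R b * u j)^-1 * (sg R b * u j) =
  2 * z / (z ^+ 2 - u j ^+ 2) * (u j ^+ 2 / z).
Proof.
have [n1 n2] := nz j.
rewrite big_bool /= /sg expr1 expr0 mul1r mulN1r opprK subr_sqr.
by field; rewrite n1 n2 gt_eqF.
Qed.

(** The weights form a product measure on the sign vectors, so the sum factors over the coordinates.
    The next lemma changes the factor i only. *)
Lemma sum_weights : \sum_ep (\prod_j fc ep j)^-1 = W.
Proof.
rewrite /W; under [RHS]eq_bigr do rewrite -sumb.
by rewrite bigA_distr_bigA /=; apply: eq_bigr => ep _; rewrite prodfV.
Qed.

Lemma sum_weights_sg i : \sum_ep (\prod_j fc ep j)^-1 * (sg R (ep i) * u i) = W * (u i ^+ 2 / z).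
Proof.
have -> : W * (u i ^+ 2 / z) = \prod_j \sum_(b : bool)
    ((z - sg R b * u j)^-1 * (if j == i then sg R b * u j else 1)).
  rewrite /W (bigD1 i) //= [RHS](bigD1 i) //= eqxx sumb_sg mulrAC; congr (_ * _).
  apply: eq_bigr => j /negbTE ji; rewrite ji -sumb.
  by apply: eq_bigr => b _; rewrite mulr1.
rewrite bigA_distr_bigA /=; apply: eq_bigr => ep _.
rewrite big_split /= prodfV; congr (_ * _).
by rewrite (bigD1 i) //= eqxx big1 ?mulr1 // => j /negbTE ->.
Qed.

Lemma sum_weights_proj : z ^+ 2 + \sum_j u j ^+ 2 = 1 ->
  \sum_ep (\prod_j fc ep j)^-1 * (z + \sum_j sg R (ep j) * u j) = W / z.
Proof.
move=> h1.
under eq_bigr do rewrite mulrDr mulr_sumr.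
rewrite big_split /= -mulr_suml sum_weights exchange_big /=.
under [X in _ + X]eq_bigr do rewrite sum_weights_sg.
rewrite -mulr_sumr -mulr_suml -mulrDr; congr (_ * _).
have -> : \sum_j u j ^+ 2 = 1 - z ^+ 2 by lra.
by field; rewrite gt_eqF.
Qed.

End Weights.

Lemma sum_facet_vol_le k (a : 'I_k.+3 -> R) (t c : R) : on_sphere a ->
  0 < c -> c ^+ 2 = 1 / 2 -> c < t -> t < a ord0 -> (k = 0%N -> 3 / 4 <= t) ->
  (forall ep j, 0 < fcoef a ep j) ->
  \sum_(ep : {ffun 'I_k.+2 -> bool}) facet_vol a (a ord0 - t) ep <=
  Num.sqrt k.+2%:R / k.+1`!%:R * 2 ^+ k.+2 * (1 - t) ^+ k.+1.
Proof.
move=> ha c0 c2 ct ta tk fc0.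
pose z := a ord0; pose u j := a (lift ord0 j); pose b := z - t.
have b0 : 0 < b by rewrite subr_gt0.
have z0 : 0 < z by rewrite /z; lra.
have zu : z ^+ 2 + \sum_j u j ^+ 2 = 1 by move: ha; rewrite /on_sphere big_ord_recl.
have S0 : 0 <= \sum_j u j ^+ 2 by apply: sumr_ge0 => j _; exact: sqr_ge0.
have z1 : z <= 1 by nra.
have z2 : c ^+ 2 < z ^+ 2 by rewrite ltrXn2r ?nnegrE //; rewrite /z; lra.
have uz j : u j ^+ 2 < z ^+ 2.
  have : u j ^+ 2 <= \sum_j u j ^+ 2.
    by rewrite (bigD1 j) //= lerDl sumr_ge0 // => i _; exact: sqr_ge0.
  lra.
pose r : R := Num.sqrt k.+2%:R.
have r0 : 0 < r by rewrite sqrtr_gt0 ltr0n.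
have F0 : 0 < k.+1`!%:R :> R by rewrite ltr0n fact_gt0.
pose W : R := \prod_j (2 * z / (z ^+ 2 - u j ^+ 2)).
have W0 : 0 < W.
  by apply: prodr_gt0 => j _; rewrite divr_gt0 ?subr_gt0 // mulr_gt0.
apply: (@le_trans _ _ (\sum_(ep : {ffun 'I_k.+2 -> bool})
   (b ^+ k.+1 / k.+1`!%:R * ((r + r^-1) * (\prod_j fcoef a ep j)^-1 - r^-1 * ((\prod_j fcoef a ep j)^-1 * fproj a ep))))).
  apply: ler_sum => ep _.
  have [L [Q [_ _ _ u0 _]]] := facet_frame b0 (fc0 ep) ha.
  rewrite -[k.+3%:R]natr1 in u0.
  have N0 : 0 < k.+2%:R :> R by rewrite ltr0n.
  have := sqrt_tangent N0 u0; rewrite -/r => h.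
  have P0 : 0 < \prod_j fcoef a ep j by apply: prodr_gt0.
  have C0 : 0 <= b ^+ k.+1 / (\prod_j fcoef a ep j) / k.+1`!%:R.
    by rewrite !divr_ge0 ?exprn_ge0 // ltW.
  have := ler_wpM2l C0 h; rewrite /facet_vol -/z -/b natr1.
  rewrite mulrAC => /le_trans; apply.
  rewrite le_eqVlt; apply/orP; left; apply/eqP.
  move: (\prod_j _)^-1 (fproj _ _) (b ^+ _) (k.+1`!%:R^-1) (r^-1) => *; ring.
rewrite -mulr_sumr sumrB -!mulr_sumr sum_weights // sum_weights_proj // -/W.
apply: (@le_trans _ _ (b ^+ k.+1 / k.+1`!%:R * (r * W))).
  rewrite ler_wpM2l //; first by rewrite divr_ge0 ?exprn_ge0 // ltW.
  (* The mean 1/z of X is at least 1, so the linear term of the tangent contributes a non-positive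
     amount. *)
  rewrite mulrDl -addrA gerDl -mulrBr pmulr_rle0 ?invr_gt0 // subr_le0.
  by rewrite ler_pdivlMr // ler_piMr // ltW.
have key : b ^+ k.+1 * W <= 2 ^+ k.+2 * (1 - t) ^+ k.+1.
  have WE : W = 2 ^+ k.+2 * z ^+ k.+2 / \prod_j (z ^+ 2 - u j ^+ 2).
    by rewrite /W big_split /= prodfV prodr_const card_ord exprMn.
  pose P : R := \prod_j (z ^+ 2 - u j ^+ 2).
  have P0 : 0 < P by apply: prodr_gt0 => j _; rewrite subr_gt0.
  rewrite WE -/P [leLHS]mulrA ler_pdivrMr //.
  (* With A = z^2 and sum_j u_j^2 = 1 - z^2, the product of the z^2 - u_j^2 is bounded below in
     terms of z alone. *)
  have := @prod_sub_ge _ (z ^+ 2) (fun j => u j ^+ 2) _; rewrite -/P => hP.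
  have {}hP := hP (fun j => ltac:(by rewrite sqr_ge0 ltW)).
  have hP2 : (z ^+ 2) ^+ k.+1 * (2 * z ^+ 2 - 1) <= P.
    rewrite -(ler_pM2l (exprn_gt0 2 z0)); apply: le_trans hP.
    have -> : z ^+ 2 - \sum_j u j ^+ 2 = 2 * z ^+ 2 - 1 by lra.
    by rewrite [X in _ <= X * _](exprS _ k.+1) -[leRHS]mulrA.
  have := @pow_ratio_le k z t c c0 c2 (ltW ct) (ltW ta) z1 tk; rewrite -/b => h.
  have t1 : 0 <= 1 - t by rewrite /z in z1; lra.
  have h2 : b ^+ k.+1 * z ^+ k.+2 <= (1 - t) ^+ k.+1 * P.
    apply: (@le_trans _ _ ((1 - t) ^+ k.+1 * ((z ^+ 2) ^+ k.+1 * (2 * z ^+ 2 - 1)))); last first.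
      by rewrite ler_wpM2l // exprn_ge0.
    have zk : 0 <= z ^+ k.+1 by rewrite exprn_ge0 // ltW.
    have := ler_wpM2r zk h; rewrite exprMn [(z ^+ 2) ^+ _]exprAC expr2 (exprS z k.+1).
    by move: (b ^+ _) (z ^+ k.+1) ((1 - t) ^+ _) => A B C; lra.
  have p2 : 0 <= 2 ^+ k.+2 :> R by rewrite exprn_ge0.
  by rewrite [leLHS]mulrCA -[leRHS]mulrA ler_wpM2l.
have rf : 0 <= r / k.+1`!%:R by rewrite divr_ge0 // ltW.
rewrite -/r -[leRHS]mulrA; apply: (le_trans _ (ler_wpM2l rf key)).
by rewrite le_eqVlt; apply/orP; left; apply/eqP; move: (b ^+ _) (W) => B E; ring.
Qed.

End Inequality.

(** * Hausdorff measure of the sections *)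

Section Perimeter.
Variable R : realType.

Lemma hausdorff_ge0 k n (A : set ('I_n -> R)) : (0 <= hausdorff k.+1 A)%E.
Proof.
apply: (@le_trans _ _ (hcontent k.+1 1 A)); last by apply: ereal_sup_ubound; exists 1.
apply: le_ereal_inf_tmp => _ [U [_ [_ ->]]].
by apply: nneseries_ge0 => i _ _; exact: hterm_ge0.
Qed.

Lemma sum_continuous n (f : 'I_n -> 'rV[R]_n -> R) :
  (forall i, continuous (f i)) -> continuous (fun r => \sum_i f i r).
Proof.
by move=> fc r; apply: cvg_big; [exact: add_continuous | exact: nbhs_filter | move=> i _; exact: fc].
Qed.

Lemma compact_section k (a : 'I_k.+2 -> R) t : compact (rowset (section a t)).
Proof.
have cB : compact [set r : 'rV[R]_k.+2 | forall i, (`[(-1 : R), 1]%classic : set R) (r ord0 i)].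
  exact: (@rV_compact R k.+2 (fun=> `[(-1 : R), 1]%classic) (fun=> @segment_compact R (-1) 1)).
apply: subclosed_compact cB _.
- have -> : rowset (section a t) =
    (fun r : 'rV[R]_k.+2 => \sum_i a i * r 0 i) @^-1` [set x | x = t] `&`
    (fun r : 'rV[R]_k.+2 => \sum_i `|r 0 i|) @^-1` [set x | x = 1] by [].
  apply: closedI; (apply: preimage_closed; last exact: closed_eq) => r _.
    apply: sum_continuous => i {}r.
    by apply: continuousM; [exact: cst_continuous | exact: coord_continuous].
  apply: sum_continuous => i {}r.
  by apply: continuous_comp; [exact: coord_continuous | exact: norm_continuous].
- move=> r [_]; rewrite /cross_boundary /= /l1norm => h i /=.
  rewrite in_itv /= -ler_norml -h (bigD1 i) //= lerDl; apply: sumr_ge0 => j _; exact: normr_ge0.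
Qed.

Definition e1_perimeter k (t : R) : R := Num.sqrt k.+2%:R / k.+1`!%:R * 2 ^+ k.+2 * (1 - t) ^+ k.+1.

Lemma e1_perimeter_ge0 k t : t <= 1 -> 0 <= e1_perimeter k t.
Proof.
move=> t1; apply: mulr_ge0; last by rewrite exprn_ge0 // subr_ge0.
by rewrite mulr_ge0 ?divr_ge0 ?sqrtr_ge0 ?exprn_ge0.
Qed.

Lemma hausdorff_e1_ge k t : 0 <= t <= 1 ->
  ((e1_perimeter k t)%:E <= hausdorff k.+1 (section (@e1 R k.+3) t))%E.
Proof.
move=> /andP [t0]; rewrite le_eqVlt => /orP [/eqP ->|t1].
  by rewrite /e1_perimeter subrr expr0n mulr0; exact: hausdorff_ge0.
apply/lee_addgt0Pr => d d0.
pose s := 1 - t; have s0 : 0 < s by rewrite subr_gt0.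
pose c : R := Num.sqrt k.+2%:R / k.+1`!%:R * 2 ^+ k.+2.
have c0 : 0 < c by rewrite mulr_gt0 ?divr_gt0 ?exprn_gt0 ?sqrtr_gt0 ?ltr0n ?fact_gt0.
(* Replacing s by s - h lowers c s^(k+1) by at most K h, and h is chosen so that this is at most
   d. *)
pose K := c * (k.+1%:R * s ^+ k).
have K0 : 0 < K by rewrite mulr_gt0 // mulr_gt0 ?ltr0n // exprn_gt0.
pose h := Num.min (s / 2) (d / K).
have h0 : 0 < h by rewrite lt_min !divr_gt0.
have hs : h <= s / 2 by rewrite ge_min lexx.
have hd : h * K <= d by rewrite -ler_pdivlMr // ge_min lexx orbT.
have k2 : 0 < k.+2%:R :> R by rewrite ltr0n.
pose eta := h / k.+2%:R.
have eta0 : 0 < eta by rewrite divr_gt0.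
have eh : k.+2%:R * eta = h by rewrite mulrC divfK // gt_eqF.
have lo : ((c * (s - h) ^+ k.+1)%:E <= hausdorff k.+1 (section (@e1 R k.+3) t))%E.
  apply: (hausdorff_ge (@compact_section _ _ _) eta0) => cov hcov.
  rewrite -eh; apply: section_e1_lower hcov => //; rewrite ?eh; rewrite -/s; lra.
apply: (@le_trans _ _ ((c * (s - h) ^+ k.+1)%:E + d%:E)%E); last by rewrite leeD2r.
rewrite -EFinD lee_fin /e1_perimeter -/s -/c.
have hs' : h <= s by lra.
have /andP [_ u] := exprB_le k (ltW h0) hs'.
have := ler_wpM2l (ltW c0) u; rewrite mulrBr.
have -> : c * (k.+1%:R * h * s ^+ k) = h * K by rewrite /K; ring.
by move: (c * _) (c * _) (h * K) hd => x y z; lra.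
Qed.

Section Bounds.
Variables (k : nat) (a : 'I_k.+2 -> R) (t c : R).
Hypotheses (ha : on_sphere a) (c0 : 0 < c) (c2 : c ^+ 2 = 1 / 2) (ct : c < t) (ta : t <= a ord0).

(** a_j^2 <= 1 - a_0^2 <= 1 - t^2 < 1/2 < t^2. *)
Lemma small_coord j : `|a (lift ord0 j)| < t.
Proof.
have t0 : 0 < t := lt_trans c0 ct.
rewrite -(ltr_pXn2r (n := 2)) ?nnegrE ?(ltW t0) // real_normK ?num_real //.
have : c ^+ 2 < t ^+ 2 by rewrite ltrXn2r ?nnegrE ?(ltW c0) ?(ltW t0).
have : t ^+ 2 <= a ord0 ^+ 2 by rewrite lerXn2r ?nnegrE ?(ltW t0) // (le_trans (ltW t0)).
move: ha; rewrite /on_sphere big_ord_recl (bigD1 j) //=.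
have : 0 <= \sum_(i < k.+1 | i != j) a (lift ord0 i) ^+ 2.
  by apply: sumr_ge0 => i _; exact: sqr_ge0.
rewrite c2; lra.
Qed.

Lemma fcoef_gt0 ep j : 0 < fcoef a ep j.
Proof.
move: (ta) (small_coord j); rewrite /fcoef /sg ltr_norml.
by case: (ep j); rewrite ?expr1 ?expr0; lra.
Qed.

(** If x_0 < 0, then the product of a and x is less than t sum_{j>0} |x_j| = t (1 + x_0) < t. *)
Lemma section_ge0 x : section a t x -> 0 <= x ord0.
Proof.
move=> [h1 h2]; rewrite leNgt; apply/negP => x0.
have t0 : 0 < t := lt_trans c0 ct.
have e1 : a ord0 * x ord0 + \sum_j a (lift ord0 j) * x (lift ord0 j) = t.
  by rewrite -[RHS]h1 [RHS]big_ord_recl.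
have e2 : - x ord0 + \sum_j `|x (lift ord0 j)| = 1.
  by rewrite -[RHS]h2 /l1norm [RHS]big_ord_recl (ltr0_norm x0).
have le : \sum_j a (lift ord0 j) * x (lift ord0 j) <= t * \sum_j `|x (lift ord0 j)|.
  rewrite mulr_sumr; apply: ler_sum => j _; apply: (le_trans (ler_norm _)).
  by rewrite normrM ler_wpM2r // ltW // small_coord.
have : a ord0 * x ord0 < 0 by rewrite pmulr_rlt0 // (lt_le_trans t0).
have : t * x ord0 < 0 by rewrite pmulr_rlt0.
nra.
Qed.

(** For t = a_0 the simplices have b = 0 and collapse to the vertex e_0. *)
Lemma section_degenerate x : a ord0 = t -> section a t x -> forall j, x (lift ord0 j) = 0.
Proof.
move=> e xs j; have := section_sum xs (section_ge0 xs); rewrite e subrr => /eqP.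
have ge i : (t - `|a (lift ord0 i)|) * `|x (lift ord0 i)| <=
    t * `|x (lift ord0 i)| - a (lift ord0 i) * x (lift ord0 i).
  by rewrite mulrBl lerD2l lerN2 -normrM ler_norm.
have pos i : 0 < t - `|a (lift ord0 i)| by rewrite subr_gt0 small_coord.
rewrite psumr_eq0; last by move=> i _; apply: le_trans (ge i); rewrite mulr_ge0 // ltW.
move=> /allP /(_ j (mem_index_enum _)) /= /eqP h.
have := ge j; rewrite h pmulr_rle0 // normr_le0 => /eqP //.
Qed.

End Bounds.

Lemma section_ub k (a : 'I_k.+3 -> R) (t c : R) : on_sphere a ->
  0 < c -> c ^+ 2 = 1 / 2 -> c < t -> t <= a ord0 -> (k = 0%N -> 3 / 4 <= t) ->
  forall e d : R, 0 < e -> 0 < d -> hcov k.+1 e (e1_perimeter k t + d) (rowset (section a t)).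
Proof.
move=> ha c0 c2 ct ta tk e d e0 d0.
move: (ta); rewrite le_eqVlt => /orP [/eqP eta|lta]; last first.
  apply: (@hcov_le _ _ _ e (\sum_(ep : {ffun 'I_k.+2 -> bool}) facet_vol a (a ord0 - t) ep + d)) => //.
    rewrite lerD2r; apply: (sum_facet_vol_le ha c0 c2) => //.
    exact: (fcoef_gt0 ha c0 c2 ct ta).
  apply: section_hcov => //; first exact: (fcoef_gt0 ha c0 c2 ct ta).
  by move=> x; exact: (section_ge0 ha c0 c2 ct ta).
have t1 : t <= 1.
  have : a ord0 ^+ 2 <= 1.
    by move: ha; rewrite /on_sphere big_ord_recl => <-; rewrite lerDl sumr_ge0 // => i _; exact: sqr_ge0.
  rewrite -eta; nra.
have [rho rho0 [re rd]] := enlarge_diam k (lexx (0 : R)) e0 d0.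
apply: (@hcov_le _ _ _ (0 + 2 * rho) (ball_vol R k.+1 * ((0 + 2 * rho) / 2) ^+ k.+1)) => //.
  by apply: (le_trans rd); rewrite mul0r expr0n mulr0 lerD2r e1_perimeter_ge0.
apply: hcov_single; first by lra.
move=> x y xs ys.
have -> : x = y.
  have H (r : 'rV[R]_k.+3) : rowset (section a t) r -> (forall j, r 0 (lift ord0 j) = 0) /\ r 0 ord0 = 1.
    move=> rs; have z := section_degenerate ha c0 c2 ct ta (esym eta) rs; split => //.
    have r0 := section_ge0 ha c0 c2 ct ta rs.
    have : l1norm (fun i => r 0 i) = 1 by case: rs.
    by rewrite /l1norm big_ord_recl (ger0_norm r0) big1 ?addr0 // => j _; rewrite z normr0.
  have [zx x1] := H _ xs; have [zy y1] := H _ ys.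
  apply/rowP => i; case: (unliftP ord0 i) => [j ->|->]; first by rewrite zx zy.
  by rewrite x1 y1.
rewrite subrr /sqn big1; first exact: sqr_ge0.
by move=> i _; rewrite mxE expr0n.
Qed.

(* A signed permutation of the coordinates moves the index i to position 0. *)
Lemma section_ub_abs k (a : 'I_k.+3 -> R) (t c : R) i : on_sphere a ->
  0 < c -> c ^+ 2 = 1 / 2 -> c < t -> t <= `|a i| -> (k = 0%N -> 3 / 4 <= t) ->
  forall e d : R, 0 < e -> 0 < d -> hcov k.+1 e (e1_perimeter k t + d) (rowset (section a t)).
Proof.
move=> ha c0 c2 ct ta tk e d e0 d0.
pose s := fun j => sg R (a j < 0).
pose p := tperm ord0 i.
have ss j : s j * s j = 1 by rewrite -expr2 sqrr_sign.
pose a' j := s (p j) * a (p j).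
have ha' : on_sphere a'.
  rewrite /on_sphere -[RHS]ha [RHS](reindex_inj (@perm_inj _ p)) /=.
  by apply: eq_bigr => j _; rewrite /a' exprMn expr2 ss mul1r.
have ta' : t <= a' ord0.
  by rewrite /a' tpermL /s /sg -normrEsign.
pose f (r : 'rV[R]_k.+3) : 'rV[R]_k.+3 := \row_j (s j * r 0 (p j)).
have pp j : p (p j) = j by rewrite tpermK.
have fiso x y : sqn (f x - f y) = 1 ^+ 2 * sqn (x - y).
  rewrite expr1n mul1r /sqn (reindex_inj (@perm_inj _ p)) /=.
  apply: eq_bigr => j _; rewrite !mxE pp -mulrBr exprMn [s _ ^+ 2]expr2 ss mul1r //.
have := hcov_sim ler01 fiso (section_ub ha' c0 c2 ct ta' tk e0 d0).
rewrite expr1n !mul1r; apply: hcov_sub => r [h1 h2].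
exists (\row_j (s (p j) * r 0 (p j))).
  split.
    rewrite /hyperplane /= -[RHS]h1 /dotp [RHS](reindex_inj (@perm_inj _ p)) /=.
    by apply: eq_bigr => j _; rewrite /a' mxE mulrACA ss mul1r.
  rewrite /cross_boundary /= -[RHS]h2 /l1norm [RHS](reindex_inj (@perm_inj _ p)) /=.
  by apply: eq_bigr => j _; rewrite mxE normrM normr_sign mul1r.
by apply/rowP => j; rewrite !mxE pp mulrA ss mul1r.
Qed.

Lemma hausdorff_section_le k (a : 'I_k.+3 -> R) (t c : R) : on_sphere a ->
  0 < c -> c ^+ 2 = 1 / 2 -> c < t -> t <= 1 -> (k = 0%N -> 3 / 4 <= t) ->
  (hausdorff k.+1 (section a t) <= (e1_perimeter k t)%:E)%E.
Proof.
move=> ha c0 c2 ct t1 tk; apply: hausdorff_le => e d e0 d0.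
case: (pickP (fun i => t <= `|a i|)) => [i ti|none].
  exact: (section_ub_abs ha c0 c2 ct ti tk).
(* All |a_i| are below t, so the hyperplane misses the cross-polytope and the empty cover
   suffices. *)
exists [::]; last by rewrite /cost big_nil addr_ge0 ?e1_perimeter_ge0 // ltW.
split => // r [h1 h2]; exfalso.
have small i : `|a i| < t by rewrite ltNge none.
have le i : a i * r 0 i <= t * `|r 0 i|.
  by apply: (le_trans (ler_norm _)); rewrite normrM ler_wpM2r // ltW.
have r0 i : r 0 i = 0.
  have := h1; rewrite -[t]mulr1 -h2 /hyperplane /= /dotp /l1norm mulr_sumr => /esym /eqP.
  rewrite -subr_eq0 -sumrB psumr_eq0; last by move=> j _; rewrite subr_ge0.
  move=> /allP /(_ i (mem_index_enum _)) /=; rewrite subr_eq0 => /eqP e1.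
  apply/eqP; apply: contraT => rn.
  have : `|a i| * `|r 0 i| < t * `|r 0 i| by rewrite ltr_pM2r ?normr_gt0.
  by rewrite e1 -normrM ltNge ler_norm.
move: h2; rewrite /cross_boundary /= /l1norm big1 => [/eqP|i _]; last by rewrite r0 normr0.
by rewrite eq_sym oner_eq0.
Qed.

Lemma perimeter_section k (a : 'I_k.+3 -> R) t : perimeter a t = hausdorff k.+1 (section a t).
Proof. by rewrite /perimeter /section subn2. Qed.

End Perimeter.

Theorem theorem3 (R : realType) (n : nat) (t : R) :
  ((4 <= n)%N /\ 1 / Num.sqrt 2 < t <= 1) \/ (n = 3%N /\ 4 / 5 < t <= 1) ->
  perimeter (@e1 R n) t =
    ((Num.sqrt (n - 1)%:R / (n - 2)`!%:R) * 2 ^+ (n - 1) * (1 - t) ^+ (n - 2))%:E /\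
  (forall a : 'I_n -> R, on_sphere a -> (perimeter a t <= perimeter (@e1 R n) t)%E).
Proof.
move=> H; pose c : R := 1 / Num.sqrt 2.
have s0 : 0 < Num.sqrt 2 :> R by rewrite sqrtr_gt0.
have c0 : 0 < c by rewrite divr_gt0.
have c2 : c ^+ 2 = 1 / 2 by rewrite expr_div_n expr1n sqr_sqrtr.
have [k nk] : exists k, n = k.+3.
  by case: H => [[n4 _]|[-> _]]; [exists (n - 3)%N; lia | exists 0%N].
have [ct t1 tk] : [/\ c < t, t <= 1 & k = 0%N -> 3 / 4 <= t].
  case: H => [[n4 /andP [ct t1]]|[n3 /andP [t45 t1]]]; split => //; try lra.
  - by move=> k0; move: n4; rewrite nk k0.
  - nra.
rewrite {}nk subn1 subn2 /= -/(e1_perimeter k t).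
have t0 : 0 <= t <= 1 by rewrite t1 andbT; lra.
have E : perimeter (@e1 R k.+3) t = (e1_perimeter k t)%:E.
  rewrite perimeter_section; apply/eqP; rewrite eq_le hausdorff_e1_ge // andbT.
  by apply: (hausdorff_section_le (c := c)) => //; exact: on_sphere_e1.
split; first by rewrite E.
by move=> a ha; rewrite E perimeter_section; exact: (hausdorff_section_le (c := c)).
Qed.
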